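(* Let $d\geq 2$ be an integer, written as $d=2m-1$ or $d=2m$. For every integer $e\geq 1$, $$\mathrm{HK}_e(R_{2,d})=\begin{cases}\dfrac{2^m}{2^m-1}2^{de}-\dfrac{(2^{m-1})^e}{2^m-1}, & \text{if } d=2m-1;\\[2mm] \dfrac{2^m+1}{2^m}2^{de}, & \text{if } d=2m.\end{cases}$$ In particular, the Hilbert–Kunz multiplicity of an $A_1$ singularity in characteristic 2 is $$e_{\mathrm{HK}}(R_{2,d})=\begin{cases}\dfrac{2^m}{2^m-1}, & \text{if } d=2m-1;\\[2mm] \dfrac{2^m+1}{2^m}, & \text{if } d=2m.\end{cases}$$
   Context: For a Noetherian local ring $(R,\mathfrak{m})$ of prime characteristic $p$ and dimension $d$, let $\mathfrak{m}^{[p^e]}=(a^{p^e}:a\in\mathfrak{m})$, $\mathrm{HK}_e(R)=\operatorname{length}_R(R/\mathfrak{m}^{[p^e]})$ (the Hilbert–Kunz function), and $e_{\mathrm{HK}}(R)=\lim_{e\to\infty}\mathrm{HK}_e(R)/p^{ed}$ (the Hilbert–Kunz multiplicity). The $A_1$ singularity in characteristic 2 is $R_{2,d}=\mathbb{F}_2[[x_0,\dots,x_d]]/(Q_d)$, where $Q_d=x_0x_1+x_2x_3+\dots+x_{d-1}x_d$ if $d$ is odd and $Q_d=x_0x_1+\dots+x_{d-2}x_{d-1}+x_d^2$ if $d$ is even. *)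

(* Defs.v *)
From HB Require Import structures.
From mathcomp Require Import all_boot all_order all_algebra generic_quotient ring_quotient.
From mathcomp Require Import boolp.
From mathcomp Require mpoly.

Set Implicit Arguments.
Unset Strict Implicit.
Unset Printing Implicit Defensive.

Import GRing.Theory.
Local Open Scope ring_scope.

(* Formal power series in n variables over R: arbitrary families of
   coefficients indexed by the monomials of [mpoly]. *)
Record mfps (n : nat) (R : Type) := MFPS { mfps_coef : mpoly.multinom n -> R }.

(* The notations of [mpoly] clash with those of mathcomp-analysis; the import
   ends with this section. *)
Section PowerSeries.
Import mpoly.
Variables (n : nat) (R : comNzRingType).
Implicit Types (f g h : mfps n R) (m : 'X_{1..n}).

HB.instance Definition _ := [isNew for @mfps_coef n R].
HB.instance Definition _ := [Choice of mfps n R by <:].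

Lemma mfpsP f g : mfps_coef f =1 mfps_coef g -> f = g.
Proof. by case: f g => [f] [g] /= /funext ->. Qed.

Definition mfps_zero : mfps n R := MFPS (fun=> 0).
Definition mfps_opp f : mfps n R := MFPS (fun m => - mfps_coef f m).
Definition mfps_add f g : mfps n R :=
  MFPS (fun m => mfps_coef f m + mfps_coef g m).
Definition mfps_one : mfps n R := MFPS (fun m => (m == 0%MM)%:R).

(* Cauchy product; the degree bounds only make the index type finite. *)
Definition mfps_mul f g : mfps n R :=
  MFPS (fun m =>
    \sum_(k : 'X_{1..n < (mdeg m).+1, (mdeg m).+1} | m == (k.1 + k.2)%MM)
      mfps_coef f k.1 * mfps_coef g k.2).

Definition mfps_var (i : 'I_n) : mfps n R := MFPS (fun m => (m == U_(i)%MM)%:R).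

Lemma mfps_addA : associative mfps_add.
Proof. by move=> f g h; apply: mfpsP => m /=; rewrite addrA. Qed.
Lemma mfps_addC : commutative mfps_add.
Proof. by move=> f g; apply: mfpsP => m /=; rewrite addrC. Qed.
Lemma mfps_add0 : left_id mfps_zero mfps_add.
Proof. by move=> f; apply: mfpsP => m /=; rewrite add0r. Qed.
Lemma mfps_addN : left_inverse mfps_zero mfps_opp mfps_add.
Proof. by move=> f; apply: mfpsP => m /=; rewrite addNr. Qed.

HB.instance Definition _ := GRing.isZmodule.Build (mfps n R)
  mfps_addA mfps_addC mfps_add0 mfps_addN.

Definition mfps_trunc (k : nat) f : {mpoly R[n]} :=
  \sum_(m : 'X_{1..n < k}) mfps_coef f m *: 'X_[m].

Lemma mfps_truncE k f m : (mdeg m < k)%N -> (mfps_trunc k f)@_m = mfps_coef f m.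
Proof. exact: mcoeff_mpoly. Qed.

Lemma mfps_mulE k f g m (p q : {mpoly R[n]}) : (mdeg m < k)%N ->
  (forall a, (mdeg a < k)%N -> p@_a = mfps_coef f a) ->
  (forall a, (mdeg a < k)%N -> q@_a = mfps_coef g a) ->
  mfps_coef (mfps_mul f g) m = (p * q)@_m.
Proof.
move=> mk pf qg; rewrite mcoeffM /=; apply: eq_bigr => [[a b]] /= _.
by rewrite pf ?qg //; apply: leq_trans mk; rewrite bmdeg.
Qed.

Lemma mfps_mulA : associative mfps_mul.
Proof.
move=> f g h; apply: mfpsP => m; pose k := (mdeg m).+1.
have T u a : (mdeg a < k)%N -> (mfps_trunc k u)@_a = mfps_coef u a.
  exact: mfps_truncE.
have TM u v a : (mdeg a < k)%N ->
    (mfps_trunc k u * mfps_trunc k v)@_a = mfps_coef (mfps_mul u v) a.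
  by move=> ak; rewrite (mfps_mulE ak (T u) (T v)).
rewrite (mfps_mulE (ltnSn _) (T f) (TM g h)) mulrA.
by rewrite (mfps_mulE (ltnSn _) (TM f g) (T h)).
Qed.

Lemma mfps_mulC : commutative mfps_mul.
Proof.
move=> f g; apply: mfpsP => m; have T := @mfps_truncE (mdeg m).+1.
by rewrite (mfps_mulE (ltnSn _) (T f) (T g)) mulrC -(mfps_mulE (ltnSn _) (T g) (T f)).
Qed.

Lemma mfps_mul1 : left_id mfps_one mfps_mul.
Proof.
move=> f; apply: mfpsP => m; have T := @mfps_truncE (mdeg m).+1.
by rewrite (@mfps_mulE _ _ _ _ 1 _ (ltnSn _) _ (T f)) ?mul1r ?T // => a _; rewrite mcoeff1.
Qed.

Lemma mfps_mulDl : left_distributive mfps_mul mfps_add.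
Proof.
move=> f g h; apply: mfpsP => m /=; rewrite -big_split /=.
by apply: eq_bigr => k _; rewrite mulrDl.
Qed.

Lemma mfps_one_neq0 : mfps_one != 0.
Proof.
apply/eqP => /(congr1 (fun f => mfps_coef f 0%MM)) /= /eqP.
by rewrite eqxx oner_eq0.
Qed.

HB.instance Definition _ := GRing.Zmodule_isComNzRing.Build (mfps n R)
  mfps_mulA mfps_mulC mfps_mul1 mfps_mulDl mfps_one_neq0.

Lemma mfps_coef0M f g :
  mfps_coef (f * g) 0%MM = mfps_coef f 0%MM * mfps_coef g 0%MM.
Proof.
have T u : forall a, (mdeg a < 1)%N -> (mfps_trunc 1 u)@_a = mfps_coef u a.
  exact: mfps_truncE.
have d0 : (mdeg (0%MM : 'X_{1..n}) < 1)%N by rewrite mdeg0.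
rewrite (mfps_mulE d0 (T f) (T g)).
by rewrite (mcoeff0_is_multiplicative n R).1 !T.
Qed.

Lemma mfps_var_coef0 i : mfps_coef (mfps_var i) 0%MM = 0.
Proof. by rewrite /= eq_sym mnm1_eq0. Qed.

End PowerSeries.

From mathcomp Require Import classical_sets reals ereal topology normedtype sequences.
Local Open Scope classical_set_scope.

Section QuotientModule.
Local Open Scope quotient_scope.
Variables (R : pzRingType) (M : lmodType R).
Variables (N : {pred M}) (N_closed : submod_closed N).

(* N under a name that records N_closed, so that it can carry the structures
   required by [Quotient.quot]. *)
Definition submodule_of (_ : submod_closed N) : {pred M} := N.
HB.instance Definition _ :=
  GRing.isSubmodClosed.Build R M (submodule_of N_closed) N_closed.

Definition quot_module := Quotient.quot (submodule_of N_closed).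
HB.instance Definition _ := GRing.Zmodule.on quot_module.

Definition quot_scale (a : R) (x : quot_module) : quot_module :=
  \pi_quot_module (a *: repr x).

Lemma pi_scale a (x : M) :
  quot_scale a (\pi_quot_module x) = \pi_quot_module (a *: x).
Proof.
apply/eqP; rewrite -Quotient.idealrBE -scalerBr.
by apply: rpredZ; rewrite Quotient.idealrBE reprK.
Qed.

Lemma quot_scaleA a b x : quot_scale a (quot_scale b x) = quot_scale (a * b) x.
Proof.
by rewrite -[x]reprK [quot_scale b _]pi_scale !pi_scale scalerA.
Qed.

Lemma quot_scale1 : left_id 1 quot_scale.
Proof. by move=> x; rewrite -[x in LHS]reprK pi_scale scale1r reprK. Qed.

Lemma quot_scaleDr : right_distributive quot_scale +%R.
Proof.
move=> a x y; rewrite /quot_scale -(raddfD \pi_quot_module) -scalerDr.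
by rewrite -[RHS]pi_scale /quot_scale raddfD /= !reprK.
Qed.

Lemma quot_scaleDl x : {morph quot_scale^~ x : a b / a + b}.
Proof. by move=> a b; rewrite /quot_scale scalerDl raddfD. Qed.

HB.instance Definition _ := GRing.Zmodule_isLmodule.Build R quot_module
  quot_scaleA quot_scale1 quot_scaleDr quot_scaleDl.

End QuotientModule.

Section Length.
Variables (K : realType) (R : pzRingType) (M : lmodType R).

Definition submodule_chain (n : nat) : Prop :=
  exists N : nat -> {pred M},
    (forall i, (i <= n)%N -> submod_closed (N i)) /\
    (forall i, (i < n)%N ->
       {subset N i <= N i.+1} /\ exists2 x, x \in N i.+1 & x \notin N i).

Definition module_length : \bar K :=
  ereal_sup [set n%:R%:E | n in submodule_chain].

End Length.

Section HilbertKunz.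
Variables (K : realType) (R : comNzRingType).

Definition prime_chain (n : nat) : Prop :=
  exists P : nat -> {pred R},
    (forall i, (i <= n)%N -> idealr_closed (P i) /\ prime_idealr_closed (P i)) /\
    (forall i, (i < n)%N ->
       {subset P i <= P i.+1} /\ exists2 x, x \in P i.+1 & x \notin P i).

Definition krull_dim : \bar K :=
  ereal_sup [set n%:R%:E | n in prime_chain].

(* The ideal generated by A, as the intersection of the ideals containing A. *)
Definition ideal_span (A : set R) : {pred R^o} :=
  fun x => `[< forall I : {pred R^o},
                 submod_closed I -> (forall a, A a -> a \in I) -> x \in I >].

Lemma ideal_span_closed (A : set R) : submod_closed (ideal_span A).
Proof.
split=> [|a x y /asboolP xA /asboolP yA]; apply/asboolP => I I_closed AI.
  by case: I_closed.
by case: (I_closed) => _; apply; [apply: xA | apply: yA].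
Qed.

(* In a local ring the maximal ideal is the set of non-units. *)
Definition nonunits : set R := [set a | forall b, a * b <> 1].

(* For q = p ^ e and R local of characteristic p, this is m^[q]. *)
Definition frobenius_power (q : nat) : {pred R^o} :=
  ideal_span [set a ^+ q | a in nonunits].

Definition hilbert_kunz (p e : nat) : \bar K :=
  module_length K (quot_module
    (ideal_span_closed _ : submod_closed (frobenius_power (p ^ e)))).

(* e_HK(R) = l : the limit defining the multiplicity exists and equals l. *)
Definition is_hk_multiplicity (p : nat) (l : K) : Prop :=
  exists2 d : nat, krull_dim = d%:R%:E &
    (fun e : nat => hilbert_kunz p e * ((p ^ (e * d))%:R^-1)%:E)%E @ \oo
      --> l%:E.

End HilbertKunz.

Section A1Singularity.
Variable d : nat.

Definition A1_var (i : nat) : mfps d.+1 'F_2 := mfps_var _ (inord i).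

(* uphalf d = m both for d = 2m - 1 and for d = 2m. *)
Definition A1_form : mfps d.+1 'F_2 :=
  (\sum_(i < uphalf d) A1_var i.*2 * A1_var i.*2.+1)
  + (if odd d then 0 else A1_var d ^+ 2).

Definition A1_ideal : {pred mfps d.+1 'F_2} := ideal_span [set A1_form].

Lemma A1_ideal_closed : idealr_closed A1_ideal.
Proof.
have [J0 JM] := ideal_span_closed [set A1_form].
split=> //; apply/negP => /asboolP.
pose I : {pred mfps d.+1 'F_2} := fun f => mfps_coef f mpoly.mnm0 == 0.
have I0 : 0 \in I by exact: eqxx.
have ID x y : x \in I -> y \in I -> x + y \in I.
  by rewrite !unfold_in /= => /eqP -> /eqP ->; rewrite addr0.
have IM a x : x \in I -> a * x \in I.
  by rewrite !unfold_in mfps_coef0M => /eqP ->; rewrite mulr0.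
have I_closed : submod_closed (I : {pred (mfps d.+1 'F_2)^o}).
  by split=> [|a x y xI yI]; [exact: I0 | exact: (ID _ _ (IM a x xI) yI)].
have XI i : A1_var i \in I by apply/eqP; exact: mfps_var_coef0.
have QI : A1_form \in I.
  apply: (ID); last first.
    by case: ifP => _; [| rewrite expr2; exact/IM/XI].
  apply: (big_ind (fun f => f \in I)) => [|x y|i _] //; first exact: ID.
  exact/IM/XI.
move/(_ I I_closed) => H; have : 1 \in I by apply: H => _ ->.
by rewrite unfold_in /= eqxx oner_eq0.
Qed.

HB.instance Definition _ := isIdealr.Build _ A1_ideal A1_ideal_closed.

Definition A1_ring : comNzRingType := {ideal_quot A1_ideal}.

End A1Singularity.

(* Main.v *)
From HB Require Import structures.
Require Import Defs.
From mathcomp Require Import all_boot all_order all_algebra.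
From mathcomp Require Import generic_quotient ring_quotient.
From mathcomp Require Import zify ring lra.
From mathcomp Require Import boolp.
Set Implicit Arguments.
Unset Strict Implicit.
Unset Printing Implicit Defensive.
Import Order.TTheory GRing.Theory Num.Theory.
Local Open Scope ring_scope.

(** Write q = 2^e and let Q be the quadric. The maximal ideal of the A_1 ring is
    generated by the variables and Frobenius is additive, so the e-th
    Hilbert-Kunz value is the length of the power series ring modulo Q and the
    x_i^q (mem_frobenius_power). This quotient is the cokernel of multiplication
    by Q on the finite-dimensional algebra F_2[x_0, ..., x_d]/(x_i^q), and its
    dimension is that of the kernel (hilbert_kunz_ker). Lengths and dimensions
    agree because the residue field is F_2.

    Multiplication by Q is a sum of commuting operators on tensor factors: m copies
    of multiplication by xy on F_2[x, y]/(x^q, y^q) and, for even d, one of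
    multiplication by z^2 on F_2[z]/z^q. What is needed is therefore the Jordan type of
    a sum of commuting nilpotent operators on a tensor product, in characteristic 2.
    The type of T is recorded by the function sending b to dim ker T^b,
    and the functions that occur are combinations of the identity and of the tent
    functions tent k for k < e. Their increments are the Walsh signs, which multiply
    when Jordan blocks are tensored (jK_walsh): the source of this is
    (t + T)^(2^k) = t^(2^k) + T^(2^k). Along diagonals, multiplication by xy splits
    into Jordan blocks of lengths q, q-1, q-1, ..., 1, 1, and summing the tents over
    these lengths shows that one more product xy multiplies the coordinate on the
    identity by q * q and the one on tent k by q * 2^k (walsh_pairT). Starting
    from a single xy when d is odd (walsh_pairT0) and from z^2 when d is even
    (walsh_square), and evaluating at b = 1, one finds the dimension of the kernel; a geometric series puts it in the stated form.

    The multiplicity also needs that the A_1 ring has dimension d. A chain of d + 1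
    primes comes from a parametrisation of the quadric in d variables
    (A1_prime_chain). No chain is longer: its preimages and the zero ideal form a
    longer chain in the power series ring, and a chain of primes of power series in
    k variables has at most k steps (prime_chain_in_vars): a change of coordinates makes
    a nonzero element of the second prime regular in the last variable,
    Weierstrass division then makes the ring integral over the one with a variable less
    modulo this element, and strict inclusions of primes survive contraction along
    integral extensions. *)

(** * Kernels of powers of a linear operator *)

Section LinearPower.
Variables (F : fieldType) (V : vectType F).
Implicit Types (f g : 'End(V)) (U : {vspace V}).

Definition lpow f n : 'End(V) := iter n (comp_lfun f) \1%VF.

Lemma lpowE f n x : lpow f n x = iter n f x.
Proof. by elim: n => [|n IHn] /=; rewrite ?id_lfunE // comp_lfunE IHn. Qed.

Lemma mem_ker_lpow f n x : (x \in lker (lpow f n)) = (iter n f x == 0).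
Proof. by rewrite memv_ker lpowE. Qed.

Lemma iter_lfun0 f n : iter n f 0 = 0.
Proof. by elim: n => //= n ->; rewrite linear0. Qed.

Lemma iter_lfunD f n x y : iter n f (x + y) = iter n f x + iter n f y.
Proof. by rewrite -!lpowE linearD. Qed.

Lemma iter_lfun_comm f g : (forall x, f (g x) = g (f x)) ->
  forall m n x, iter m f (iter n g x) = iter n g (iter m f x).
Proof.
move=> fg m n x; elim: m => //= m ->; elim: n => //= n IHn.
by rewrite fg IHn.
Qed.

Lemma iter_ker_leq f m n x : (m <= n)%N -> iter m f x = 0 -> iter n f x = 0.
Proof. by move=> /subnK <-; rewrite iterD => ->; rewrite iter_lfun0. Qed.

Lemma ker_lpow_leq f m n : (m <= n)%N -> (lker (lpow f m) <= lker (lpow f n))%VS.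
Proof.
move=> mn; apply/subvP => x; rewrite !mem_ker_lpow => /eqP fx.
by rewrite (iter_ker_leq mn fx).
Qed.

(** One application of f maps the kernel of f^(n+1) into the kernel of f^n
    and kills only the kernel of f. *)
Lemma dim_ker_lpow_le f U n : (f @: U <= U)%VS ->
  (\dim (U :&: lker (lpow f n)) <= n * \dim (U :&: lker f))%N.
Proof.
move=> fU; elim: n => [|n IHn].
  suff -> : (U :&: lker (lpow f 0) = 0)%VS by rewrite dimv0.
  apply/eqP; rewrite -subv0; apply/subvP => x.
  by rewrite memv_cap mem_ker_lpow /= memv0 => /andP[].
rewrite -(limg_ker_dim f (U :&: lker (lpow f n.+1))) mulSn leq_add //.
  by apply: dimvS; rewrite -capvA (capvC (lker _)) capvA capvSl.
apply: leq_trans IHn; apply: dimvS; apply/subvP => _ /memv_imgP[x + ->].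
rewrite !memv_cap !mem_ker_lpow -iterSr => /andP[xU ->].
by rewrite andbT (subvP fU) // memv_img.
Qed.

End LinearPower.

(** * Subspaces of spaces of functions *)

Section FunctionSubspace.
Variables (F : fieldType) (W : vectType F) (I : finType).
Implicit Types (K : I -> {vspace W}).

Definition ffun_single (i : I) (w : W) : {ffun I -> W} := [ffun j => if j == i then w else 0].

Fact ffun_single_linear i : linear (ffun_single i).
Proof.
move=> a x y; apply/ffunP => j; rewrite !ffunE.
by case: eqP => // _; rewrite scaler0 addr0.
Qed.

HB.instance Definition _ i :=
  GRing.isLinear.Build F W {ffun I -> W} *:%R (ffun_single i) (ffun_single_linear i).

Definition ffunv K : {vspace {ffun I -> W}} :=
  (\sum_i linfun (ffun_single i) @: K i)%VS.

Lemma mem_ffunv K x : (x \in ffunv K) = [forall i, x i \in K i].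
Proof.
apply/idP/forallP => [/memv_sumP[y yK ->] i|xK].
  rewrite sum_ffunE rpred_sum // => j _; have /memv_imgP[w wK ->] := yK j isT.
  by rewrite lfunE ffunE; case: eqP => [->|_]; rewrite ?mem0v.
suff -> : x = \sum_i ffun_single i (x i).
  by apply: memv_sumr => i _; rewrite -[ffun_single i _]lfunE memv_img.
apply/ffunP => i; rewrite sum_ffunE (bigD1 i) //= big1 ?ffunE ?eqxx ?addr0 //.
by move=> j /negPf ji; rewrite ffunE eq_sym ji.
Qed.

Lemma dim_ffunv K : \dim (ffunv K) = (\sum_i \dim (K i))%N.
Proof.
have inj i (w : W) : linfun (ffun_single i) w = 0 -> w = 0.
  by move/ffunP/(_ i); rewrite lfunE !ffunE eqxx.
rewrite (directvP _) /= ?/ffunv; last first.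
  apply/directv_sum_independent => u uK u0 i _.
  have ui j k : j != k -> u j k = 0.
    move=> jk; have /memv_imgP[w _ ->] := uK j isT.
    by rewrite lfunE ffunE eq_sym (negPf jk).
  apply/ffunP => j; rewrite ffunE.
  have [<-|] := eqVneq i j; last exact: ui.
  move/ffunP/(_ i): u0; rewrite sum_ffunE ffunE (bigD1 i) //= big1 ?addr0 //.
  by move=> k; apply: ui.
apply: eq_bigr => i _; apply: limg_dim_eq.
apply/eqP; rewrite -subv0; apply/subvP => w.
by rewrite memv_cap memv_ker memv0 => /andP[_ /eqP/inj->].
Qed.

End FunctionSubspace.

(** * Tensoring with a Jordan block in characteristic 2 *)

Lemma addvv_char2 (F : fieldType) (char2 : 2%N \in [pchar F]) (V : lmodType F) (v : V) : v + v = 0.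
Proof. by rewrite -[v]scale1r -scalerDl addrr_pchar2 ?scale0r. Qed.

Section JordanTensor.
Variables (F : fieldType) (W : vectType F) (T : 'End(W)) (N : nat).
Implicit Types (x : {ffun 'I_N -> W}) (X : {vspace W}).

(** The function x stands for the sum of the x_i t^i in W[t]/t^N, the tensor product of
    W with a Jordan block of length N. Here jshift, or jt as a linear map, is
    multiplication by t, jT applies T to the coefficients, and js is t + T. *)
Definition jshift x : {ffun 'I_N -> W} :=
  [ffun i : 'I_N => (if (i : nat) is j.+1 then oapp x 0 (insub j) else 0) : W].

Fact jshift_linear : linear jshift.
Proof.
move=> a x y; apply/ffunP => -[[|j] ji]; rewrite !ffunE /= ?scaler0 ?addr0 //.
by rewrite insubT ?(ltnW ji) //= => ?; rewrite !ffunE.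
Qed.

HB.instance Definition _ :=
  GRing.isLinear.Build F {ffun 'I_N -> W} {ffun 'I_N -> W} *:%R jshift jshift_linear.

Definition jpoint x : {ffun 'I_N -> W} := [ffun i => T (x i)].

Fact jpoint_linear : linear jpoint.
Proof. by move=> a x y; apply/ffunP => i; rewrite !ffunE linearP. Qed.

HB.instance Definition _ :=
  GRing.isLinear.Build F {ffun 'I_N -> W} {ffun 'I_N -> W} *:%R jpoint jpoint_linear.

Definition jt : 'End({ffun 'I_N -> W}) := linfun jshift.
Definition jT : 'End({ffun 'I_N -> W}) := linfun jpoint.
Definition js : 'End({ffun 'I_N -> W}) := jt + jT.

Lemma jtE x i (iN : (i < N)%N) (iN1 : (i.-1 < N)%N) :
  jt x (Ordinal iN) = if i == 0%N then 0 else x (Ordinal iN1).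
Proof.
rewrite lfunE ffunE /=; case: i iN iN1 => [|i] iN iN1 //=.
by rewrite insubT /=; congr (x _); apply: val_inj.
Qed.

Lemma iter_jtE n x i (iN : (i < N)%N) (inN : (i - n < N)%N) :
  iter n jt x (Ordinal iN) = if (i < n)%N then 0 else x (Ordinal inN).
Proof.
elim: n i iN inN => [|n IHn] i iN inN /=; first by congr (x _); apply: val_inj => /=; lia.
have iN1 : (i.-1 < N)%N by lia.
rewrite (jtE _ _ iN1); case: eqP => [i0|i0].
  by have -> : (i < n.+1)%N by lia.
have inN1 : (i.-1 - n < N)%N by lia.
rewrite (IHn _ _ inN1); have -> : (i.-1 < n)%N = (i < n.+1)%N by lia.
by case: ifP => // _; congr (x _); apply: val_inj => /=; lia.
Qed.

Lemma jTE x i : jT x i = T (x i).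
Proof. by rewrite lfunE ffunE. Qed.

Lemma iter_jTE n x i : iter n jT x i = iter n T (x i).
Proof. by elim: n => //= n <-; rewrite jTE. Qed.

Lemma jtT x : jt (jT x) = jT (jt x).
Proof.
apply/ffunP => -[i iN]; have iN1 : (i.-1 < N)%N by lia.
rewrite (jtE _ _ iN1) !jTE (jtE _ _ iN1).
by case: eqP; rewrite ?linear0.
Qed.

Lemma jsE x : js x = jt x + jT x.
Proof. exact: add_lfunE. Qed.

Lemma jts x : jt (js x) = js (jt x).
Proof. by rewrite !jsE -jtT linearD. Qed.

Lemma jTs x : jT (js x) = js (jT x).
Proof. by rewrite !jsE jtT linearD. Qed.

(** X[t]/t^N inside W[t]/t^N. *)
Definition jcon X : {vspace {ffun 'I_N -> W}} := ffunv (fun=> X).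

Lemma mem_jcon X x : (x \in jcon X) = [forall i, x i \in X].
Proof. by rewrite mem_ffunv. Qed.

Lemma jcon_iter_jt n X x : x \in jcon X -> iter n jt x \in jcon X.
Proof.
rewrite !mem_jcon => /forallP xX; apply/forallP => -[i iN].
have inN : (i - n < N)%N by lia.
by rewrite (iter_jtE _ _ inN); case: ifP => _; rewrite ?mem0v ?xX.
Qed.

Lemma jcon_jT X x : (T @: X <= X)%VS -> x \in jcon X -> jT x \in jcon X.
Proof.
move=> TX; rewrite !mem_jcon => /forallP xX; apply/forallP => i.
by rewrite jTE (subvP TX) // memv_img.
Qed.

Lemma jcon_iter_js n X x : (T @: X <= X)%VS ->
  x \in jcon X -> iter n js x \in jcon X.
Proof.
move=> TX xX; elim: n => //= n IHn; rewrite jsE memvD ?jcon_jT //.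
exact: (jcon_iter_jt 1).
Qed.

(** For a <= N this is t^(N-a) X[t]/t^N, the tensor product of X with a Jordan block of
    length a; all block lengths are thus handled in one space. *)
Definition jker X a : {vspace {ffun 'I_N -> W}} := (jcon X :&: lker (lpow jt a))%VS.

Lemma mem_jker X a x : (x \in jker X a) = (x \in jcon X) && (iter a jt x == 0).
Proof. by rewrite memv_cap mem_ker_lpow. Qed.

Lemma jker_ffunv X a : (a <= N)%N ->
  jker X a = ffunv (fun i : 'I_N => if (i < N - a)%N then 0%VS else X).
Proof.
move=> aN; apply/vspaceP => x; rewrite mem_jker mem_jcon mem_ffunv.
apply/andP/forallP => [[/forallP xX /eqP x0] i|xK].
  case: ltnP => // ia; rewrite memv0.
  have iaN : (i + a < N)%N by lia.
  have iaN' : (i + a - a < N)%N by lia.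
  move/ffunP/(_ (Ordinal iaN)): x0; rewrite (iter_jtE _ _ iaN') ffunE ltnNge leq_addl /=.
  by move <-; apply/eqP; congr (x _); apply: val_inj => /=; lia.
split.
  by apply/forallP => i; move: (xK i); case: ifP => // _; rewrite memv0 => /eqP->; rewrite mem0v.
apply/eqP/ffunP => -[i iN]; have iaN : (i - a < N)%N by lia.
rewrite (iter_jtE _ _ iaN) ffunE; case: ltnP => // ai.
have lia_ : (i - a < N - a)%N by lia.
by move: (xK (Ordinal iaN)); rewrite /= lia_ memv0 => /eqP.
Qed.

Lemma dim_jker X a : (a <= N)%N -> \dim (jker X a) = (a * \dim X)%N.
Proof.
move=> aN; rewrite jker_ffunv // dim_ffunv.
rewrite (eq_bigr (fun i : 'I_N => if (N - a <= i)%N then \dim X else 0%N)); last first.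
  by move=> i _; case: ltnP; rewrite ?dimv0.
rewrite -(big_mkord xpredT (fun i => if (N - a <= i)%N then \dim X else 0%N)).
rewrite (@big_cat_nat _ _ _ (N - a)) ?leq_subr //= big_nat big1 ?add0n; last first.
  by move=> i; case: leqP => //; lia.
rewrite (eq_big_nat _ _ (F2 := fun=> \dim X)); last by move=> i /andP[-> _].
by rewrite sum_nat_const_nat subKn.
Qed.

(** A vector killed by t + T is determined by its last coordinate. *)
Lemma dim_ker_js X : (\dim (jcon X :&: lker js) <= \dim X)%N.
Proof.
have [N0|N_gt0] := posnP N.
  suff -> : \dim (jcon X :&: lker js) = 0%N by [].
  apply/eqP; rewrite -leqn0 -[X in (_ <= X)%N](mul0n (\dim X)).
  rewrite -(@dim_jker X 0) //; apply: dimvS; apply/subvP => x _.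
  by rewrite mem_jker mem_jcon; apply/andP; split; [apply/forallP|apply/eqP/ffunP] => -[i iN]; exfalso; move: iN; rewrite N0.
have lastN : (N.-1 < N)%N by lia.
pose ev (x : {ffun 'I_N -> W}) := x (Ordinal lastN).
have ev_lin : linear ev by move=> a x y; rewrite /ev !ffunE.
pose evL := GRing.isLinear.Build F {ffun 'I_N -> W} W *:%R ev ev_lin.
pose lev : {linear {ffun 'I_N -> W} -> W} := HB.pack ev evL.
rewrite -(limg_ker_dim (linfun lev)).
rewrite [X in (\dim X + _)%N](_ : _ = 0%VS) ?dimv0 ?add0n.
  apply: dimvS; apply/subvP => _ /memv_imgP[x + ->]; rewrite lfunE /= memv_cap mem_jcon.
  by move=> /andP[/forallP xX _]; exact: xX.
apply/eqP; rewrite -subv0; apply/subvP => x; rewrite memv_cap (memv_ker (linfun lev)) lfunE /=.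
move=> /andP[]; rewrite memv_cap memv_ker => /andP[_ /eqP sx] /eqP x_last.
rewrite memv0; apply/eqP/ffunP => -[i iN]; rewrite ffunE.
have [k ik] : exists k, (i + k = N.-1)%N by exists (N.-1 - i)%N; lia.
elim: k i iN ik => [|k IHk] i iN ik.
  by rewrite -[RHS]x_last; congr (x _); apply: val_inj => /=; lia.
have iN1 : (i.+1 < N)%N by clear -ik N_gt0; lia.
have iN' : (i.+1.-1 < N)%N by lia.
move/ffunP/(_ (Ordinal iN1)): sx; rewrite jsE ffunE (jtE _ _ iN') jTE ffunE.
rewrite (IHk i.+1 iN1) ?linear0 ?addr0; last by clear -ik; lia.
by move=> /= <-; congr (x _); apply: val_inj.
Qed.

Variable char2 : 2%N \in [pchar F].

(** The Frobenius identity: t and T commute in characteristic 2. *)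
Lemma iter_js k x : iter (2 ^ k) js x = iter (2 ^ k) jt x + iter (2 ^ k) jT x.
Proof.
elim: k x => [|k IHk] x; first by rewrite !expn0 /= jsE.
rewrite expnS mul2n -addnn !iterD !IHk !iter_lfunD.
rewrite (iter_lfun_comm jtT) addrACA -addrA (addrA (iter _ jT _)) (addvv_char2 char2).
by rewrite add0r.
Qed.

Lemma iter_jt_split k x : iter (2 ^ k) jt x = iter (2 ^ k) js x + iter (2 ^ k) jT x.
Proof. by rewrite iter_js -addrA (addvv_char2 char2) addr0. Qed.

Lemma iter_jT_split k x : iter (2 ^ k) jT x = iter (2 ^ k) js x + iter (2 ^ k) jt x.
Proof. by rewrite iter_js addrAC (addvv_char2 char2) add0r. Qed.

(** The dimension of the kernel of (t + T)^b on the tensor product of X with a Jordan block of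
    length a. *)
Definition jK X a b := \dim (jker X a :&: lker (lpow js b)).

Lemma mem_jK X a b x :
  (x \in (jker X a :&: lker (lpow js b))%VS) =
  [&& x \in jcon X, iter a jt x == 0 & iter b js x == 0].
Proof. by rewrite memv_cap mem_ker_lpow mem_jker andbA. Qed.

(** When T^q = 0 with q a power of 2, also (t + T)^q = t^q + T^q vanishes on the
    kernel of t^q; this kernel is then as free over F[t + T]/(t + T)^q as it is
    over F[t]/t^q. *)
Lemma jK_free k X b : (2 ^ k <= N)%N -> (T @: X <= X)%VS ->
  (forall w, w \in X -> iter (2 ^ k) T w = 0) -> (b <= 2 ^ k)%N ->
  jK X (2 ^ k) b = (b * \dim X)%N.
Proof.
move=> qN TX Tq bq; set q := (2 ^ k)%N in qN Tq bq *.
have upper c : (jK X q c <= c * \dim X)%N.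
  apply: leq_trans (dim_ker_lpow_le _ _) _.
    apply/subvP => _ /memv_imgP[x + ->]; rewrite !mem_jker => /andP[xX /eqP tx].
    by have /= -> := iter_lfun_comm jts q 1 x; rewrite (jcon_iter_js 1) // tx linear0 /=.
  rewrite leq_mul2l; apply/orP; right; apply: leq_trans (dim_ker_js X).
  by apply/dimvS/capvS; rewrite ?capvSl.
have /esym := limg_ker_dim (lpow js b) (jker X q); rewrite dim_jker //.
have img : (\dim (lpow js b @: jker X q) <= (q - b) * \dim X)%N.
  apply: leq_trans (upper _); apply: dimvS; apply/subvP => _ /memv_imgP[x + ->].
  rewrite mem_jK lpowE mem_jker => /andP[xX /eqP tx].
  rewrite jcon_iter_js //= -iterD subnK // (iter_lfun_comm jts) tx iter_lfun0 eqxx /=.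
  rewrite iter_js tx add0r; apply/eqP/ffunP => i; rewrite iter_jTE ffunE Tq //.
  by move: xX; rewrite mem_jcon => /forallP.
move=> dimq; apply/eqP; rewrite eqn_leq upper /=.
move: dimq img; rewrite -/(jK X q b) mulnBl.
have : (b * \dim X <= q * \dim X)%N by rewrite leq_mul2r bq orbT.
lia.
Qed.

Lemma limg_lpow_sub n X : (T @: X <= X)%VS -> (T @: (lpow T n @: X) <= lpow T n @: X)%VS.
Proof.
move=> TX; apply/subvP => _ /memv_imgP[_ /memv_imgP[x xX ->] ->].
by rewrite lpowE -iterS iterSr -lpowE memv_img // (subvP TX) // memv_img.
Qed.

Lemma cap_ker_lpow_sub n X :
  (T @: X <= X)%VS -> (T @: (X :&: lker (lpow T n)) <= X :&: lker (lpow T n))%VS.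
Proof.
move=> TX; apply/subvP => _ /memv_imgP[x + ->].
rewrite !memv_cap !mem_ker_lpow => /andP[xX /eqP x0].
by rewrite (subvP TX) ?memv_img //= -iterSr /= x0 linear0.
Qed.

Lemma mem_jcon_cap_ker n X x :
  (x \in jcon (X :&: lker (lpow T n))) = (x \in jcon X) && (iter n jT x == 0).
Proof.
rewrite !mem_jcon; apply/forallP/andP => [xX|[/forallP xX /eqP x0] i].
  split; first by apply/forallP => i; move: (xX i); rewrite memv_cap => /andP[].
  apply/eqP/ffunP => i; rewrite iter_jTE ffunE.
  by move: (xX i); rewrite memv_cap mem_ker_lpow => /andP[_ /eqP].
by rewrite memv_cap xX mem_ker_lpow -iter_jTE x0 ffunE eqxx.
Qed.

(** On the kernels of t^a and (t + T)^b both 2^k-th powers vanish, hence so does their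
    sum T^(2^k). *)
Lemma jK_small k X a b : (a <= 2 ^ k)%N -> (b <= 2 ^ k)%N ->
  jK X a b = jK (X :&: lker (lpow T (2 ^ k))) a b.
Proof.
move=> aq bq; congr (\dim _); apply/vspaceP => x; rewrite !mem_jK mem_jcon_cap_ker.
case: (x \in _) => //=; apply/andP/and3P => [[/eqP ax /eqP bx]|[_ -> ->]] //.
by rewrite iter_jT_split (iter_ker_leq aq ax) (iter_ker_leq bq bx) addr0 ax bx eqxx.
Qed.

(** The kernel of t^(q+j) in the kernel of (t+T)^b is cut by T^q: on it
    t^q = T^q, and T^q maps onto the corresponding kernel for T^q X because both
    sides are free over F[t + T]. *)
Lemma jK_mixed k X j b : (2 ^ k.+1 <= N)%N -> (T @: X <= X)%VS ->
  (forall w, w \in X -> iter (2 ^ k.+1) T w = 0) ->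
  (j <= 2 ^ k)%N -> (b <= 2 ^ k)%N ->
  jK X (2 ^ k + j) b =
    (b * \dim (X :&: lker (lpow T (2 ^ k))) + jK (lpow T (2 ^ k) @: X) j b)%N.
Proof.
move=> qN TX TQ jq bq; have Qq : (2 ^ k.+1 = 2 ^ k + 2 ^ k)%N by rewrite expnS mul2n addnn.
set q := (2 ^ k)%N in jq bq Qq *.
set X0 := (X :&: lker _)%VS; set Y := (lpow T q @: X)%VS.
have TX0 : (T @: X0 <= X0)%VS by apply: cap_ker_lpow_sub.
have TY : (T @: Y <= Y)%VS by apply: limg_lpow_sub.
have X0q w : w \in X0 -> iter q T w = 0.
  by rewrite memv_cap mem_ker_lpow => /andP[_ /eqP].
have X0Q w : w \in X0 -> iter (2 ^ k.+1) T w = 0.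
  by rewrite memv_cap => /andP[/TQ].
have YQ w : w \in Y -> iter (2 ^ k.+1) T w = 0.
  by move=> /memv_imgP[v vX ->]; rewrite lpowE -iterD addnC iterD TQ // iter_lfun0.
have bQ : (b <= 2 ^ k.+1)%N by lia.
have jcon_img x : x \in jcon X -> iter q jT x \in jcon Y.
  rewrite !mem_jcon => /forallP xX; apply/forallP => i.
  by rewrite iter_jTE -lpowE memv_img.
have onto y : y \in (jker Y (2 ^ k.+1) :&: lker (lpow js b))%VS ->
    exists2 x, x \in (jker X (2 ^ k.+1) :&: lker (lpow js b))%VS & y = iter q jT x.
  (* The image lies in the target, and the dimensions agree by jK_free for X, for Y and for
     the kernel X0 of T^q. *)
  suff /eqP <- : (lpow jT q @: (jker X (2 ^ k.+1) :&: lker (lpow js b)) ==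
               jker Y (2 ^ k.+1) :&: lker (lpow js b))%VS.
    by move=> /memv_imgP[x xA ->]; exists x; rewrite ?lpowE.
  rewrite eqEdim; apply/andP; split.
    apply/subvP => _ /memv_imgP[x + ->]; rewrite !mem_jK lpowE => /and3P[xX /eqP tx /eqP sx].
    rewrite jcon_img //= -(iter_lfun_comm jTs) sx iter_lfun0 eqxx andbT.
    by rewrite (iter_lfun_comm jtT) tx iter_lfun0.
  rewrite [X in (X <= _)%N](jK_free qN TY YQ bQ).
  have := limg_ker_dim (lpow jT q) (jker X (2 ^ k.+1) :&: lker (lpow js b)).
  rewrite [X in _ = X -> _](jK_free qN TX TQ bQ).
  have -> : (jker X (2 ^ k.+1) :&: lker (lpow js b) :&: lker (lpow jT q) =
             jker X0 (2 ^ k.+1) :&: lker (lpow js b))%VS.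
    apply/vspaceP => x; rewrite memv_cap !mem_jK mem_jcon_cap_ker mem_ker_lpow.
    by rewrite -!andbA; do !bool_congr.
  rewrite [X in (X + _)%N](jK_free qN TX0 X0Q bQ) -(limg_ker_dim (lpow T q) X).
  rewrite -/X0 -/Y; nia.
rewrite /jK -(limg_ker_dim (lpow jT q)); congr (_ + _)%N.
  rewrite -(jK_free (k := k) _ TX0 X0q bq); last by lia.
  congr (\dim _); apply/vspaceP => x.
  rewrite memv_cap !mem_jK mem_jcon_cap_ker mem_ker_lpow -!andbA.
  case: (x \in _) => //=; apply/and3P/and3P => [[/eqP tx /eqP sx /eqP Tx]|[/eqP Tx /eqP tx /eqP sx]].
    by rewrite iter_jt_split (iter_ker_leq bq sx) sx Tx addr0 eqxx.
  by rewrite addnC iterD tx sx Tx iter_lfun0 eqxx.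
congr (\dim _); apply/vspaceP => y; rewrite mem_jK.
apply/memv_imgP/and3P => [[x + ->]|[yY /eqP ty /eqP sy]].
  rewrite mem_jK lpowE => /and3P[xX /eqP tx /eqP sx]; rewrite jcon_img //.
  rewrite -(iter_lfun_comm jTs) sx iter_lfun0 eqxx iter_jT_split iter_lfunD.
  by rewrite (iter_ker_leq bq sx) iter_lfun0 add0r -iterD addnC tx.
have [|x] := onto y.
  by rewrite mem_jK yY sy eqxx (iter_ker_leq _ ty) ?eqxx //; lia.
rewrite mem_jK => /and3P[xX _ /eqP sx] yx; exists x; rewrite ?lpowE //.
rewrite mem_jK xX sx eqxx andbT /= addnC iterD iter_jt_split iter_lfunD.
by rewrite (iter_ker_leq bq sx) iter_lfun0 add0r -yx ty.
Qed.

(** Duality over the free modules: kernels of t^a are images of t^(q-a), and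
    likewise for t + T. *)
Lemma jK_dual k X a b : (2 ^ k <= N)%N -> (T @: X <= X)%VS ->
  (forall w, w \in X -> iter (2 ^ k) T w = 0) -> (a <= 2 ^ k)%N -> (b <= 2 ^ k)%N ->
  (jK X a b + 2 ^ k * \dim X = (a + b) * \dim X + jK X (2 ^ k - a) (2 ^ k - b))%N.
Proof.
move=> qN TX Tq aq bq; set q := (2 ^ k)%N in qN Tq aq bq *.
have jkerS c d : (c <= d)%N -> (jker X c <= jker X d)%VS.
  by move=> cd; apply: capvS => //; apply: ker_lpow_leq.
have sq x : x \in jker X q -> iter q js x = 0.
  rewrite mem_jker iter_js => /andP[xX /eqP ->]; rewrite add0r.
  apply/ffunP => i; rewrite iter_jTE ffunE Tq //.
  by move: xX; rewrite mem_jcon => /forallP.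
have imgt : (lpow jt a @: jker X q = jker X (q - a))%VS.
  apply/eqP; rewrite eqEdim; apply/andP; split.
    apply/subvP => _ /memv_imgP[x + ->]; rewrite !mem_jker lpowE => /andP[xX /eqP tx].
    by rewrite jcon_iter_jt //= -iterD subnK // tx.
  have := limg_ker_dim (lpow jt a) (jker X q); rewrite !dim_jker //; last by lia.
  have -> : (jker X q :&: lker (lpow jt a) = jker X a)%VS.
    by rewrite -capvA; congr (_ :&: _)%VS; apply/capv_idPr/ker_lpow_leq.
  by rewrite dim_jker; nia.
have imgs : (lpow js (q - b) @: jker X q = jker X q :&: lker (lpow js b))%VS.
  apply/eqP; rewrite eqEdim; apply/andP; split.
    apply/subvP => _ /memv_imgP[x xq ->]; rewrite mem_jK lpowE.
    rewrite -iterD subnKC // sq // eqxx andbT.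
    move: xq; rewrite mem_jker => /andP[xX /eqP tx].
    by rewrite jcon_iter_js //= (iter_lfun_comm jts) tx iter_lfun0.
  have := limg_ker_dim (lpow js (q - b)) (jker X q).
  rewrite [X in (X + _)%N](jK_free qN TX Tq) ?leq_subr // [X in (X <= _)%N](jK_free qN TX Tq) //.
  by rewrite dim_jker //; nia.
have E1 := limg_ker_dim (lpow jt a) (jker X q :&: lker (lpow js b)).
rewrite [X in _ = X](jK_free qN TX Tq) // -{2}imgs in E1.
have -> : jK X a b = \dim (jker X q :&: lker (lpow js b) :&: lker (lpow jt a)).
  rewrite /jK -capvA (capvC (lker (lpow js b))) capvA; congr (\dim (_ :&: _)).
  by rewrite -capvA; congr (_ :&: _)%VS; apply/esym/capv_idPr/ker_lpow_leq.
have E2 := limg_ker_dim (lpow js (q - b)) (jker X (q - a)).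
rewrite dim_jker in E2; last by lia.
rewrite -/(jK X (q - a) (q - b)) -imgt -!limg_comp in E2.
rewrite -limg_comp in E1.
have comm : (lpow js (q - b) \o lpow jt a = lpow jt a \o lpow js (q - b))%VF.
  by apply/lfunP => x; rewrite !comp_lfunE !lpowE (iter_lfun_comm jts).
rewrite comm mulnBl in E2.
have : (a * \dim X <= q * \dim X)%N by rewrite leq_mul2r aq orbT.
move: E1 E2; rewrite mulnDl.
move: (\dim _) (\dim _) (jK _ _ _) (a * _)%N (b * _)%N (q * _)%N; clear; lia.
Qed.

End JordanTensor.

(** * Tent functions *)

(** Distance from b to the nearest multiple of 2^(k+1), i.e. the partial sum over
    i < b of the Walsh signs (-1)^(k-th bit of i). *)
Definition tent (k b : nat) : nat :=
  minn (b %% 2 ^ k.+1) (2 ^ k.+1 - b %% 2 ^ k.+1).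

Lemma tent_small k b : (b <= 2 ^ k)%N -> tent k b = b.
Proof.
move=> bk; have kS : (2 ^ k.+1 = 2 ^ k + 2 ^ k)%N by rewrite expnS mul2n addnn.
by rewrite /tent modn_small ?expn_gt0 //; have := expn_gt0 2 k; lia.
Qed.

Lemma tent_period k b c : (2 ^ k.+1 %| c)%N -> tent k (c + b) = tent k b.
Proof. by move=> /dvdnP[l ->]; rewrite /tent modnMDl. Qed.

Lemma tent_reflect k b c : (2 ^ k.+1 %| c)%N -> (b <= c)%N -> tent k (c - b) = tent k b.
Proof.
move=> /dvdnP[l ->]; set p := (2 ^ k.+1)%N => bc; have p0 : (0 < p)%N by rewrite expn_gt0.
rewrite /tent -/p; have := ltn_pmod b p0.
have := divn_eq b p; set r := (b %% p)%N; set u := (b %/ p)%N => bE rp.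
have -> : ((l * p - b) %% p = if r == 0 then 0 else p - r)%N.
  rewrite bE; case: eqP => [->|/eqP r0]; first by rewrite addn0 -mulnBl modnMl.
  have ul : (u < l)%N.
    by rewrite -(ltn_pmul2r p0); move: bc; rewrite bE; move: (u * p)%N (l * p)%N r0; clear; lia.
  rewrite -(subnK ul) mulnDl mulSn.
  rewrite (_ : _ - _ = (l - u.+1) * p + (p - r))%N ?modnMDl ?modn_small //.
    by move: r0 rp; clear; lia.
  by move: (u * p)%N (_ * p)%N r0 rp; clear; lia.
by case: eqP; move: rp; clear; lia.
Qed.

Lemma tent_top k j : (j <= 2 ^ k)%N -> tent k (2 ^ k + j) = (2 ^ k - j)%N.
Proof.
move=> jk; have kS : (2 ^ k.+1 = 2 ^ k + 2 ^ k)%N by rewrite expnS mul2n addnn.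
by rewrite -(tent_reflect (c := 2 ^ k.+1)) // ?tent_small; lia.
Qed.

Section WalshKernels.
Variables (F : fieldType) (char2 : 2%N \in [pchar F]).
Variables (W : vectType F) (T : 'End(W)) (N : nat).
Implicit Types X : {vspace W}.

Local Notation jK := (jK T N).

(** Kernel dimensions of powers of T that are combinations of the identity and
    of tent functions stay so after tensoring: on Jordan blocks the Walsh signs
    are multiplicative, so that their partial sums multiply. The induction on e
    splits X into the kernel of T^q and the image T^q X, with q = 2^(e-1); on both the
    top tent is affine and is absorbed into the identity. *)
Lemma jK_walsh e X (al : int) (be : nat -> int) : (2 ^ e <= N)%N ->
  (T @: X <= X)%VS -> (forall w, w \in X -> iter (2 ^ e) T w = 0) ->
  (forall b, (b <= 2 ^ e)%N -> (\dim (X :&: lker (lpow T b)))%:Z =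
     al * b%:Z + \sum_(k < e) be k * (tent k b)%:Z) ->
  forall a b, (a <= 2 ^ e)%N -> (b <= 2 ^ e)%N ->
  (jK X a b)%:Z = al * a%:Z * b%:Z + \sum_(k < e) be k * ((tent k a)%:Z * (tent k b)%:Z).
Proof.
elim: e X al => [|e IHe] X al eN TX Tq kX a b ae be'.
  have kX1 := kX 1%N isT; rewrite !big_ord0 addr0 in kX1 *.
  have XT : (X :&: lker (lpow T 1) = X)%VS.
    apply/capv_idPl/subvP => w /Tq Tw; rewrite mem_ker_lpow; exact/eqP.
  case: a ae => [|[|//]] _.
    rewrite mulr0 mul0r; congr Posz; apply/eqP; rewrite -leqn0.
    by rewrite -[X in (_ <= X)%N](mul0n (\dim X)) -(dim_jker X (leq0n N)) dimvS ?capvSl.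
  rewrite [X in X%:Z](jK_free char2 (k := 0) eN TX Tq be') -[in RHS]kX1.
  by rewrite XT addr0 PoszM mulrC.
have Qq : (2 ^ e.+1 = 2 ^ e + 2 ^ e)%N by rewrite expnS mul2n addnn.
set q := (2 ^ e)%N in Qq *; have q0 : (0 < q)%N by rewrite expn_gt0.
have qN : (q <= N)%N by lia.
have dvdq (k : 'I_e) : (2 ^ k.+1 %| q)%N by rewrite dvdn_exp2l.
have dvdQ (k : 'I_e.+1) : (2 ^ k.+1 %| q + q)%N by rewrite -Qq dvdn_exp2l.
pose S (u v : nat) := \sum_(k < e) be k * ((tent k u)%:Z * (tent k v)%:Z).
have kX' b' : (b' <= q + q)%N -> (\dim (X :&: lker (lpow T b')))%:Z =
    al * b'%:Z + \sum_(k < e) be k * (tent k b')%:Z + be e * (tent e b')%:Z.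
  by move=> b'q; rewrite kX ?Qq // big_ord_recr addrA.
have dX : (\dim X)%:Z = al * (q + q)%:Z.
  rewrite -[in LHS](capv_idPl (_ : X <= lker (lpow T (2 ^ e.+1)))%VS).
    rewrite kX // Qq big1 ?addr0 // => k _.
    by rewrite -[(q + q)%N]addn0 (tent_period _ (dvdQ k)) tent_small ?mulr0.
  by apply/subvP => w /Tq Tw; rewrite mem_ker_lpow; exact/eqP.
set X0 := (X :&: lker (lpow T q))%VS; set Y := (lpow T q @: X)%VS.
have kq : (\dim X0)%:Z = (al + be e) * q%:Z.
  rewrite kX' ?leq_addr // big1 ?addr0 ?tent_small ?mulrDl // => k _.
  by rewrite -[q]addn0 (tent_period _ (dvdq k)) tent_small ?mulr0.
have small X1 al1 : (T @: X1 <= X1)%VS -> (forall w, w \in X1 -> iter q T w = 0) ->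
    (forall b, (b <= q)%N -> (\dim (X1 :&: lker (lpow T b)))%:Z =
       al1 * b%:Z + \sum_(k < e) be k * (tent k b)%:Z) ->
    forall a b, (a <= q)%N -> (b <= q)%N -> (jK X1 a b)%:Z = al1 * a%:Z * b%:Z + S a b.
  by move=> TX1 Tq1 kX1; apply: IHe.
(* tent e is the identity up to q, so al becomes al + be e on the kernel of T^q. *)
have smallX u v : (u <= q)%N -> (v <= q)%N ->
    (jK X u v)%:Z = (al + be e) * u%:Z * v%:Z + S u v.
  move=> uq vq; rewrite (jK_small T N char2 _ uq vq); apply: small => //.
  - exact: cap_ker_lpow_sub.
  - by move=> w; rewrite memv_cap mem_ker_lpow => /andP[_ /eqP].
  move=> b' b'q; rewrite -capvA (capv_idPr (ker_lpow_leq _ b'q)) kX'; last by lia.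
  by rewrite tent_small // mulrDl; ring.
(* Beyond q, tent e decreases with slope -1, so al becomes al - be e on the image. *)
have smallY u v : (u <= q)%N -> (v <= q)%N ->
    (jK Y u v)%:Z = (al - be e) * u%:Z * v%:Z + S u v.
  move=> uq vq; apply: small => //; first exact: limg_lpow_sub.
    by move=> w /memv_imgP[x xX ->]; rewrite lpowE -iterD -Qq Tq.
  move=> b' b'q; have := limg_ker_dim (lpow T q) (X :&: lker (lpow T (q + b'))).
  have -> : (X :&: lker (lpow T (q + b')) :&: lker (lpow T q) = X0)%VS.
    by rewrite -capvA; congr (_ :&: _)%VS; apply/capv_idPr/ker_lpow_leq/leq_addr.
  have -> : (lpow T q @: (X :&: lker (lpow T (q + b'))) = Y :&: lker (lpow T b'))%VS.
    apply/vspaceP => w; rewrite memv_cap; apply/memv_imgP/andP.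
      case=> x; rewrite memv_cap !mem_ker_lpow => /andP[xX x0] ->.
      by rewrite memv_img // lpowE -iterD addnC.
    case=> /memv_imgP[x xX ->]; rewrite mem_ker_lpow lpowE -iterD => x0.
    by exists x; rewrite ?lpowE // memv_cap xX mem_ker_lpow addnC.
  move/(congr1 Posz); rewrite PoszD kX' ?leq_add2l // kq => H.
  apply: (addrI ((al + be e) * q%:Z)); rewrite H tent_top // -subzn // PoszD.
  rewrite (eq_bigr (fun k : 'I_e => be k * (tent k b')%:Z)); first by ring.
  by move=> k _; rewrite (tent_period _ (dvdq k)).
have S0 u v : S (q + u)%N v = S u v.
  by apply: eq_bigr => k _; rewrite (tent_period _ (dvdq k)).
have goalE u v : (u <= q + q)%N -> (v <= q)%N -> (jK X u v)%:Z =
    al * u%:Z * v%:Z + S u v + be e * ((tent e u)%:Z * v%:Z).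
  move=> uQ vq; have [uq|/ltnW qu] := leqP u q.
    by rewrite smallX // tent_small //; ring.
  have jq : (u - q <= q)%N by lia.
  move: jq (subnKC qu); move: (u - q)%N => j jq <-.
  rewrite (jK_mixed char2 (k := e)) // -/q -/X0 -/Y PoszD PoszM kq smallY //.
  by rewrite S0 tent_top // -subzn // PoszD; ring.
rewrite big_ord_recr /= addrA -/(S a b) Qq in ae be' *.
(* When b also exceeds q, duality reflects both arguments. *)
have [bq|/ltnW qb] := leqP b q; first by rewrite goalE // [tent e b]tent_small.
have a'Q : (q + q - a <= q + q)%N by apply: leq_subr.
have b'q : (q + q - b <= q)%N by lia.
have tE := tent_reflect (dvdQ ord_max).
have := jK_dual char2 eN TX Tq; rewrite Qq => /(_ a b ae be') /(congr1 Posz).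
rewrite !PoszD !PoszM (goalE (q + q - a)%N (q + q - b)%N) // dX -!subzn // tE //.
have -> : S (q + q - a)%N (q + q - b)%N = S a b.
  by apply: eq_bigr => k _; rewrite !(tent_reflect (dvdQ (widen_ord (leqnSn e) k))).
have -> : (tent e b)%:Z = (q + q)%:Z - b%:Z.
  by rewrite -(subnKC qb) tent_top; [rewrite -subzn; lia|lia].
rewrite !PoszD => H.
by apply: (addIr ((q%:Z + q%:Z) * (al * (q%:Z + q%:Z)))); rewrite H; ring.
Qed.

End WalshKernels.

Section TentSums.

(** Multiplication by xy has, for each c < q, one Jordan block of length q - c and one of
    length q - c - 1; by tent_reflect, this is the sum of a tent over these lengths. *)
Lemma sum_tent k e : (k < e)%N ->
  (\sum_(c < 2 ^ e) (tent k c + tent k c.+1) = 2 ^ e * 2 ^ k)%N.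
Proof.
move=> ke; rewrite -(big_mkord xpredT (fun c => tent k c + tent k c.+1)%N).
elim: e ke => // e IHe; rewrite ltnS leq_eqVlt => /orP[/eqP ke|ke].
  have q2 : (2 ^ e.+1 = 2 ^ e + 2 ^ e)%N by rewrite expnS mul2n addnn.
  rewrite {1}q2 (@big_cat_nat _ _ _ (2 ^ e)) ?leq_addr //=.
  rewrite -{2}[(2 ^ e)%N]add0n big_addn addnK -big_split /=.
  rewrite (eq_big_nat _ _ (F2 := fun=> (2 ^ e + 2 ^ e)%N)) ?sum_nat_const_nat.
    by rewrite subn0 -q2 mulnC ke.
  move=> c /andP[_ ce]; rewrite -addSn ![(_ + 2 ^ e)%N]addnC ke.
  by rewrite !tent_top ?(ltnW ce) // !tent_small ?(ltnW ce) //; lia.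
have q2 : (2 ^ e.+1 = 2 ^ e + 2 ^ e)%N by rewrite expnS mul2n addnn.
rewrite q2 (@big_cat_nat _ _ _ (2 ^ e)) ?leq_addr //=.
rewrite -{2}[(2 ^ e)%N]add0n big_addn addnK mulnDl IHe //; congr (_ + _)%N.
rewrite -IHe //; apply: eq_bigr => c _; rewrite -addSn ![(_ + 2 ^ e)%N]addnC.
by rewrite !tent_period // dvdn_exp2l.
Qed.

(** A Jordan block of length a has a kernel of dimension min(a, b) for its b-th power. *)
Lemma sum_min b q : (b <= q)%N ->
  (\sum_(c < q) (minn c b + minn c.+1 b) + b * b = q * b + q * b)%N.
Proof.
move=> /subnK <-; elim: (q - b)%N => [|n IHn].
  rewrite add0n; congr (_ + _)%N; rewrite (eq_bigr (fun c : 'I_b => c + c.+1)%N).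
    rewrite -(big_mkord xpredT (fun c => c + c.+1)%N).
    by elim: b => [|b IHb]; [rewrite big_geq|rewrite big_nat_recr //= IHb; nia].
  by move=> c _; have := ltn_ord c; lia.
rewrite addSn big_ord_recr /=; have -> : minn (n + b) b = b by lia.
have -> : minn (n + b).+1 b = b by lia.
by rewrite mulSn; move: IHn; move: (_ * _)%N (_ * _)%N (bigop.body _ _ _); clear; lia.
Qed.

(** Removes the square left over by sum_min: 2^e b - b^2 is itself a combination of tents. *)
Lemma tent_quadratic e b : (b <= 2 ^ e)%N ->
  (b * b + \sum_(k < e) 2 ^ k * tent k b = 2 ^ e * b)%N.
Proof.
elim: e b => [|e IHe] b; first by case: b => [|[|//]]; rewrite big_ord0.
have q2 : (2 ^ e.+1 = 2 ^ e + 2 ^ e)%N by rewrite expnS mul2n addnn.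
rewrite q2 => bQ; rewrite big_ord_recr /= addnA; have [bq|/ltnW qb] := leqP b (2 ^ e).
  by rewrite IHe // tent_small // mulnDl.
rewrite -(subnKC qb); set j := (b - _)%N; have jq : (j <= 2 ^ e)%N by rewrite /j; lia.
rewrite (eq_bigr (fun k : 'I_e => 2 ^ k * tent k j)%N) => [|k _]; last first.
  by rewrite tent_period // dvdn_exp2l.
have := IHe j jq; rewrite tent_top //; move: (\sum_(i < e) _)%N => S.
by clearbody j; move: (subnKC jq); move: (2 ^ e - j)%N => u <-; clear; nia.
Qed.

(** The kernel dimensions of the square of a Jordan block of length 2^(e+1). *)
Lemma tent_double e b : (b <= 2 ^ e.+1)%N -> minn b.*2 (2 ^ e.+1) = (b + tent e b)%N.
Proof.
have q2 : (2 ^ e.+1 = 2 ^ e + 2 ^ e)%N by rewrite expnS mul2n addnn.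
rewrite q2 => bQ; have [bq|/ltnW qb] := leqP b (2 ^ e); first by rewrite tent_small //; lia.
have tE : tent e b = (2 ^ e - (b - 2 ^ e))%N by rewrite -{1}(subnKC qb) tent_top //; lia.
by rewrite tE; lia.
Qed.

End TentSums.

(** * Adding a product of two variables *)

Section PairTensor.
Variables (F : fieldType) (W : vectType F) (T : 'End(W)) (q : nat).
Implicit Types f : {ffun 'I_q * 'I_q -> W}.

(** xy + T on W[x, y]/(x^q, y^q), where f stands for the sum of the f(i, j) x^i y^j. *)
Definition pair_op f : {ffun 'I_q * 'I_q -> W} :=
  [ffun p : 'I_q * 'I_q => ((if (0 < p.1)%N && (0 < p.2)%N then f (ord_pred p.1, ord_pred p.2) else 0)
             + T (f p)) : W].

Fact pair_op_linear : linear pair_op.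
Proof.
move=> a x y; apply/ffunP => p; rewrite !ffunE linearP scalerDr addrACA.
by case: ifP; rewrite ?scaler0 ?addr0.
Qed.

HB.instance Definition _ := GRing.isLinear.Build F {ffun 'I_q * 'I_q -> W}
  {ffun 'I_q * 'I_q -> W} *:%R pair_op pair_op_linear.

Definition pairT : 'End({ffun 'I_q * 'I_q -> W}) := linfun pair_op.

Lemma pairTE f i j (iq : (i < q)%N) (jq : (j < q)%N) (iq1 : (i.-1 < q)%N) (jq1 : (j.-1 < q)%N) :
  pairT f (Ordinal iq, Ordinal jq) =
  (if (0 < i)%N && (0 < j)%N then f (Ordinal iq1, Ordinal jq1) else 0)
   + T (f (Ordinal iq, Ordinal jq)).
Proof.
rewrite lfunE ffunE /=; congr (_ + _); case: ifP => // /andP[i0 j0].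
congr (f (_, _)); apply: val_inj => /=.
  by rewrite -subn1 -addnBAC // subn1 modnDr modn_small.
by rewrite -subn1 -addnBAC // subn1 modnDr modn_small.
Qed.

Lemma osub_subproof (l : 'I_q) n : (l - n < q)%N.
Proof. exact: leq_ltn_trans (leq_subr _ _) (ltn_ord l). Qed.
Definition osub l n := Ordinal (osub_subproof l n).

(** The pair (false, c) carries the monomials x^i y^j with i - j = c and (true, c) those with
    j - i = c + 1; on a diagonal, the monomial is indexed by its larger exponent, so that
    xy acts as t. *)
Definition diagonals f : {ffun bool * 'I_q -> {ffun 'I_q -> W}} :=
  [ffun p : bool * 'I_q => [ffun l : 'I_q =>
    (if (p.2 + p.1 <= l)%N then
       if p.1 then f (osub l (p.2 + p.1), l) else f (l, osub l (p.2 + p.1))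
     else 0) : W]].

Fact diagonals_linear : linear diagonals.
Proof.
move=> a x y; apply/ffunP => p; apply/ffunP => l; rewrite !ffunE.
by case: ifP => _; [case: p.1|rewrite scaler0 addr0].
Qed.

HB.instance Definition _ := GRing.isLinear.Build F {ffun 'I_q * 'I_q -> W}
  {ffun bool * 'I_q -> {ffun 'I_q -> W}} *:%R diagonals diagonals_linear.

Lemma diagonalsT f p : diagonals (pairT f) p = js T q (diagonals f p).
Proof.
case: p => s c; apply/ffunP => -[l lq]; have lq1 : (l.-1 < q)%N by lia.
rewrite jsE [RHS]ffunE (jtE _ _ lq1) jTE !ffunE /=.
have lsq1 : ((l - (c + s)).-1 < q)%N by lia.
case: leqP => [csl|lcs]; last by rewrite linear0 addr0; case: eqP => //; rewrite leqNgt; case: ltnP => //; lia.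
rewrite /osub; case: s csl lsq1 => csl lsq1; rewrite (pairTE _ _ _ lsq1 lq1) || rewrite (pairTE _ _ _ lq1 lsq1);
congr (_ + _); case: eqP => [l0|l0];
  do ?[by case: ifP => // /andP[]; lia];
  (have -> : (0 < l)%N by lia);
  rewrite ?andbT /= subn_gt0.
  have -> : (c + 1 <= l.-1)%N = (c + 1 < l)%N by lia.
  by case: ifP => // _; congr (f (_, _)); apply: val_inj => /=; lia.
have -> : (c + 0 <= l.-1)%N = (c + 0 < l)%N by lia.
by case: ifP => // _; congr (f (_, _)); apply: val_inj => /=; lia.
Qed.

Lemma iter_diagonalsT n f p : diagonals (iter n (pairT) f) p = iter n (js T q) (diagonals f p).
Proof. by elim: n => //= n <-; rewrite diagonalsT. Qed.

Definition undiagonals (g : {ffun bool * 'I_q -> {ffun 'I_q -> W}}) : {ffun 'I_q * 'I_q -> W} :=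
  [ffun p : 'I_q * 'I_q => (if (p.2 <= p.1)%N then g (false, osub p.1 p.2) p.1
             else g (true, osub p.2 p.1.+1) p.2) : W].

Lemma diagonalsK : cancel diagonals undiagonals.
Proof.
move=> f; apply/ffunP => -[i j]; rewrite !ffunE /=; case: leqP => ij; rewrite ?ffunE /=.
  rewrite addn0 leq_subr; congr (f (_, _)); apply: val_inj => /=; lia.
have -> : (j - i.+1 + 1 <= j)%N by lia.
by congr (f (_, _)); apply: val_inj => /=; lia.
Qed.

(** Monomials x^i y^j with fixed i - j form one Jordan block of the
    multiplication by xy, of length q - |i - j|. *)
Lemma dim_ker_pairT b :
  \dim (lker (lpow pairT b)) =
  (\sum_(c < q) (jK T q fullv (q - c) b + jK T q fullv (q - c.+1) b))%N.
Proof.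
pose K (p : bool * 'I_q) := (jker q fullv (q - (p.2 + p.1)) :&: lker (lpow (js T q) b))%VS.
transitivity (\dim (ffunv K)).
  rewrite -(@limg_dim_eq _ _ _ (linfun diagonals)); last first.
    apply/eqP; rewrite -subv0; apply/subvP => f; rewrite memv_cap memv0.
    move=> /andP[_]; rewrite memv_ker lfunE => /eqP f0.
    by rewrite -[f]diagonalsK f0 -(linear0 diagonals) diagonalsK.
  congr (\dim _); apply/vspaceP => g; rewrite mem_ffunv.
  have memK (p : bool * 'I_q) x : (x \in K p) =
      [forall l : 'I_q, (l < p.2 + p.1)%N ==> (x l == 0)] && (iter b (js T q) x == 0).
    have pq : (p.2 + p.1 <= q)%N by have := ltn_ord p.2; case: (p.1); lia.
    rewrite memv_cap mem_ker_lpow jker_ffunv ?leq_subr // mem_ffunv; congr (_ && _).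
    apply/forallP/forallP => xl l; move: (xl l); rewrite subKn //.
      by case: ltnP; rewrite ?memv0.
    by case: ltnP; rewrite ?memv0 ?memvf.
  apply/memv_imgP/forallP => [[f + ->] p|gK].
    rewrite mem_ker_lpow memK lfunE => /eqP f0; apply/andP; split.
      by apply/forallP => l; apply/implyP => lt; rewrite !ffunE leqNgt lt.
    by rewrite /= -iter_diagonalsT f0 linear0 ffunE.
  have gE : g = diagonals (undiagonals g).
    apply/ffunP => -[s c]; apply/ffunP => l; rewrite !ffunE /=.
    have := gK (s, c); rewrite memK => /andP[/forallP/(_ l)/implyP /= g0 _].
    move: g0; case: leqP => [csl _|_ /(_ isT)/eqP-> //]; rewrite ?ffunE; case: s csl => csl; rewrite ?ffunE /=.
      have -> : (l <= l - (c + 1))%N = false by lia.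
      by congr (g (_, _) _); apply: val_inj => /=; lia.
    rewrite leq_subr; congr (g (_, _) _); apply: val_inj => /=; lia.
  exists (undiagonals g); rewrite ?lfunE //= mem_ker_lpow; apply/eqP.
  rewrite -[LHS]diagonalsK -[RHS]diagonalsK; congr undiagonals; apply/ffunP => p.
  rewrite iter_diagonalsT -gE linear0 ffunE.
  by have := gK p; rewrite memK => /andP[_ /eqP].
rewrite dim_ffunv (eq_bigr (fun p : bool * 'I_q => jK T q fullv (q - (p.2 + p.1)) b)) //.
rewrite -(pair_bigA _ (fun (s : bool) (c : 'I_q) => jK T q fullv (q - (c + s)) b)) /= big_bool /= -big_split /=.
by apply: eq_bigr => c _; rewrite addn0 addn1 addnC.
Qed.

End PairTensor.

Section WalshTower.
Variables (F : fieldType) (char2 : 2%N \in [pchar F]).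

(** The sequence of kernel dimensions determines the Jordan type of T; al and be
    are its coordinates on the identity and on the tent functions. *)
Definition walsh_kernels (V : vectType F) (T : 'End(V)) e (al : int) (be : nat -> int) :=
  (forall v, iter (2 ^ e) T v = 0) /\
  forall b, (b <= 2 ^ e)%N -> (\dim (lker (lpow T b)))%:Z =
     al * b%:Z + \sum_(k < e) be k * (tent k b)%:Z.

(** By jK_walsh a Jordan block of length a multiplies al by a and be k by tent k a; the
    factors are the sums of these over the blocks of multiplication by xy. *)
Lemma walsh_pairT (W : vectType F) (T : 'End(W)) e al be :
  walsh_kernels T e al be ->
  walsh_kernels (pairT T (2 ^ e)) e (2 ^+ e * 2 ^+ e * al) (fun k => 2 ^+ e * 2 ^+ k * be k).
Proof.
move=> [Tq kT]; split=> [f|b bq].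
  rewrite -[LHS]diagonalsK -[RHS]diagonalsK; congr undiagonals; apply/ffunP => p.
  rewrite iter_diagonalsT iter_js // linear0 ffunE.
  apply/ffunP => -[l lq]; have lq' : (l - 2 ^ e < 2 ^ e)%N by lia.
  by rewrite ffunE (iter_jtE _ _ lq') lq iter_jTE Tq addr0 !ffunE.
have jKE a : (a <= 2 ^ e)%N -> (jK T (2 ^ e) fullv a b)%:Z =
    al * a%:Z * b%:Z + \sum_(k < e) be k * ((tent k a)%:Z * (tent k b)%:Z).
  by move=> aq; apply: (jK_walsh char2 _ (subvf _)) => // b' b'q; rewrite capfv kT.
pose t1 c := ((2 ^ e - c)%:Z + (2 ^ e - c.+1)%:Z).
pose t2 k c := ((tent k c)%:Z + (tent k c.+1)%:Z).
have sum_t1 : \sum_(c < 2 ^ e) t1 c = 2 ^+ e * 2 ^+ e.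
  have H : (\sum_(c < 2 ^ e) ((2 ^ e - c) + (2 ^ e - c.+1)) = 2 ^ e * 2 ^ e)%N.
    apply/eqP; rewrite -(eqn_add2r (2 ^ e * 2 ^ e)); apply/eqP; rewrite -[RHS](sum_min (leqnn _)); congr (_ + _)%N.
    rewrite (reindex_inj rev_ord_inj) /=; apply: eq_bigr => c _.
    by have := ltn_ord c; move: (2 ^ e)%N (nat_of_ord c); clear; lia.
  by rewrite -!natrX -natrM -H natr_sum; apply: eq_bigr => c _; rewrite natrD !natz.
have sum_t2 k : (k < e)%N -> \sum_(c < 2 ^ e) t2 k c = 2 ^+ e * 2 ^+ k.
  move=> ke; rewrite -!natrX -natrM -(sum_tent ke) natr_sum; apply: eq_bigr => c _.
  by rewrite natrD !natz.
rewrite dim_ker_pairT (big_morph Posz PoszD erefl).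
rewrite (eq_bigr (fun c : 'I_(2 ^ e) => al * b%:Z * t1 c +
  \sum_(k < e) be k * (tent k b)%:Z * t2 k c)); last first.
  move=> c _; rewrite PoszD !jKE ?leq_subr // addrACA -big_split /=; congr (_ + _).
    by rewrite /t1; ring.
  apply: eq_bigr => k _; rewrite /t2.
  rewrite !tent_reflect // ?dvdn_exp2l ?(ltnW (ltn_ord c)) //; ring.
rewrite big_split /= -mulr_sumr sum_t1 exchange_big /=; congr (_ + _); first by ring.
by apply: eq_bigr => k _; rewrite -mulr_sumr sum_t2 //; ring.
Qed.

End WalshTower.

Section Tower.
Variables (F : fieldType).

(** T + x_1 y_1 + ... + x_m y_m on W[x_1, y_1, ..., x_m, y_m] modulo q-th powers. *)
Fixpoint tower_space (W : vectType F) (q m : nat) : vectType F :=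
  if m is m'.+1 then {ffun 'I_q * 'I_q -> tower_space W q m'} : vectType F else W.

Fixpoint tower_op (W : vectType F) (T : 'End(W)) q m : 'End(tower_space W q m) :=
  if m is m'.+1 then pairT (tower_op T q m') q else T.

Variable char2 : 2%N \in [pchar F].

(** For T = 0 the kernel dimension of a Jordan block is a minimum; tent_quadratic turns the
    sum of these minima into tents. *)
Lemma walsh_pairT0 e :
  walsh_kernels (pairT (0 : 'End(F^o)) (2 ^ e)) e (2 ^+ e) (fun k => 2 ^+ k).
Proof.
have js0 n x : iter n (js (0 : 'End(F^o)) (2 ^ e)) x = iter n (jt F^o (2 ^ e)) x.
  elim: n => //= n ->; rewrite jsE (_ : jT _ _ _ = 0) ?addr0 //.
  by apply/ffunP => i; rewrite jTE zero_lfunE ffunE.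
split=> [f|b bq].
  rewrite -[LHS]diagonalsK -[RHS]diagonalsK; congr undiagonals; apply/ffunP => p.
  rewrite iter_diagonalsT js0 linear0 !ffunE.
  apply/ffunP => -[l lq]; have lq' : (l - 2 ^ e < 2 ^ e)%N by lia.
  by rewrite (iter_jtE _ _ lq') lq ffunE.
have jKE a : (a <= 2 ^ e)%N -> jK (0 : 'End(F^o)) (2 ^ e) fullv a b = minn a b.
  move=> aq; have mq : (minn a b <= 2 ^ e)%N by rewrite geq_min aq.
  rewrite -[RHS]muln1 -[X in (_ * X)%N](dimvf F^o).
  rewrite -(dim_jker _ mq); congr (\dim _); apply/vspaceP => x.
  rewrite mem_jK mem_jker js0; case: (x \in _) => //=.
  rewrite /minn; case: ltnP => ab; apply/andP/idP => [[]//|x0].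
    by split=> //; apply/eqP; apply: iter_ker_leq (ltnW ab) (eqP x0).
  by split=> //; apply/eqP; apply: iter_ker_leq ab (eqP x0).
have H1 := sum_min bq; have H2 := tent_quadratic bq.
rewrite dim_ker_pairT [X in X%:Z](_ : _ = \sum_(c < 2 ^ e) (minn c b + minn c.+1 b))%N; last first.
  rewrite (reindex_inj rev_ord_inj) /=; apply: eq_bigr => c _.
  rewrite !jKE ?leq_subr // addnC; have := ltn_ord c.
  by move: (2 ^ e)%N (nat_of_ord c); clear; lia.
have {H1 H2} H : (\sum_(c < 2 ^ e) (minn c b + minn c.+1 b) =
    2 ^ e * b + \sum_(k < e) 2 ^ k * tent k b)%N by lia.
rewrite H PoszD PoszM (big_morph Posz PoszD erefl); congr (_ * _ + _).
  by rewrite -natrX natz.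
by apply: eq_bigr => k _; rewrite PoszM -natrX natz.
Qed.

(** Multiplication by z^2 on F[z]/z^q has two Jordan blocks of length q/2. *)
Lemma walsh_square e :
  walsh_kernels (lpow (jt F^o (2 ^ e.+1)) 2) e.+1 1 (fun k => (k == e)%:Z).
Proof.
have iter2 n x : iter n (lpow (jt F^o (2 ^ e.+1)) 2) x = iter n.*2 (jt F^o (2 ^ e.+1)) x.
  by elim: n => // n IHn; rewrite iterS IHn lpowE -iterD doubleS.
split=> [x|b bq].
  rewrite iter2; apply/ffunP => -[l lq].
  have lq' : (l - (2 ^ e.+1).*2 < 2 ^ e.+1)%N by lia.
  by rewrite (iter_jtE _ _ lq') ffunE; case: ltnP => //; lia.
have -> : \dim (lker (lpow (lpow (jt F^o (2 ^ e.+1)) 2) b)) = (b + tent e b)%N.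
  rewrite -tent_double // -[RHS]muln1 -[X in (_ * X)%N](dimvf F^o).
  rewrite -(dim_jker _ (geq_minr b.*2 (2 ^ e.+1))); congr (\dim _); apply/vspaceP => x.
  rewrite mem_ker_lpow iter2 mem_jker.
  have -> : x \in jcon (2 ^ e.+1) fullv by rewrite mem_jcon; apply/forallP => i; apply: memvf.
  rewrite /= /minn; case: ltnP => // qb.
  have x0 : iter (2 ^ e.+1) (jt F^o (2 ^ e.+1)) x = 0.
    apply/ffunP => -[l lq]; have lq' : (l - 2 ^ e.+1 < 2 ^ e.+1)%N by lia.
    by rewrite (iter_jtE _ _ lq') lq ffunE.
  by rewrite x0 (iter_ker_leq qb x0).
rewrite mul1r big_ord_recr /= eqxx mul1r PoszD big1 ?add0r // => k _.
by rewrite ltn_eqF ?ltn_ord ?mul0r.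
Qed.

Lemma walsh_tower (W : vectType F) (T : 'End(W)) e al be m :
  walsh_kernels T e al be ->
  walsh_kernels (tower_op T (2 ^ e) m) e
    ((2 ^+ e * 2 ^+ e) ^+ m * al) (fun k => (2 ^+ e * 2 ^+ k) ^+ m * be k).
Proof.
move=> wT; elim: m => [|m /(walsh_pairT char2) [T0 kT]] /=.
  case: wT => T0 kT; split=> // b bq; rewrite kT // expr0 mul1r; congr (_ + _).
  by apply: eq_bigr => k _; rewrite mul1r.
split=> // b bq; rewrite kT // exprS -!mulrA; congr (_ + _).
by apply: eq_bigr => k _; rewrite exprS -!mulrA.
Qed.

(** All tents are 1 at b = 1. *)
Lemma walsh_ker (V : vectType F) (T : 'End(V)) e al be :
  walsh_kernels T e al be -> (\dim (lker T))%:Z = al + \sum_(k < e) be k.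
Proof.
case=> _ kT; have := kT 1%N; rewrite expn_gt0 mulr1 => /(_ isT).
have -> : lpow T 1 = T by rewrite /lpow /= comp_lfun1r.
by move=> ->; congr (_ + _); apply: eq_bigr => k _; rewrite tent_small ?mulr1 ?expn_gt0.
Qed.

Lemma dim_ker_tower_odd e m :
  (\dim (lker (tower_op (0 : 'End(F^o)) (2 ^ e) m.+1)))%:Z =
  (2 ^+ e * 2 ^+ e) ^+ m * 2 ^+ e + \sum_(k < e) (2 ^+ e * 2 ^+ k) ^+ m * 2 ^+ k.
Proof.
suff w : walsh_kernels (tower_op (0 : 'End(F^o)) (2 ^ e) m.+1) e
    ((2 ^+ e * 2 ^+ e) ^+ m * 2 ^+ e) (fun k => (2 ^+ e * 2 ^+ k) ^+ m * 2 ^+ k).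
  exact: (walsh_ker w).
elim: m => [|m /(walsh_pairT char2) [T0 kT]].
  have [T0 kT] := walsh_pairT0 e; split=> // b bq; rewrite kT // mul1r; congr (_ + _).
  by apply: eq_bigr => k _; rewrite expr0 mul1r.
split=> // b bq; rewrite kT // exprS -!mulrA; congr (_ + _).
by apply: eq_bigr => k _; rewrite exprS -!mulrA.
Qed.

Lemma dim_ker_tower_even e m :
  (\dim (lker (tower_op (lpow (jt F^o (2 ^ e.+1)) 2) (2 ^ e.+1) m)))%:Z =
  (2 ^+ e.+1 * 2 ^+ e.+1) ^+ m + (2 ^+ e.+1 * 2 ^+ e) ^+ m.
Proof.
rewrite (walsh_ker (walsh_tower m (walsh_square e))) mulr1; congr (_ + _).
rewrite big_ord_recr /= eqxx mulr1 big1 ?add0r // => k _.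
by rewrite ltn_eqF ?ltn_ord ?mulr0.
Qed.

End Tower.

(** * Multivariate power series *)

Section PowerSeriesBasics.
Import mpoly.
Variables (n : nat) (R : comNzRingType).
Implicit Types (f g h : mfps n R) (m a : 'X_{1..n}).

Lemma mfps_coefD f g m : mfps_coef (f + g) m = mfps_coef f m + mfps_coef g m.
Proof. by []. Qed.

Lemma mfps_coefN f m : mfps_coef (- f) m = - mfps_coef f m.
Proof. by []. Qed.

Lemma mfps_coefB f g m : mfps_coef (f - g) m = mfps_coef f m - mfps_coef g m.
Proof. by []. Qed.

Lemma mfps_coef1 m : mfps_coef (1 : mfps n R) m = (m == 0%MM)%:R.
Proof. by []. Qed.

Lemma mfps_coef_sum (I : Type) (r : seq I) (P : pred I) (G : I -> mfps n R) m :
  mfps_coef (\sum_(i <- r | P i) G i) m = \sum_(i <- r | P i) mfps_coef (G i) m.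
Proof. by elim/big_rec2: _ => // i _ y _ <-. Qed.

Lemma mfps_coefM f g m :
  mfps_coef (f * g) m =
  \sum_(k : 'X_{1..n < (mdeg m).+1} | (k <= m)%MM) mfps_coef f k * mfps_coef g (m - k)%MM.
Proof.
have T u := @mfps_truncE n R (mdeg m).+1 u.
rewrite (mfps_mulE (ltnSn _) (T f) (T g)) (mcoeff_poly_mul_lin _ _ (ltnSn _)).
by apply: eq_bigr => k _; rewrite !T // ?ltnS ?mdegB // -ltnS bmdeg.
Qed.

Lemma eq_mfps_coefM f1 f2 g1 g2 m :
  (forall k, (k <= m)%MM -> mfps_coef f1 k = mfps_coef f2 k) ->
  (forall k, (k <= m)%MM -> mfps_coef g1 k = mfps_coef g2 k) ->
  mfps_coef (f1 * g1) m = mfps_coef (f2 * g2) m.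
Proof.
move=> ef eg; rewrite !mfps_coefM; apply: eq_bigr => k km.
by rewrite ef // eg // lem_subr.
Qed.

Definition mfps_monom a : mfps n R := MFPS (fun m => (m == a)%:R).

Lemma mfps_coef_monomM a f m :
  mfps_coef (mfps_monom a * f) m = if (a <= m)%MM then mfps_coef f (m - a)%MM else 0.
Proof.
rewrite mfps_coefM; case: ifP => am.
  have am' : (mdeg a < (mdeg m).+1)%N by rewrite -(submK am) mdegD ltnS leq_addl.
  rewrite (bigD1 (BMultinom am')) //= eqxx mul1r big1 ?addr0 // => k /andP[_].
  by rewrite bmeqP /= => /negPf ->; rewrite mul0r.
rewrite big1 // => k km /=; case: eqP => [ka|]; last by rewrite mul0r.
by rewrite -ka km in am.
Qed.

Lemma mfps_monomM a b : mfps_monom a * mfps_monom b = mfps_monom (a + b)%MM.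
Proof.
apply: mfpsP => m; rewrite mfps_coef_monomM /=; case: ifP => am.
  by rewrite -[in RHS](submK am) addmC eqm_add2l.
by case: eqP => // mab; rewrite mab lem_addr in am.
Qed.

Lemma mfps_varX i k : mfps_var R i ^+ k = mfps_monom (U_(i) *+ k)%MM.
Proof.
elim: k => [|k IHk]; first by apply: mfpsP => m; rewrite expr0 mulm0n.
by rewrite exprS IHk mfps_monomM mulmS.
Qed.

Lemma lem_mnm1n i k m : (U_(i) *+ k <= m)%MM = (k <= m i)%N.
Proof.
apply/mnm_lepP/idP => [/(_ i)|km j]; rewrite mulmnE mnm1E ?eqxx ?mul1n //.
by case: eqP => [<-|]; rewrite ?mul1n.
Qed.

Lemma mfps_coef_varXM i k f m :
  mfps_coef (mfps_var R i ^+ k * f) m =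
  if (k <= m i)%N then mfps_coef f (m - U_(i) *+ k)%MM else 0.
Proof. by rewrite mfps_varX mfps_coef_monomM lem_mnm1n. Qed.

Lemma mfps_coef_varM i f m :
  mfps_coef (mfps_var R i * f) m = if (0 < m i)%N then mfps_coef f (m - U_(i))%MM else 0.
Proof. by rewrite -[mfps_var R i]expr1 mfps_coef_varXM. Qed.

Definition mfps_const (c : R) : mfps n R := MFPS (fun m => if m == 0%MM then c else 0).

Lemma mfps_coef_constM c f m : mfps_coef (mfps_const c * f) m = c * mfps_coef f m.
Proof.
have d0 : (mdeg (0%MM : 'X_{1..n}) < (mdeg m).+1)%N by rewrite mdeg0.
rewrite mfps_coefM (bigD1 (BMultinom d0)) /=; last by apply/mnm_lepP => i; rewrite mnm0E.
rewrite eqxx subm0 big1 ?addr0 // => k /andP[_]; rewrite bmeqP /= => /negPf ->.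
by rewrite mul0r.
Qed.

Fact mfps_const_zmod : zmod_morphism mfps_const.
Proof. by move=> c d; apply: mfpsP => m; rewrite mfps_coefB /=; case: eqP; rewrite ?subr0. Qed.

Fact mfps_const_monoid : monoid_morphism mfps_const.
Proof.
split=> [|c d]; apply: mfpsP => m; first by rewrite mfps_coef1 /=; case: eqP.
by rewrite mfps_coef_constM /=; case: eqP; rewrite ?mulr0.
Qed.

Definition mfps_constR : {rmorphism R -> mfps n R} :=
  HB.pack mfps_const (GRing.isZmodMorphism.Build R (mfps n R) mfps_const mfps_const_zmod)
    (GRing.isMonoidMorphism.Build R (mfps n R) mfps_const mfps_const_monoid).
#[global] Arguments mfps_constR : simpl never.

Lemma mfps_coef_constRM c f m : mfps_coef (mfps_constR c * f) m = c * mfps_coef f m.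
Proof. exact: mfps_coef_constM. Qed.

Definition mfps_ord_ge (D : nat) f := forall m, (mdeg m < D)%N -> mfps_coef f m = 0.

Lemma mfps_ord_geM D E f g :
  mfps_ord_ge D f -> mfps_ord_ge E g -> mfps_ord_ge (D + E) (f * g).
Proof.
move=> fD gE m mDE; rewrite mfps_coefM big1 // => k km.
have [kD|Dk] := ltnP (mdeg k) D; first by rewrite fD ?mul0r.
by rewrite gE ?mulr0 //; move: mDE; rewrite -{1}(submK km) mdegD; lia.
Qed.

Lemma mfps_ord_geX D f k : mfps_ord_ge D f -> mfps_ord_ge (D * k) (f ^+ k).
Proof.
move=> fD; elim: k => [|k IHk]; first by move=> m; rewrite muln0.
by rewrite exprS mulnS; apply: mfps_ord_geM.
Qed.

Definition mfps_low (q : nat) f : mfps n R :=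
  MFPS (fun m => if [forall i, (m i < q)%N] then mfps_coef f m else 0).

Lemma mfps_lowE q f m :
  mfps_coef (mfps_low q f) m = if [forall i, (m i < q)%N] then mfps_coef f m else 0.
Proof. by []. Qed.

(** Each monomial divisible by some x_i^q is charged to the first such i. *)
Lemma mfps_decomp q f : exists g : 'I_n -> mfps n R,
  f = mfps_low q f + \sum_i mfps_var R i ^+ q * g i.
Proof.
pose fst_var m i := (q <= m i)%N && [forall j : 'I_n, (j < i)%N ==> (m j < q)%N].
pose G (i : 'I_n) : mfps n R := MFPS (fun m =>
  if fst_var (m + U_(i) *+ q)%MM i then mfps_coef f (m + U_(i) *+ q)%MM else 0).
exists G; apply: mfpsP => m; rewrite mfps_coefD mfps_coef_sum.
have coefE (i : 'I_n) : mfps_coef (mfps_var R i ^+ q * G i) m = if fst_var m i then mfps_coef f m else 0.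
  rewrite mfps_coef_varXM /=; case: leqP => mi; last by rewrite /fst_var leqNgt mi.
  by rewrite submK ?lem_mnm1n.
under eq_bigr => i _ do rewrite coefE.
rewrite /=; case: (boolP [forall i, _]) => [/forallP mq|/forallPn[i0]].
  by rewrite big1 ?addr0 // => i _; rewrite /fst_var leqNgt mq.
rewrite -leqNgt => mi0.
have [i mi imin] := @arg_minnP _ i0 (fun i => q <= m i)%N (@nat_of_ord n) mi0.
have fi : fst_var m i.
  rewrite /fst_var mi; apply/forallP => j; apply/implyP; apply: contraLR.
  by rewrite -!leqNgt => /imin.
rewrite add0r (bigD1 i) //= fi big1 ?addr0 // => j ji; case: ifP => // /andP[mj /forallP jmin].
have := imin j mj; rewrite leq_eqVlt => /orP[/eqP/val_inj ij|ij]; first by rewrite ij eqxx in ji.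
by have := jmin i; rewrite ij /= ltnNge mi.
Qed.

Lemma mfps_low1 f : mfps_low 1 f = mfps_const (mfps_coef f 0%MM).
Proof.
apply: mfpsP => m /=; case: (m =P 0%MM) => [->|m0].
  by case: forallP => // H; case: H => i; rewrite mnm0E.
by case: forallP => // mi; case: m0; apply/mnmP => i; have := mi i; rewrite mnm0E; case: (m i).
Qed.

End PowerSeriesBasics.

(** * Substitution of power series *)

Section Substitution.
Import mpoly.
Variables (n k : nat) (R : comNzRingType).

Lemma mfps_ord_ge_mmap (g : 'I_n -> mfps k R) (p : {mpoly R[n]}) D :
  (forall i, mfps_coef (g i) 0%MM = 0) ->
  (forall a, (mdeg a < D)%N -> p@_a = 0) ->
  mfps_ord_ge D (mmap (mfps_constR k R) g p).
Proof.
move=> g0 pD m mD; rewrite /mmap mfps_coef_sum big1 // => a _.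
rewrite mfps_coef_constRM; have [aD|Da] := ltnP (mdeg a) D; first by rewrite pD ?mul0r.
suff : mfps_ord_ge (mdeg a) (mmap1 g a) by move->; rewrite ?mulr0 //; apply: leq_trans Da.
rewrite /mmap1 mdegE; elim/big_ind2: _ => [x|D1 f1 D2 f2|i _] //.
  by move=> H1 H2; apply: mfps_ord_geM.
rewrite -[X in mfps_ord_ge X]mul1n; apply: mfps_ord_geX => x.
by rewrite ltnS leqn0 mdeg_eq0 => /eqP->.
Qed.

(** Substituting series without constant term: the coefficients of degree less
    than D depend only on those of the truncation at D. *)
Definition mfps_subst (g : 'I_n -> mfps k R) (_ : forall i, mfps_coef (g i) 0%MM = 0)
    (f : mfps n R) : mfps k R :=
  MFPS (fun m => mfps_coef (mmap (mfps_constR k R) g (mfps_trunc (mdeg m).+1 f)) m).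

Variables (g : 'I_n -> mfps k R) (g0 : forall i, mfps_coef (g i) 0%MM = 0).
Local Notation subst := (mfps_subst g0).
Local Notation eval := (mmap (mfps_constR k R) g).

Lemma mfps_substE D f p m : (mdeg m < D)%N ->
  (forall a, (mdeg a < D)%N -> p@_a = mfps_coef f a) ->
  mfps_coef (subst f) m = mfps_coef (eval p) m.
Proof.
move=> mD pf; apply/eqP; pose q := mfps_trunc (mdeg m).+1 f.
rewrite -[mfps_coef (subst f) m]/(mfps_coef (eval q) m) -subr_eq0 -mfps_coefB -mmapB.
apply/eqP; apply: (@mfps_ord_ge_mmap _ _ (mdeg m).+1) => // a am.
by rewrite mcoeffB mfps_truncE // pf ?subrr //; apply: leq_trans mD.
Qed.

Lemma mfps_subst_poly f p : (forall a, p@_a = mfps_coef f a) -> subst f = eval p.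
Proof. by move=> pf; apply: mfpsP => m; apply: (mfps_substE (ltnSn _)). Qed.

Fact mfps_subst_zmod : zmod_morphism subst.
Proof.
move=> f h; apply: mfpsP => m; have T := @mfps_truncE n R (mdeg m).+1.
rewrite (@mfps_substE _ _ (mfps_trunc (mdeg m).+1 f - mfps_trunc (mdeg m).+1 h) _ (ltnSn _)).
  by rewrite mmapB !mfps_coefB !(@mfps_substE _ _ _ _ (ltnSn _) (T _)).
by move=> a am; rewrite mcoeffB !T.
Qed.

Fact mfps_subst_monoid : monoid_morphism subst.
Proof.
split=> [|f h].
  by rewrite (@mfps_subst_poly _ 1) ?rmorph1 // => a; rewrite mcoeff1.
apply: mfpsP => m; have T := @mfps_truncE n R (mdeg m).+1.
rewrite (@mfps_substE _ _ (mfps_trunc (mdeg m).+1 f * mfps_trunc (mdeg m).+1 h) _ (ltnSn _)).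
  rewrite rmorphM; apply: eq_mfps_coefM => a am.
    apply/esym/mfps_substE/T; rewrite ltnS -(submK am) mdegD leq_addl //.
  by apply/esym/mfps_substE/T; rewrite ltnS -(submK am) mdegD leq_addl.
by move=> a am; rewrite -(@mfps_mulE n R _ f h a _ _ am (T f) (T h)).
Qed.

HB.instance Definition _ := GRing.isZmodMorphism.Build (mfps n R) (mfps k R) subst mfps_subst_zmod.
HB.instance Definition _ := GRing.isMonoidMorphism.Build (mfps n R) (mfps k R) subst mfps_subst_monoid.

Lemma mfps_subst_var i : subst (mfps_var R i) = g i.
Proof.
rewrite (@mfps_subst_poly _ 'X_i) ?mmapX ?mmap1U // => a.
by rewrite mcoeffX eq_sym.
Qed.

Lemma mfps_subst_const c : subst (@mfps_const n R c) = mfps_const k c.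
Proof.
rewrite (@mfps_subst_poly _ c%:MP) ?mmapC // => a.
by rewrite mcoeffC /=; case: eqP; rewrite ?mulr1 ?mulr0.
Qed.

Lemma mfps_subst_ord D f : mfps_ord_ge D f -> mfps_ord_ge D (subst f).
Proof.
move=> fD m mD; rewrite (@mfps_substE D _ 0 _ mD) ?raddf0 // => a aD.
by rewrite mcoeff0 fD.
Qed.

End Substitution.

Section SubstitutionInverse.
Import mpoly.
Variables (n : nat) (R : comNzRingType).
Variables (g h : 'I_n -> mfps n R).
Hypotheses (g0 : forall i, mfps_coef (g i) 0%MM = 0)
           (h0 : forall i, mfps_coef (h i) 0%MM = 0).

(** Substitutions are continuous, hence determined by the images of the variables. *)
Lemma mfps_substK : (forall i, mfps_subst h0 (g i) = mfps_var R i) ->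
  cancel (mfps_subst g0) (mfps_subst h0).
Proof.
move=> hg f; apply: mfpsP => m; pose p := mfps_trunc (mdeg m).+1 f.
pose fp : mfps n R := MFPS (fun a => p@_a).
have fpE : fp = mmap (mfps_constR n R) (mfps_var R) p.
  apply: mfpsP => a /=; rewrite [in LHS](mpolyE p) raddf_sum mfps_coef_sum.
  apply: eq_bigr => b _; rewrite [LHS]mcoeffZ [RHS]mfps_coef_constM mcoeffX; congr (_ * _).
  have -> : mmap1 (mfps_var R) b = mfps_monom R b; last by rewrite /= eq_sym.
  rewrite [in RHS](multinomUE_id b) /mmap1.
  elim/big_ind2: _ => [|x u y v -> ->|i _]; rewrite ?mfps_monomM ?mfps_varX //.
have fD : mfps_ord_ge (mdeg m).+1 (f - fp).
  by move=> a am; rewrite mfps_coefB /= mfps_truncE ?subrr.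
rewrite -[f](subrK fp); move: (f - fp) fD => r rD.
rewrite !rmorphD !mfps_coefD; congr (_ + _).
  by rewrite rD // (mfps_subst_ord _ (mfps_subst_ord _ rD)).
clearbody fp; rewrite fpE /mmap !rmorph_sum !mfps_coef_sum; apply: eq_bigr => a _.
congr (mfps_coef _ _); rewrite !rmorphM; congr (_ * _).
  by rewrite /= !mfps_subst_const.
rewrite /mmap1 !rmorph_prod; apply: eq_bigr => i _.
by rewrite !rmorphXn /= mfps_subst_var hg.
Qed.

End SubstitutionInverse.

(** * Prime ideals generated by variables *)

Section MonomialPrimes.
Import mpoly.
Variables (n : nat) (R : idomainType).
Implicit Types (f g : mfps n R) (B : pred 'I_n) (m : 'X_{1..n}).

(** The ideal generated by the variables in B, described by coefficients. *)
Definition var_ideal B f :=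
  forall m, (forall i, B i -> m i = 0%N) -> mfps_coef f m = 0.

Lemma exists_ltm_min (P : 'X_{1..n} -> Prop) m : P m ->
  exists2 a, P a & forall b, P b -> (a <= b)%O.
Proof.
elim/(@ltmwf n): m => m IHm Pm.
have [[b Pb bm]|noP] := pselect (exists2 b, P b & (b < m)%O); first exact: (IHm b).
by exists m => // b Pb; rewrite leNgt; apply/negP => bm; apply: noP; exists b.
Qed.

(** The product of the initial coefficients is a coefficient of the product. *)
Lemma var_ideal_prime B f g : var_ideal B (f * g) -> var_ideal B f \/ var_ideal B g.
Proof.
move=> Bfg.
have notB h : ~ var_ideal B h ->
    exists2 a : 'X_{1..n}, (forall i, B i -> a i = 0%N) /\ mfps_coef h a <> 0 &
      forall b : 'X_{1..n}, (forall i, B i -> b i = 0%N) /\ mfps_coef h b <> 0 -> (a <= b)%O.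
  move=> nBh; suff [m Pm] : exists m : 'X_{1..n}, (forall i, B i -> m i = 0%N) /\ mfps_coef h m <> 0.
    exact: exists_ltm_min Pm.
  apply: contra_notP nBh => noP m mB; apply: contrapT => hm.
  by apply: noP; exists m.
have [Bf|/notB[a [aB fa] amin]] := pselect (var_ideal B f); first by left.
have [Bg|/notB[b [bB gb] bmin]] := pselect (var_ideal B g); first by right.
have abB i : B i -> (a + b)%MM i = 0%N by move=> Bi; rewrite mnmDE aB // bB.
have := Bfg _ abB; rewrite mfps_coefM.
have da : (mdeg a < (mdeg (a + b)%MM).+1)%N by rewrite mdegD ltnS leq_addr.
rewrite (bigD1 (BMultinom da)) /=; last exact: lem_addr.
have abK : (a + b - a)%MM = b by rewrite addmC addmK.
rewrite abK big1 ?addr0 => [/eqP|k /andP[kab]].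
  by rewrite mulf_eq0 => /orP[]/eqP.
rewrite bmeqP /= => ka; apply/eqP; rewrite mulf_eq0; apply/orP.
have kE := submK kab; set l := (a + b - k)%MM in kE *.
have klB i : B i -> k i = 0%N /\ l i = 0%N.
  by move=> Bi; move/mnmP/(_ i): kE; rewrite !mnmDE aB // bB // => /eqP; rewrite addn_eq0 => /andP[/eqP-> /eqP->].
have [_|/eqP fk] := eqVneq (mfps_coef f k) 0; first by left.
have [_|/eqP gl] := eqVneq (mfps_coef g l) 0; first by right.
have ak : (a < k)%O.
  by rewrite lt_neqAle eq_sym ka; apply: amin; split=> // i /klB[].
have bl : (b <= l)%O by apply: bmin; split=> // i /klB[].
by have := lemc_lt_add bl ak; rewrite kE addmC ltxx.
Qed.

Lemma var_ideal0 B : var_ideal B 0.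
Proof. by []. Qed.

Lemma var_idealD B f g : var_ideal B f -> var_ideal B g -> var_ideal B (f + g).
Proof. by move=> Bf Bg m mB; rewrite mfps_coefD Bf // Bg // addr0. Qed.

Lemma var_idealM B f g : var_ideal B g -> var_ideal B (f * g).
Proof.
move=> Bg m mB; rewrite mfps_coefM big1 // => k km; rewrite Bg ?mulr0 // => i Bi.
by rewrite mnmBE mB.
Qed.

Lemma mem_var_ideal_monom B m : var_ideal B (mfps_monom R m) <-> exists2 i, B i & m i != 0%N.
Proof.
split=> [Bm|[i Bi mi] a aB]; last first.
  by rewrite /=; case: eqP => // am; rewrite -am aB ?eqxx in mi.
apply: contrapT => noi; have := Bm m; rewrite /= eqxx => H.
have /eqP : (1 : R) = 0; last by rewrite oner_eq0.
apply: H => i Bi; apply/eqP; apply: contrapT => mi; apply: noi; exists i => //; exact/negP.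
Qed.

End MonomialPrimes.

(** * Weierstrass division *)

(** G is given the whole function; that it consults smaller arguments only is a
    hypothesis, which keeps proofs of order out of the formula for G. *)
Lemma wf_fixpoint (E V : Type) (lt : E -> E -> Prop) (v0 : V) (G : E -> (E -> V) -> V) :
  well_founded lt ->
  (forall q1 q2 e, (forall e', lt e' e -> q1 e' = q2 e') -> G e q1 = G e q2) ->
  exists q, forall e, q e = G e q.
Proof.
move=> wf ext.
pose step e (rec : forall e', lt e' e -> V) :=
  G e (fun e' => if pselect (lt e' e) is left p then rec e' p else v0).
exists (Fix wf (fun=> V) step) => e; rewrite Fix_eq.
  by rewrite /step; apply: ext => e' ee; case: pselect.
move=> x r1 r2 r12; rewrite /step; apply: ext => e' ee.
by case: pselect.
Qed.

Section Weierstrass.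
Import mpoly.
Variables (n : nat) (F : fieldType).
Implicit Types (f g h : mfps n F) (m : 'X_{1..n}).

(** Power series in the first k variables: a family of nested power series rings
    inside one ring. *)
Definition in_vars k f :=
  forall m, mfps_coef f m != 0 -> forall i : 'I_n, (k <= i)%N -> m i = 0%N.

Lemma in_vars_coef0 k f m (i : 'I_n) :
  in_vars k f -> (k <= i)%N -> m i != 0%N -> mfps_coef f m = 0.
Proof. by move=> kf ki mi; apply/eqP; apply: contraR mi => /kf->. Qed.

Lemma in_vars0 k : in_vars k 0.
Proof. by move=> m; rewrite eqxx. Qed.

Lemma in_vars1 k : in_vars k 1.
Proof. by move=> m; rewrite mfps_coef1; case: (m =P 0%MM) => [-> _ i _|]; rewrite ?mnm0E // eqxx. Qed.

Lemma in_varsD k f g : in_vars k f -> in_vars k g -> in_vars k (f + g).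
Proof.
move=> kf kg m; rewrite mfps_coefD => fgm i ki; apply/eqP.
apply: contraR fgm => mi; rewrite (in_vars_coef0 kf ki mi).
by rewrite (in_vars_coef0 kg ki mi) addr0.
Qed.

Lemma in_varsN k f : in_vars k f -> in_vars k (- f).
Proof. by move=> kf m; rewrite mfps_coefN oppr_eq0; apply: kf. Qed.

Lemma in_varsB k f g : in_vars k f -> in_vars k g -> in_vars k (f - g).
Proof. by move=> kf kg; apply: in_varsD => //; apply: in_varsN. Qed.

Lemma in_varsM k f g : in_vars k f -> in_vars k g -> in_vars k (f * g).
Proof.
move=> kf kg m fgm i ki; apply/eqP; apply: contraR fgm => mi.
rewrite mfps_coefM big1 // => l lm; have [li|li] := eqVneq (bmnm l i) 0%N.
  by rewrite (in_vars_coef0 kg ki) ?mulr0 // mnmBE li subn0.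
by rewrite (in_vars_coef0 kf ki li) mul0r.
Qed.

Lemma in_varsX k f e : in_vars k f -> in_vars k (f ^+ e).
Proof.
move=> kf; elim: e => [|e IHe]; first exact: in_vars1.
by rewrite exprS; apply: in_varsM.
Qed.

Lemma in_vars_sum (I : Type) (r : seq I) (P : pred I) (G : I -> mfps n F) k :
  (forall i, P i -> in_vars k (G i)) -> in_vars k (\sum_(i <- r | P i) G i).
Proof. by move=> kG; elim/big_ind: _ => //; [apply: in_vars0 | apply: in_varsD]. Qed.

Lemma in_vars_var k (i : 'I_n) : (i < k)%N -> in_vars k (mfps_var F i).
Proof.
move=> ik m /=; case: (m =P U_(i)%MM) => [-> _ j kj|]; last by rewrite eqxx.
by rewrite mnm1E; case: eqP => // ij; rewrite ij ltnNge kj in ik.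
Qed.

Lemma in_vars_const k c : in_vars k (mfps_const n c : mfps n F).
Proof. by move=> m /=; case: (m =P 0%MM) => [-> _ i _|]; rewrite ?mnm0E // eqxx. Qed.

Lemma in_vars_leq k l f : (k <= l)%N -> in_vars k f -> in_vars l f.
Proof. by move=> kl kf m fm i li; apply: kf fm _ _; apply: leq_trans li. Qed.

Lemma in_vars_full f : in_vars n f.
Proof. by move=> m _ i; rewrite leqNgt ltn_ord. Qed.

Lemma in_vars0_const f : in_vars 0 f -> f = mfps_const n (mfps_coef f 0%MM).
Proof.
move=> f0; apply: mfpsP => m /=; case: (m =P 0%MM) => [->|m0] //.
have [//|/f0 fm] := eqVneq (mfps_coef f m) 0.
by case: m0; apply/mnmP => i; rewrite fm // mnm0E.
Qed.

Variable k : 'I_n.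

(** The degree of a monomial in the variables other than the k-th. *)
Let codeg m := (mdeg m - m k)%N.

Let coord_le m : (m k <= mdeg m)%N.
Proof. by rewrite mdegE (bigD1 k) //= leq_addr. Qed.

Let codegD a b : codeg (a + b)%MM = (codeg a + codeg b)%N.
Proof.
by rewrite /codeg mdegD mnmDE; have := coord_le a; have := coord_le b; lia.
Qed.

Let codeg0 m : codeg m = 0%N -> m = (U_(k) *+ m k)%MM.
Proof.
move=> m0; apply/mnmP => i; rewrite mulmnE mnm1E; case: eqP => [<-|/eqP ik].
  by rewrite mul1n.
have : (m k + m i <= mdeg m)%N.
  by rewrite mdegE (bigD1 k) //= leq_add2l (bigD1 i) 1?eq_sym //= leq_addr.
by move: m0; rewrite /codeg; lia.
Qed.

Let codegU j : codeg (U_(k) *+ j)%MM = 0%N.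
Proof. by rewrite /codeg mdegMn mdeg1 mulmnE mnm1E eqxx subnn. Qed.

Let lt_codeg a b := (codeg a < codeg b)%N || ((codeg a == codeg b) && (a k < b k)%N).

Let lt_codeg_wf : well_founded (fun a b => lt_codeg a b).
Proof.
suff H w v m : (codeg m < w)%N || ((codeg m == w) && (m k < v)%N) -> Acc (fun a b => lt_codeg a b) m.
  by move=> m; apply: (H (codeg m) (m k).+1); rewrite eqxx ltnSn orbT.
elim: w v m => [|w IHw] v m.
  elim: v m => [|v IHv] m; first by rewrite andbF.
  rewrite /= => /andP[/eqP mw mv]; constructor => a; rewrite /lt_codeg mw => /andP[aw am].
  by apply: IHv; rewrite aw /=; lia.
have Hw a : (codeg a < w.+1)%N -> Acc (fun a b => lt_codeg a b) a.
  move=> aw; apply: (IHw (a k).+1).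
  by move: aw; rewrite ltnS leq_eqVlt => /orP[->|->]; rewrite ?ltnSn ?orbT.
elim: v m => [|v IHv] m; case/orP => [mw|/andP[mw mv]]; [exact: Hw|by rewrite ltn0 in mv|exact: Hw|].
constructor => a; rewrite /lt_codeg (eqP mw) => /orP[|/andP[aw am]]; first exact: Hw.
by apply: IHv; rewrite aw /=; apply/orP; right; lia.
Qed.

(** On the k-th axis f has order s, the condition for Weierstrass division. *)
Definition regular_in s f :=
  (forall j, (j < s)%N -> mfps_coef f (U_(k) *+ j)%MM = 0) /\ mfps_coef f (U_(k) *+ s)%MM != 0.

(** The coefficients of the quotient are determined by recursion, first on the
    degree in the other variables and then on the degree in the k-th. *)
Lemma weierstrass_division s f h :
  in_vars k.+1 f -> in_vars k.+1 h -> regular_in s f ->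
  exists2 q, in_vars k.+1 q & forall m, (s <= m k)%N -> mfps_coef (h - q * f) m = 0.
Proof.
move=> kf kh [f_lt f_s]; pose u := (U_(k) *+ s)%MM.
have uk : u k = s by rewrite mulmnE mnm1E eqxx mul1n.
pose ok m := [forall i : 'I_n, (k < i)%N ==> (m i == 0%N)].
pose G m (q : 'X_{1..n} -> F) := if ok m then
  (mfps_coef h (m + u)%MM - \sum_(c : 'X_{1..n < (mdeg (m + u)%MM).+1} |
     (c <= m + u)%MM && (bmnm c != u)) mfps_coef f c * q (m + u - c)%MM) / mfps_coef f u else 0.
have [|q qE] := wf_fixpoint 0 (G := G) lt_codeg_wf.
  move=> q1 q2 m q12; rewrite /G; case: ifP => // _; congr ((_ - _) / _).
  apply: eq_bigr => c /andP[cm cu]; have [->|fc] := eqVneq (mfps_coef f c) 0; first by rewrite !mul0r.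
  rewrite q12 //; have := congr1 codeg (submK cm).
  rewrite codegD [in RHS]codegD codegU addn0 /lt_codeg => <-.
  case: (posnP (codeg c)) => [c0|c0]; last by rewrite -{1}[codeg _]addn0 ltn_add2l c0.
  rewrite c0 addn0 eqxx ltnn /= mnmBE mnmDE mulmnE mnm1E eqxx mul1n.
  move: fc cu cm; rewrite (codeg0 c0); move: (bmnm c k) => j fj ju.
  rewrite lem_mnm1n mnmDE mulmnE mnm1E eqxx mul1n => jm.
  have sj : (s < j)%N.
    rewrite ltn_neqAle; apply/andP; split; first by apply: contra ju => /eqP<-.
    by rewrite leqNgt; apply: contra fj => /f_lt->.
  by move: jm sj; rewrite uk; move: (m k) => mk; clear; lia.
have okP m : reflect (forall i : 'I_n, (k < i)%N -> m i = 0%N) (ok m).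
  by apply: (iffP forallP) => H i; [move=> ki; apply/eqP; apply: implyP (H i) ki | apply/implyP => /H->].
exists (MFPS q) => [m|m sm].
  by rewrite /= qE /G; case: (okP m) => // _; rewrite eqxx.
have um : (u <= m)%MM by rewrite lem_mnm1n.
rewrite -(submK um); set m' := (m - u)%MM.
have du : (mdeg u < (mdeg (m' + u)%MM).+1)%N by rewrite mdegD ltnS leq_addl.
rewrite mfps_coefB mulrC mfps_coefM (bigD1 (BMultinom du)) /=; last exact: lem_addl.
rewrite addmK qE /G; case: (boolP (ok m')) => okm.
  rewrite mulrC divfK //; apply/eqP; rewrite subr_eq0 -addrA eq_sym -subr_eq0 addrAC.
  rewrite subrr add0r addrC subr_eq0; apply/eqP/eq_bigl => c.
  by rewrite bmeqP.
have [i ki mi] : exists2 i : 'I_n, (k < i)%N & m' i != 0%N.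
  by move: okm => /forallPn[i]; rewrite negb_imply => /andP[]; exists i.
have mui : (m' + u)%MM i != 0%N by rewrite mnmDE addn_eq0 (negPf mi).
rewrite mulr0 add0r (in_vars_coef0 kh ki mui) sub0r big1 ?oppr0 // => c /andP[cm _].
have [->|fc] := eqVneq (mfps_coef f c) 0; first by rewrite mul0r.
rewrite qE /G; case: okP => [/(_ i ki)|]; last by rewrite mulr0.
by rewrite mnmBE (kf _ fc i ki) subn0 => /eqP; rewrite (negPf mui).
Qed.

(** The coefficient of the j-th power of the k-th variable. *)
Definition slice j f : mfps n F :=
  MFPS (fun m => if m k == 0%N then mfps_coef f (m + U_(k) *+ j)%MM else 0).

Lemma in_vars_slice j f : in_vars k.+1 f -> in_vars k (slice j f).
Proof.
move=> kf m /=; case: (m k =P 0%N) => [mk fm i|]; last by rewrite eqxx.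
rewrite leq_eqVlt => /orP[/eqP/val_inj<- //|ki].
by have /eqP := kf _ fm i ki; rewrite mnmDE addn_eq0 => /andP[/eqP].
Qed.

Lemma slice_sum s f : (forall m, (s <= m k)%N -> mfps_coef f m = 0) ->
  f = \sum_(j < s) slice j f * mfps_var F k ^+ j.
Proof.
move=> fs; apply: mfpsP => m; rewrite mfps_coef_sum.
have coefE j : mfps_coef (slice j f * mfps_var F k ^+ j) m = if j == m k then mfps_coef f m else 0.
  rewrite mulrC mfps_coef_varXM; case: leqP => [jm|mj]; last by rewrite gtn_eqF.
  rewrite /= mnmBE mulmnE mnm1E eqxx mul1n subn_eq0 submK ?lem_mnm1n //.
  by rewrite eqn_leq jm.
rewrite (eq_bigr _ (fun (j : 'I_s) _ => coefE j)).
have [sm|ms] := leqP s (m k); first by rewrite fs // big1 // => j _; case: eqP.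
rewrite (bigD1 (Ordinal ms)) //= eqxx big1 ?addr0 // => j.
by rewrite -val_eqE /= => /negPf->.
Qed.

End Weierstrass.

(** * Making a power series regular in a given variable *)

Section CoordinateChange.
Import mpoly.
Variables (n : nat).
Implicit Types (m : 'X_{1..n}) (w : 'I_n -> nat).

Definition weight w m := (\sum_i w i * m i)%N.

Lemma weightD1 w m i : weight w m = (w i * m i + \sum_(j | j != i) w j * m j)%N.
Proof. by rewrite /weight (bigD1 i). Qed.

(** Weights decreasing fast enough along the list of variables order exponents
    lexicographically near the lexicographic minimum. *)
Lemma exists_separating_weight (k : 'I_n) (E : 'X_{1..n} -> Prop) m0 : E m0 ->
  exists w a, [/\ w k = 1%N, forall i, (0 < w i)%N, E a &
    forall b, E b -> b <> a -> (weight w a < weight w b)%N].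
Proof.
have min_coord (E' : 'X_{1..n} -> Prop) (m1 : 'X_{1..n}) (i : 'I_n) : E' m1 ->
    exists2 a : 'X_{1..n}, E' a & forall b : 'X_{1..n}, E' b -> (a i <= b i)%N.
  move=> Em1; have [N mN] := ubnP (m1 i); elim: N m1 Em1 mN => // N IHN m1 Em1 mN.
  have [[b Eb bm]|noP] := pselect (exists2 b : 'X_{1..n}, E' b & (b i < m1 i)%N).
    by apply: (IHN b) => //; lia.
  exists m1 => // b Eb; rewrite leqNgt; apply/negP => bm; apply: noP.
  by exists b.
suff H (s : seq 'I_n) (E' : 'X_{1..n} -> Prop) m1 : E' m1 -> k \notin s ->
    (forall a b, E' a -> E' b -> forall i, i != k -> i \notin s -> a i = b i) ->
    exists w a, [/\ w k = 1%N, forall i, (0 < w i)%N, E' a &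
      forall b, E' b -> b <> a -> (weight w a < weight w b)%N].
  move=> Em0; apply: (H (rem k (enum 'I_n)) E m0 Em0).
    by rewrite mem_rem_uniq ?enum_uniq // inE eqxx.
  by move=> a b _ _ i ik; rewrite mem_rem_uniq ?enum_uniq // inE ik mem_enum.
elim: s E' m1 => [|i s IHs] E' m1 Em1 ks agree.
  have [a Ea amin] := min_coord E' m1 k Em1.
  exists (fun=> 1%N), a; split=> // b Eb ba.
  have off : forall i : 'I_n, i != k -> a i = b i by move=> i ik; apply: agree.
  rewrite !(weightD1 _ _ k) [X in (_ < _ + X)%N](eq_bigr (fun j => 1 * a j)%N) => [|j jk]; last by rewrite off.
  rewrite ltn_add2r !mul1n ltn_neqAle amin // andbT; apply/eqP => abk; apply: ba.
  by apply/mnmP => i; have [->|/off] := eqVneq i k.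
have [a0 Ea0 a0min] := min_coord E' m1 i Em1.
move: ks; rewrite inE negb_or => /andP[ki ks].
pose E1 (b : 'X_{1..n}) := E' b /\ b i = a0 i.
have [|||w1 [a [w1k w1pos [Ea ai] amin]]] := IHs E1 a0 => //.
  move=> b c [Eb bi] [Ec ci] j jk js; have [->|ji] := eqVneq j i; first by rewrite bi ci.
  by apply: agree => //; rewrite inE negb_or ji.
pose w j := if j == i then (weight w1 a).+1 else w1 j.
have wE b : weight w b = ((weight w1 a).+1 * b i + \sum_(j | j != i) w1 j * b j)%N.
  rewrite (weightD1 _ _ i) /w eqxx; congr (_ + _)%N.
  by apply: eq_bigr => j /negPf->.
exists w, a; split=> // [|j|b Eb ba]; first by rewrite /w (negPf ki).
  by rewrite /w; case: ifP.
have [bi|bi] := eqVneq (b i) (a i).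
  have := amin b (conj Eb (etrans bi ai)) ba.
  by rewrite !(weightD1 w1 _ i) !wE bi !ltn_add2l.
have abi : (a i < b i)%N by rewrite ltn_neqAle eq_sym bi ai a0min.
rewrite !wE; apply: leq_trans (leq_addr _ _).
apply: leq_trans (_ : (weight w1 a).+1 * (a i).+1 <= _)%N; last by rewrite leq_mul2l abi orbT.
by rewrite mulnS addnC ltn_add2r ltnS (weightD1 w1 a i) leq_addl.
Qed.

Variables (F : fieldType) (k : 'I_n) (w : 'I_n -> nat).
Hypothesis wpos : forall i, (0 < w i)%N.
Local Notation var := (mfps_var F).

(** On the k-th axis a sheared monomial of exponent a becomes the power of exponent
    weight w a, so that distinct weights prevent cancellation. *)
Definition shear i : mfps n F := if i == k then var k else var i + var k ^+ w i.

Fact shear_coef0 i : mfps_coef (shear i) 0%MM = 0.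
Proof.
have v0 j e : (0 < e)%N -> mfps_coef (var j ^+ e) 0%MM = 0.
  by case: e => // e _; rewrite exprS mfps_coef0M mfps_var_coef0 mul0r.
by rewrite /shear; case: ifP => _; rewrite ?mfps_coefD mfps_var_coef0 ?v0 ?addr0.
Qed.

Definition shear_subst := mfps_subst shear_coef0.

(** Shearing twice adds each power of the k-th variable twice. *)
Lemma shear_substK : 2%N \in [pchar F] -> involutive shear_subst.
Proof.
have substk : shear_subst (var k) = var k by rewrite /shear_subst mfps_subst_var /shear eqxx.
move=> char2; apply: mfps_substK => i; rewrite [X in mfps_subst _ X]/shear.
case: eqP => [->|/eqP ik]; first exact: substk.
have substi : shear_subst (var i) = var i + var k ^+ w i.
  by rewrite /shear_subst mfps_subst_var /shear (negPf ik).
rewrite rmorphD rmorphXn /= -/shear_subst substk substi -addrA.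
have pchar : 2%N \in [pchar (mfps n F)].
  rewrite inE /=; apply/eqP/mfpsP => m; rewrite mulr2n mfps_coefD mfps_coef1.
  by rewrite addrr_pchar2.
by rewrite addrr_pchar2 ?addr0.
Qed.

Lemma mfps_trunc_supp D (f : mfps n F) a : (mfps_trunc D f)@_a != 0 -> mfps_coef f a != 0.
Proof.
move=> fa; have [aD|Da] := ltnP (mdeg a) D; first by rewrite -(mfps_truncE f aD).
move: fa; rewrite mcoeff_eq0 negbK => /msize_mdeg_lt as_; exfalso.
move: as_; apply/negP; rewrite -leqNgt; apply: leq_trans Da.
apply: leq_trans (mmeasure_sum _ _ _ _) _.
apply/bigmax_leqP => c _; apply: leq_trans (mmeasureZ_le _ _ _) _.
by rewrite mmeasureX bmdeg.
Qed.

Lemma in_vars_shear f : in_vars k.+1 f -> in_vars k.+1 (shear_subst f).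
Proof.
move=> kf m; pose p := mfps_trunc (mdeg m).+1 f.
suff H : in_vars k.+1 (mmap (mfps_constR n F) shear p) by exact: H.
rewrite /mmap; rewrite big_seq; apply: in_vars_sum => a ap; apply: in_varsM.
  exact: in_vars_const.
have fa : mfps_coef f a != 0 by apply: mfps_trunc_supp; rewrite -mcoeff_msupp; exact: ap.
rewrite /mmap1; elim/big_ind: _ => [||i _]; [exact: in_vars1|exact: in_varsM|].
have [ki|ik] := leqP k.+1 i; first by rewrite (kf _ fa i ki); exact: in_vars1.
apply: in_varsX; rewrite /shear; case: ifP => _; first exact: in_vars_var.
by apply: in_varsD; [apply: in_vars_var|apply/in_varsX/in_vars_var].
Qed.

(** f restricts to the e-th power of the variable on the k-th axis. *)
Definition on_axis e f := forall j, mfps_coef f (U_(k) *+ j)%MM = (j == e)%:R :> F.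

Lemma U_injl i j : ((U_(k) *+ i)%MM == (U_(k) *+ j)%MM) = (i == j).
Proof.
apply/eqP/eqP => [/mnmP/(_ k)|->] //.
by rewrite !mulmnE mnm1E eqxx !mul1n.
Qed.

Lemma on_axis_varX e : on_axis e (var k ^+ e).
Proof. by move=> j; rewrite mfps_varX /= U_injl. Qed.

Lemma on_axisM e1 e2 f g : on_axis e1 f -> on_axis e2 g -> on_axis (e1 + e2)%N (f * g).
Proof.
move=> fe ge j; rewrite -(on_axis_varX (e1 + e2)%N) exprD; apply: eq_mfps_coefM => c.
  move=> /mnm_lepP cj; suff -> : c = (U_(k) *+ c k)%MM by rewrite fe on_axis_varX.
  apply/mnmP => i; have := cj i; rewrite !mulmnE mnm1E.
  by case: eqP => [->|_]; rewrite ?mul1n // !mul0n; case: (c i).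
move=> /mnm_lepP cj; suff -> : c = (U_(k) *+ c k)%MM by rewrite ge on_axis_varX.
apply/mnmP => i; have := cj i; rewrite !mulmnE mnm1E.
by case: eqP => [->|_]; rewrite ?mul1n // !mul0n; case: (c i).
Qed.

Lemma on_axisX e f d : on_axis e f -> on_axis (e * d)%N (f ^+ d).
Proof.
move=> fe; elim: d => [|d IHd].
  by rewrite muln0 expr0 -(expr0 (var k)); apply: on_axis_varX.
by rewrite exprS mulnS; apply: on_axisM.
Qed.

Hypothesis wk : w k = 1%N.

Lemma on_axis_shear i : on_axis (w i) (shear i).
Proof.
rewrite /shear; case: eqP => [->|/eqP ik].
  by rewrite wk -[var k]expr1; apply: on_axis_varX.
move=> j; rewrite mfps_coefD on_axis_varX /=; case: eqP => [/mnmP/(_ i)|]; last by rewrite add0r.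
by rewrite mulmnE !mnm1E eqxx eq_sym (negPf ik).
Qed.

Lemma on_axis_mmap1_shear a : on_axis (weight w a) (mmap1 shear a).
Proof.
rewrite /mmap1 /weight; elim/big_ind2: _ => [|x1 e1 x2 e2|i _].
- by rewrite -(expr0 (var k)); apply: on_axis_varX.
- exact: on_axisM.
by apply/on_axisX/on_axis_shear.
Qed.

(** The monomial of least weight is alone in contributing to the lowest term on the axis. *)
Lemma regular_shear f a : mfps_coef f a != 0 ->
  (forall b, mfps_coef f b != 0 -> b <> a -> (weight w a < weight w b)%N) ->
  regular_in k (weight w a) (shear_subst f).
Proof.
move=> fa amin.
have coefE j : mfps_coef (shear_subst f) (U_(k) *+ j)%MM =
   \sum_(b <- msupp (mfps_trunc (j + mdeg a).+1 f))
     (mfps_trunc (j + mdeg a).+1 f)@_b * (j == weight w b)%:R.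
  have dj : (mdeg (U_(k) *+ j)%MM < (j + mdeg a).+1)%N.
    by rewrite mdegMn mdeg1 mul1n ltnS leq_addr.
  rewrite (mfps_substE _ dj (@mfps_truncE _ _ _ f)) /mmap mfps_coef_sum.
  by apply: eq_bigr => b _; rewrite mfps_coef_constRM on_axis_mmap1_shear.
split=> [j ja|]; rewrite coefE.
  rewrite big_seq big1 // => b; rewrite mcoeff_msupp => /mfps_trunc_supp fb.
  have [ba|/eqP ba] := eqVneq b a; first by rewrite ba ltn_eqF ?mulr0.
  by rewrite ltn_eqF ?mulr0 // (ltn_trans ja) // amin.
have aD : (mdeg a < (weight w a + mdeg a).+1)%N by rewrite ltnS leq_addl.
have asupp : a \in msupp (mfps_trunc (weight w a + mdeg a).+1 f).
  by rewrite mcoeff_msupp mfps_truncE.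
rewrite (bigD1_seq a) ?msupp_uniq //= eqxx mulr1 mfps_truncE // big_seq_cond.
rewrite big1 ?addr0 // => b /andP[]; rewrite mcoeff_msupp => /mfps_trunc_supp fb /eqP ba.
by rewrite ltn_eqF ?mulr0 // amin.
Qed.

End CoordinateChange.

(** * Chains of primes in rings of power series *)

Section Subrings.
Variable S : comNzRingType.
Implicit Types A : S -> Prop.
Record subring_on A : Prop := SubringOn {
  subring_on1 : A 1;
  subring_onB : forall x y, A x -> A y -> A (x - y);
  subring_onM : forall x y, A x -> A y -> A (x * y) }.

Lemma subring_on0 A : subring_on A -> A 0.
Proof. by case=> A1 AB _; rewrite -(subrr 1); apply: AB. Qed.

Lemma subring_onN A x : subring_on A -> A x -> A (- x).
Proof. by move=> sA Ax; rewrite -sub0r; apply: subring_onB => //; apply: subring_on0. Qed.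

Lemma subring_onD A x y : subring_on A -> A x -> A y -> A (x + y).
Proof. by move=> sA Ax Ay; rewrite -[y]opprK; apply: subring_onB => //; apply: subring_onN. Qed.

Lemma subring_on_sum A (I : Type) (r : seq I) (P : pred I) (G : I -> S) :
  subring_on A -> (forall i, P i -> A (G i)) -> A (\sum_(i <- r | P i) G i).
Proof.
move=> sA AG; elim/big_ind: _ => //; first exact: subring_on0.
by move=> x y; apply: subring_onD.
Qed.

Lemma subring_on_prod A (I : Type) (r : seq I) (P : pred I) (G : I -> S) :
  subring_on A -> (forall i, P i -> A (G i)) -> A (\prod_(i <- r | P i) G i).
Proof.
move=> sA AG; elim/big_ind: _ => //; first exact: subring_on1.
by move=> x y; apply: subring_onM.
Qed.

Lemma subring_onX A x e : subring_on A -> A x -> A (x ^+ e).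
Proof.
move=> sA Ax; elim: e => [|e IHe]; first exact: subring_on1.
by rewrite exprS; apply: subring_onM.
Qed.

Lemma subring_on_det A n (M : 'M[S]_n) : subring_on A -> (forall i j, A (M i j)) -> A (\det M).
Proof.
move=> sA AM; apply: subring_on_sum => // s _; apply: subring_onM => //.
  by apply: subring_onX => //; apply: subring_onN => //; apply: subring_on1.
exact: subring_on_prod.
Qed.

Lemma subring_on_adj A n (M : 'M[S]_n) i j :
  subring_on A -> (forall i j, A (M i j)) -> A (\adj M i j).
Proof.
move=> sA AM; rewrite mxE; apply: subring_onM => //.
  by apply: subring_onX => //; apply: subring_onN => //; apply: subring_on1.
by apply: subring_on_det => // k l; rewrite !mxE.
Qed.

End Subrings.

Lemma subring_on_poly (S : comNzRingType) (A : S -> Prop) : subring_on A ->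
  subring_on (fun p : {poly S} => forall i, A p`_i).
Proof.
move=> sA; split=> [i|p q Ap Aq i|p q Ap Aq i].
- by rewrite coef1; case: (i == 0%N); [apply: subring_on1|apply: subring_on0].
- by rewrite coefB; apply: subring_onB.
by rewrite coefM; apply: subring_on_sum => // j _; apply: subring_onM.
Qed.

Lemma subring_on_char_poly (S : comNzRingType) (A : S -> Prop) n (M : 'M[S]_n) :
  subring_on A -> (forall i j, A (M i j)) -> forall i, A (char_poly M)`_i.
Proof.
move=> sA AM; apply: (subring_on_det (subring_on_poly sA)) => i j l.
rewrite !mxE coefB coefMn coefX coefC; apply: subring_onB => //.
  case: (i == j); rewrite ?mulr1n ?mulr0n; last exact: subring_on0.
  by case: (l == 1%N); [apply: subring_on1|apply: subring_on0].
by case: (l == 0%N) => //; apply: subring_on0.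
Qed.

Lemma horner_char_poly (S : comNzRingType) n (M : 'M[S]_n) x :
  (char_poly M).[x] = \det (x%:M - M).
Proof.
rewrite -horner_evalE -det_map_mx; congr (\det _); apply/matrixP => i j.
by rewrite !mxE /= /horner_eval hornerD hornerN hornerC hornerMn hornerX.
Qed.

Section PrimeChains.
Variable S : comNzRingType.
Implicit Types (A P Q : S -> Prop).

(** P cuts out a prime ideal on the subring A. Since P is a predicate on the whole
    ring, contraction to a smaller subring keeps the same P. *)
Record prime_on A P : Prop := PrimeOn {
  prime_on0 : P 0;
  prime_onD : forall x y, A x -> A y -> P x -> P y -> P (x + y);
  prime_onM : forall a x, A a -> A x -> P x -> P (a * x);
  prime_on1 : ~ P 1;
  prime_on_or : forall a b, A a -> A b -> P (a * b) -> P a \/ P b }.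

Definition prime_chain_on A (L : nat) (P : nat -> S -> Prop) :=
  (forall i, (i <= L)%N -> prime_on A (P i)) /\
  (forall i, (i < L)%N -> (forall x, A x -> P i x -> P i.+1 x) /\
     exists x, [/\ A x, P i.+1 x & ~ P i x]).

(** A prime Q containing P with the same contraction to A equals P, as far as
    elements integral over A modulo P are concerned: the constant coefficient of
    an integral equation lies in Q, hence in P, and can be removed. *)
Lemma integral_incomparable A B P Q x (p : {poly S}) :
  subring_on B -> (forall a, A a -> B a) -> prime_on B P -> prime_on B Q ->
  (forall y, B y -> P y -> Q y) -> (forall a, A a -> Q a -> P a) ->
  B x -> Q x -> p \is monic -> (forall i, A p`_i) -> P p.[x] -> P x.
Proof.
move=> sB AB pP pQ PQ QP Bx Qx.
elim/poly_ind: p => [|p c IHp]; first by rewrite monicE lead_coef0 eq_sym oner_eq0.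
move=> p_monic Ap; rewrite hornerMXaddC => Ppx.
have Ac : A c by have := Ap 0%N; rewrite coefD coefMX coefC eqxx add0r.
have Ap' i : A p`_i by have := Ap i.+1; rewrite coefD coefMX coefC addr0.
have [p0|p0] := eqVneq p 0.
  case: (prime_on1 pP); move: p_monic Ppx; rewrite p0 mul0r add0r horner0 mul0r add0r.
  by rewrite monicE lead_coefC => /eqP->.
have p'_monic : p \is monic.
  move: p_monic; rewrite !monicE lead_coefDl ?lead_coefMX //.
  by rewrite size_mulX // size_polyC; case: (c != 0); rewrite // ltnS lt0n size_poly_eq0.
have Bpx : B p.[x].
  rewrite horner_coef; apply: subring_on_sum => // i _; apply: subring_onM => //; first exact/AB.
  exact: subring_onX.
have Bpxx : B (p.[x] * x) by apply: subring_onM.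
have BN1 : B (- 1) by apply: subring_onN => //; apply: subring_on1.
have Pc : P c.
  have Bpxxc : B (p.[x] * x + c) by apply: subring_onD => //; apply: AB.
  have BNpx : B (- p.[x]) by apply: subring_onN.
  apply: QP => //; have -> : c = (p.[x] * x + c) + (- p.[x]) * x by rewrite mulNr addrAC subrr add0r.
  apply: (prime_onD pQ) => //; [by apply: subring_onM|exact: PQ|exact: (prime_onM pQ)].
have Ppxx : P (p.[x] * x).
  rewrite -[p.[x] * x](addrK c); apply: (prime_onD pP) => //.
  - by apply: subring_onD => //; apply: AB.
  - by apply: subring_onN => //; apply: AB.
  by rewrite -mulN1r; apply: (prime_onM pP) => //; apply: AB.
by have [/IHp|//] := prime_on_or pP Bpx Bx Ppxx; apply.
Qed.

End PrimeChains.

Section PowerSeriesDimension.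
Variables (n : nat) (F : fieldType).
Hypothesis char2 : 2%N \in [pchar F].
Local Notation S := (mfps n F).

Lemma in_vars_subring k : subring_on (@in_vars n F k).
Proof. by split; [apply: in_vars1|apply: in_varsB|apply: in_varsM]. Qed.

(** Weierstrass division makes the ring in k+1 variables finite over the one in k
    variables modulo f; the determinant trick then gives an integral equation. *)
Lemma weierstrass_integral (k : 'I_n) s (f x : S) :
  in_vars k.+1 f -> in_vars k.+1 x -> regular_in k s.+1 f ->
  exists p : {poly S}, [/\ p \is monic, forall i, in_vars k p`_i &
    exists2 u, in_vars k.+1 u & p.[x] = u * f].
Proof.
move=> kf kx freg; set y := mfps_var F k.
have ky : in_vars k.+1 y by apply: in_vars_var.
have div j : exists q, in_vars k.+1 q /\ forall m, (s.+1 <= mpoly.fun_of_multinom m k)%N ->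
    mfps_coef (x * y ^+ j - q * f) m = 0.
  have kxy : in_vars k.+1 (x * y ^+ j) by apply: in_varsM => //; apply: in_varsX.
  by have [q kq qP] := weierstrass_division kf kxy freg; exists q.
have [q qP] := choice div.
pose r j := x * y ^+ j - q j * f.
have kr j : in_vars k.+1 (r j).
  have [kq _] := qP j; apply: in_varsB; apply: in_varsM => //; exact: in_varsX.
have rE j : r j = \sum_(i < s.+1) slice k i (r j) * y ^+ i by apply: slice_sum; case: (qP j).
pose M := \matrix_(j < s.+1, i < s.+1) slice k i (r j).
have kM i j : in_vars k (M i j) by rewrite mxE; apply: in_vars_slice.
have sk := in_vars_subring k; have sk1 := in_vars_subring k.+1.
have kB i j : in_vars k.+1 ((x%:M - M) i j).
  rewrite !mxE; apply: in_varsB; last exact/(in_vars_leq (leqnSn k))/in_vars_slice.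
  by case: (i == j) => //; apply: in_vars0.
exists (char_poly M); split; [exact: char_poly_monic|exact: subring_on_char_poly|].
exists (\sum_j (\adj (x%:M - M)) ord0 j * q j).
  by apply: in_vars_sum => j _; apply: in_varsM; [apply: subring_on_adj|case: (qP j)].
pose v := \col_(i < s.+1) y ^+ i.
have Bv : (x%:M - M) *m v = \col_j (q j * f).
  apply/colP => j; rewrite mxE mulmxBl mul_scalar_mx !mxE.
  rewrite (eq_bigr (fun i : 'I_s.+1 => slice k i (r j) * y ^+ i)) => [|i _]; last by rewrite !mxE.
  by rewrite -rE /r opprB addrC subrK.
have /colP/(_ ord0) := congr1 (mulmx (\adj (x%:M - M))) Bv.
rewrite mulmxA mul_adj_mx mul_scalar_mx !mxE expr0 mulr1 horner_char_poly => ->.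
by rewrite mulr_suml; apply: eq_bigr => j _; rewrite [X in _ * X]mxE mulrA.
Qed.

(** Weierstrass division of 1 by f leaves no remainder. *)
Lemma regular_in_unit (k : 'I_n) (f : S) : in_vars k.+1 f -> regular_in k 0 f ->
  exists2 u, in_vars k.+1 u & u * f = 1.
Proof.
move=> kf freg; have [u ku uf] := weierstrass_division kf (@in_vars1 n F k.+1) freg.
exists u => //; apply/esym/eqP; rewrite -subr_eq0; apply/eqP/mfpsP => m; exact: uf.
Qed.

(** Strict inclusions survive contraction: f lies in all the primes, and modulo f the larger
    ring is integral over the smaller one, where integral_incomparable applies. *)
Lemma prime_chain_contract (k : 'I_n) L (P : nat -> S -> Prop) f :
  in_vars k.+1 f -> (exists s, regular_in k s f) -> P 0%N f ->
  prime_chain_on (in_vars k.+1) L P -> prime_chain_on (in_vars k) L P.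
Proof.
move=> kf [s freg] P0f [Pp Pinc]; have kk1 := @in_vars_leq n F _ _ _ (leqnSn k).
have P_mono i x : (i <= L)%N -> in_vars k.+1 x -> P 0%N x -> P i x.
  move=> iL kx P0x; elim: i iL => // i IHi iL.
  by have [H _] := Pinc i iL; apply: H => //; apply: IHi; apply: ltnW.
have Pu i u : (i <= L)%N -> in_vars k.+1 u -> P i (u * f).
  by move=> iL ku; apply: (prime_onM (Pp i iL)) => //; apply: P_mono.
split=> [i iL|i iL].
  case: (Pp i iL) => p0 pD pM p1 por; split=> //.
  - by move=> x y /kk1 kx /kk1 ky; apply: pD.
  - by move=> x y /kk1 kx /kk1 ky; apply: pM.
  by move=> x y /kk1 kx /kk1 ky; apply: por.
have [inc [x [kx Px1 nPx]]] := Pinc i iL; split; first by move=> y /kk1; apply: inc.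
apply: contra_notP nPx => noa.
have QP a : in_vars k a -> P i.+1 a -> P i a.
  by move=> ka Pa; apply: contrapT => nPa; apply: noa; exists a.
case: s freg => [|s] freg.
  have [u ku uf] := regular_in_unit kf freg.
  by case: (prime_on1 (Pp i (ltnW iL))); rewrite -uf; apply: Pu => //; apply: ltnW.
have [p [p_monic kp [u ku pE]]] := weierstrass_integral kf kx freg.
apply: (@integral_incomparable _ (in_vars k) (in_vars k.+1) (P i) (P i.+1) x p) => //.
- exact: in_vars_subring.
- exact: Pp (ltnW iL).
- exact: Pp iL.
by rewrite pE; apply: Pu => //; apply: ltnW.
Qed.

(** Induction on k: a nonzero series in the second prime is made regular in the last
    variable by a shear, after which the chain without its first prime contracts to the
    series in one variable less. *)
Lemma prime_chain_in_vars k L P : (k <= n)%N -> prime_chain_on (@in_vars n F k) L P -> (L <= k)%N.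
Proof.
elim: k L P => [|k IHk] L P kn [Pp Pinc].
  case: L Pp Pinc => // L Pp Pinc.
  have [inc [x [x0 P1x nP0x]]] := Pinc 0%N isT; exfalso.
  have xE := in_vars0_const x0; set c := mfps_coef x _ in xE.
  have c0 : c != 0.
    apply/eqP => c0; apply: nP0x; rewrite xE c0 (_ : mfps_const n 0 = 0).
      exact: prime_on0 (Pp 0%N isT).
    exact: raddf0 (mfps_constR n F).
  apply: (prime_on1 (Pp 1%N isT)); have -> : (1 : S) = mfps_const n c^-1 * x.
    by rewrite xE -[RHS](rmorphM (mfps_constR n F)) mulVf // [RHS](rmorph1 (mfps_constR n F)).
  by apply: (prime_onM (Pp 1%N isT)) => //; apply: in_vars_const.
case: L Pp Pinc => // L Pp Pinc; rewrite ltnS.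
have [inc [f [kf P1f nP0f]]] := Pinc 0%N isT.
have [m0 fm0] : exists m, mfps_coef f m != 0.
  apply: contrapT => nof; apply: nP0f; rewrite (_ : f = 0); first exact: prime_on0 (Pp 0%N isT).
  by apply: mfpsP => m; apply/eqP; apply: contrapT => fm; apply: nof; exists m; apply/negP.
pose ik := Ordinal kn.
have [w [a [wk wpos fa amin]]] := @exists_separating_weight n ik (fun m => mfps_coef f m != 0) m0 fm0.
pose phi : S -> S := @shear_subst n F ik w wpos.
have phiK : involutive phi by apply: shear_substK.
have kphi g : in_vars k.+1 g -> in_vars k.+1 (phi g) by apply: (@in_vars_shear _ _ ik).
apply: (IHk L (fun i g => P i.+1 (phi g))); first exact: ltnW.
apply: (@prime_chain_contract ik _ _ (phi f)).
- exact: kphi.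
- by exists (weight w a); apply: regular_shear.
- by rewrite phiK.
split=> [i iL|i iL].
  have [p0 pD pM p1 por] := Pp i.+1 iL; rewrite /phi /shear_subst; split; rewrite ?rmorph0 ?rmorph1 //.
  - by move=> x y kx ky Px Py; rewrite rmorphD; apply: pD => //; apply: kphi.
  - by move=> x y kx ky Px; rewrite rmorphM; apply: pM => //; apply: kphi.
  by move=> x y kx ky; rewrite rmorphM => /por; apply; apply: kphi.
have [inc' [x [kx P1x nPx]]] := Pinc i.+1 iL; split; first by move=> y /kphi; apply: inc'.
by exists (phi x); rewrite phiK; split=> //; apply: kphi.
Qed.

End PowerSeriesDimension.

(** * The A_1 ring as a quotient of the power series ring *)

Section A1Quotient.
Local Open Scope quotient_scope.
Variable d : nat.
Local Notation S := (mfps d.+1 'F_2).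
Local Notation Q := (A1_form d).

Definition A1_proj (f : S) : A1_ring d := \pi_(A1_ring d) f.

Lemma A1_proj_surj r : exists f, A1_proj f = r.
Proof. by exists (repr r); rewrite /A1_proj reprK. Qed.

Lemma A1_projB f g : A1_proj (f - g) = A1_proj f - A1_proj g.
Proof. exact: raddfB. Qed.

Lemma A1_projD f g : A1_proj (f + g) = A1_proj f + A1_proj g.
Proof. exact: raddfD. Qed.

Lemma A1_projM f g : A1_proj (f * g) = A1_proj f * A1_proj g.
Proof. exact: rmorphM. Qed.

Lemma A1_proj1 : A1_proj 1 = 1.
Proof. exact: rmorph1. Qed.

Lemma mem_A1_ideal f : (f \in @A1_ideal d) <-> exists g, f = g * Q.
Proof.
split=> [/asboolP fQ|[g ->]].
  pose I : {pred S^o} := fun x => `[< exists g, x = g * Q >].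
  have /asboolP : f \in I by apply: fQ => [|_ ->]; [split=> [|a x y /asboolP[u ->] /asboolP[v ->]]|]; apply/asboolP;
    [exists 0; rewrite mul0r|exists (a * u + v); rewrite mulrDl -mulrA|exists 1; rewrite mul1r].
  by [].
by apply/asboolP => I [I0 IM] IQ; rewrite -[g * Q]addr0; apply: IM => //; apply: IQ.
Qed.

Lemma A1_proj_eq0 f : A1_proj f = 0 <-> exists g, f = g * Q.
Proof.
rewrite -mem_A1_ideal -[f in f \in _]subr0 Quotient.idealrBE.
have -> : 0 = A1_proj 0 by rewrite -(subrr (0 : S)) A1_projB subrr.
by split=> [fE|/eqP fE]; [apply/eqP; exact: fE|exact: fE].
Qed.

End A1Quotient.

Section A1Dimension.
Import mpoly.
Variable d : nat.
Hypothesis d_gt1 : (1 < d)%N.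
Local Notation S := (mfps d.+1 'F_2).
Local Notation Q := (A1_form d).
Local Notation var i := (A1_var d i).

Lemma pchar_F2 : 2%N \in [pchar 'F_2].
Proof. exact: pchar_Fp. Qed.

Lemma addff_F2 (n : nat) (f : mfps n 'F_2) : f + f = 0.
Proof. by apply: mfpsP => m; rewrite mfps_coefD addrr_pchar2 ?pchar_F2. Qed.

Let uphalf_d_gt0 : (0 < uphalf d)%N.
Proof. by rewrite uphalf_gt0 ltnW. Qed.

Lemma A1_form_split :
  Q = var 0 * var 1 + (\sum_(1 <= i < uphalf d) var i.*2 * var i.*2.+1
                       + (if odd d then 0 else var d ^+ 2)).
Proof.
rewrite /A1_form -(big_mkord xpredT (fun i => var i.*2 * var i.*2.+1)) big_ltn //.
by rewrite addrA.
Qed.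

(** Modulo the variables of index at least 2 only the product of the first two remains. *)
Lemma A1_form_neq0 : Q <> 0.
Proof.
pose B : pred 'I_d.+1 := fun i => (1 < i)%N.
have Bvar i : (1 < i <= d)%N -> var_ideal B (var i).
  move=> /andP[i1 id]; apply/mem_var_ideal_monom; exists (inord i).
    by rewrite /B inordK.
  by rewrite mnm1E eqxx.
rewrite A1_form_split => /eqP; rewrite addr_eq0 -[- _]add0r => /eqP Q0.
have : var_ideal B (var 0 * var 1).
  rewrite Q0 add0r -mulN1r; apply: var_idealM; apply: var_idealD.
    rewrite big_nat; elim/big_ind: _ => [||i im]; [exact: var_ideal0|exact: var_idealD|].
    by apply/var_idealM/Bvar; lia.
  by case: ifP => _; [apply: var_ideal0|rewrite expr2; apply/var_idealM/Bvar; rewrite d_gt1 leqnn].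
rewrite mfps_monomM => /mem_var_ideal_monom[i i1].
rewrite mnmDE !mnm1E -!val_eqE /= !inordK //; last by lia.
by move: i1; rewrite /B; case: (nat_of_ord i) => [|[]].
Qed.

Let parity_sum := \sum_(1 <= i < uphalf d) var i.*2 * var i.*2.+1 : S.
Let tail := (if odd d then 0 else var 0 * var d ^+ 2) : S.

(** Once x_0 x_(2i) is put for the other even coordinates, all the other terms of the
    quadric are divisible by x_0 and its equation can be solved for x_1. *)
Definition A1_param (i : 'I_d.+1) : S :=
  if i == 1%N :> nat then parity_sum + tail
  else if (i == 0%N :> nat) || odd i then var i else var 0 * var i.

Fact A1_param_coef0 i : mfps_coef (A1_param i) 0%MM = 0.
Proof.
have v0 j : mfps_coef (var j) 0%MM = 0 by apply: mfps_var_coef0.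
have v0M j f : mfps_coef (var j * f) 0%MM = 0 by rewrite mfps_coef0M v0 mul0r.
rewrite /A1_param; case: ifP => _; last by case: ifP => _; rewrite ?v0 ?v0M.
rewrite mfps_coefD mfps_coef_sum big1 ?add0r; last by move=> j _; apply: v0M.
by rewrite /tail; case: ifP => _; rewrite ?v0M.
Qed.

Definition A1_param_subst := mfps_subst A1_param_coef0.

Lemma A1_param_substE i : (i <= d)%N -> A1_param_subst (var i) =
  if i == 1%N then parity_sum + tail else if (i == 0%N) || odd i then var i else var 0 * var i.
Proof.
by move=> id; rewrite /A1_param_subst mfps_subst_var /A1_param inordK.
Qed.

Lemma A1_param_form : A1_param_subst Q = 0.
Proof.
have e0 : A1_param_subst (var 0) = var 0 by rewrite A1_param_substE.
have e1 : A1_param_subst (var 1) = parity_sum + tail by rewrite A1_param_substE // ltnW.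
have eM i : (0 < i < uphalf d)%N ->
    A1_param_subst (var i.*2 * var i.*2.+1) = var 0 * (var i.*2 * var i.*2.+1).
  move=> /andP[i0 im]; have id : (i.*2.+1 <= d)%N by lia.
  rewrite /A1_param_subst rmorphM /= -/A1_param_subst !A1_param_substE ?(ltnW id) //=.
  have n1 : (i.*2 == 1%N) = false by lia.
  have n0 : (i.*2 == 0%N) = false by lia.
  by rewrite n1 ?eqSS n0 odd_double /= mulrA.
rewrite A1_form_split /A1_param_subst !rmorphD rmorphM rmorph_sum /=.
rewrite -/A1_param_subst e0 e1 (eq_big_nat _ _ eM) -mulr_sumr -/parity_sum mulrDr.
have -> : A1_param_subst (if odd d then 0 else var d ^+ 2) = var 0 * tail.
  rewrite /A1_param_subst /tail; case: ifP => [_|d_even]; first by rewrite rmorph0 mulr0.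
  rewrite rmorphXn /= -/A1_param_subst A1_param_substE // d_even orbF.
  have n1 : (d == 1%N) = false by lia.
  have n0 : (d == 0%N) = false by lia.
  by rewrite n1 n0 exprMn mulrA expr2.
by rewrite addff_F2.
Qed.

(** The parametrisation is in the d variables other than x_1. The primes of the chain
    are generated by x_2, ..., x_(j+1), and x_0 comes last because the even coordinates
    of the parametrisation are multiples of it. *)
Definition killed_vars j : pred 'I_d.+1 :=
  fun i => (1 < i < j.+2)%N || ((j == d) && (i == 0%N :> nat)).

Definition A1_prime j : {pred A1_ring d} :=
  fun r => `[< var_ideal (killed_vars j) (A1_param_subst (repr r)) >].

Lemma mem_A1_prime j f :
  (A1_proj f \in A1_prime j) <-> var_ideal (killed_vars j) (A1_param_subst f).
Proof.
suff -> : A1_param_subst f = A1_param_subst (repr (A1_proj f)) by split=> /asboolP.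
apply/eqP; rewrite -subr_eq0 -[_ - _]rmorphB /=.
have [g ->] : exists g, f - repr (A1_proj f) = g * Q.
  by apply/A1_proj_eq0; rewrite A1_projB /A1_proj reprK subrr.
by rewrite [mfps_subst _ _]rmorphM /= -/A1_param_subst A1_param_form mulr0.
Qed.

Lemma A1_prime_chain : prime_chain (A1_ring d) d.
Proof.
exists A1_prime; split=> [j _|j jd].
  split.
    split.
    - by rewrite -(subrr (A1_proj 0)) -A1_projB subr0; apply/mem_A1_prime; rewrite /A1_param_subst rmorph0.
    - rewrite -A1_proj1; apply/negP => /mem_A1_prime.
      rewrite /A1_param_subst rmorph1 => /(_ 0%MM) H.
      by have /eqP := H (fun i _ => mnm0E i); rewrite mfps_coef1 eqxx oner_eq0.
    move=> a u v; have [f <-] := A1_proj_surj a; have [g <-] := A1_proj_surj u.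
    have [h <-] := A1_proj_surj v; move=> /mem_A1_prime gB /mem_A1_prime hB.
    rewrite -A1_projM -A1_projD; apply/mem_A1_prime.
    rewrite /A1_param_subst rmorphD rmorphM; apply: var_idealD; last exact: hB.
    by apply: var_idealM; exact: gB.
  move=> u v; have [f <-] := A1_proj_surj u; have [g <-] := A1_proj_surj v.
  rewrite -A1_projM => /mem_A1_prime; rewrite /A1_param_subst rmorphM => /var_ideal_prime[fB|gB].
    by apply/orP; left; apply/mem_A1_prime.
  by apply/orP; right; apply/mem_A1_prime.
split.
  move=> r; have [f <-] := A1_proj_surj r; move=> /mem_A1_prime fB; apply/mem_A1_prime.
  move=> m mB; apply: fB => i; rewrite /killed_vars => iB; apply: mB.
  move: iB; rewrite /killed_vars (ltn_eqF jd) /= orbF => /andP[-> ij] /=.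
  by rewrite ltnS ltnW.
have [jd1|jd1] := eqVneq j.+1 d.
  exists (A1_proj (var 0)).
    apply/mem_A1_prime; rewrite A1_param_substE //=; apply/mem_var_ideal_monom.
    by exists (inord 0); rewrite ?mnm1E ?eqxx // /killed_vars jd1 eqxx inordK // orbT.
  apply/negP => /mem_A1_prime; rewrite A1_param_substE //= => /mem_var_ideal_monom[i].
  rewrite mnm1E; have [<- iB _|//] := eqVneq (inord 0) i; move: iB; rewrite /killed_vars inordK //=.
  by rewrite (ltn_eqF jd).
have j2d : (j.+2 <= d)%N by rewrite ltn_neqAle jd1.
exists (A1_proj (var j.+2)).
  apply/mem_A1_prime; rewrite A1_param_substE //=.
  suff H : var_ideal (killed_vars j.+1) (var j.+2) by case: ifP => // _; apply: var_idealM.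
  apply/mem_var_ideal_monom; exists (inord j.+2); last by rewrite mnm1E eqxx.
  by rewrite /killed_vars inordK // ltnSn.
apply/negP => /mem_A1_prime; rewrite A1_param_substE //=.
suff H (m : 'X_{1..d.+1}) : (forall i : 'I_d.+1, m i != 0%N -> i = j.+2 :> nat \/ i = 0%N :> nat) ->
    ~ var_ideal (killed_vars j) (mfps_monom 'F_2 m).
  case: ifP => _.
    by apply: H => i; rewrite mnm1E; have [<- _|//] := eqVneq (inord j.+2) i; left; exact: inordK.
  rewrite mfps_monomM; apply: H => i; rewrite mnmDE !mnm1E.
  have [<- _|_] := eqVneq (inord 0) i; first by right; rewrite inordK.
  by have [<- _|//] := eqVneq (inord j.+2) i; left; exact: inordK.
move=> mE /mem_var_ideal_monom[i iB /mE]; move: iB; rewrite /killed_vars (ltn_eqF jd) orbF.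
by move=> /andP[i1 ij] [] iE; move: i1 ij; rewrite iE // ltnn.
Qed.

(** The preimages in the power series ring form a chain above the ideal generated by the
    quadric; the zero ideal, put in front, makes it longer by one. *)
Lemma A1_prime_chain_le L : prime_chain (A1_ring d) L -> (L <= d)%N.
Proof.
move=> [P [Pp Pinc]].
pose P' i (f : S) := if i is j.+1 then A1_proj f \in P j else f = 0 : Prop.
rewrite -ltnS; apply: (@prime_chain_in_vars d.+1 'F_2 pchar_F2 d.+1 L.+1 P') => //.
split=> [[|i] iL|[|i] iL] /=.
- split=> //=.
  + by move=> x y _ _ -> ->; rewrite addr0.
  + by move=> a x _ _ ->; rewrite mulr0.
  + by apply/eqP; rewrite oner_eq0.
  move=> a b _ _ ab0; have var0 f : var_ideal pred0 f -> f = 0 by move=> f0; apply: mfpsP => m; apply: f0.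
  have [] := @var_ideal_prime _ _ pred0 a b; first by rewrite ab0; apply: var_ideal0.
    by left; apply: var0.
  by right; apply: var0.
- have [[P0 P1 PM] Por] := Pp i iL; split=> /=.
  + by rewrite -(subrr 0) A1_projB subrr.
  + by move=> x y _ _ Px Py; rewrite A1_projD -[A1_proj x]mul1r PM.
  + by move=> a x _ _ Px; rewrite A1_projM -[_ * _]addr0 PM.
  + by rewrite A1_proj1; apply/negP.
  by move=> a b _ _; rewrite A1_projM => /Por/orP.
- split=> [x _ ->|].
    by rewrite -(subrr 0) A1_projB subrr; have [[]] := Pp 0%N isT.
  exists Q; split; [exact: in_vars_full| |exact: A1_form_neq0].
  have -> : A1_proj Q = 0 by apply/A1_proj_eq0; exists 1; rewrite mul1r.
  by have [[]] := Pp 0%N isT.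
have [inc [r rP rnP]] := Pinc i iL; split=> [x _ /inc //|].
have [f fr] := A1_proj_surj r; exists f; rewrite fr; split=> //; first exact: in_vars_full.
exact/negP.
Qed.

End A1Dimension.

(** * Power series modulo q-th powers of the variables *)

Section Nesting.
Variables (F : fieldType) (q : nat).
Variables (W : vectType F) (T : 'End(W)) (b : nat).
Implicit Types (G H : seq nat -> F).

(** Multiplication by a sum of products of consecutive variables, on coefficient
    functions indexed by lists of exponents; op handles the last b variables. *)
Fixpoint pairs_op (op : (seq nat -> F) -> seq nat -> F) m G l : F :=
  if m is m'.+1 then
    if l is i :: j :: l' then
      (if (0 < i)%N && (0 < j)%N then G (i.-1 :: j.-1 :: l') else 0)
      + pairs_op op m' (fun l'' => G (i :: j :: l'')) l'
    else 0
  else op G l.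

Variables (nest0 : (seq nat -> F) -> W) (op : (seq nat -> F) -> seq nat -> F).
Hypothesis nest0B : forall G H, nest0 (fun l => G l - H l) = nest0 G - nest0 H.
Hypothesis nest0_op : forall G, nest0 (op G) = T (nest0 G).
Hypothesis nest0_eq0 : forall G, nest0 G = 0 <->
  forall l, size l = b -> all (fun i => i < q)%N l -> G l = 0.
Hypothesis nest0_surj : forall w, exists G, nest0 G = w.

(** Groups the exponents in pairs, as the tower of pairs of variables requires. *)
Fixpoint nest m G : tower_space W q m :=
  if m is m'.+1 then
    [ffun p : 'I_q * 'I_q => nest m' (fun l => G [:: p.1 : nat, p.2 : nat & l])]
  else nest0 G.

Lemma nestB m G H : nest m (fun l => G l - H l) = nest m G - nest m H.
Proof.
elim: m G H => [|m IHm] G H /=; first exact: nest0B.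
by apply/ffunP => p; rewrite !ffunE -IHm.
Qed.

Lemma nest_eq0 m G : nest m G = 0 <->
  forall l, size l = (m.*2 + b)%N -> all (fun i => i < q)%N l -> G l = 0.
Proof.
elim: m G => [|m IHm] G /=; first exact: nest0_eq0.
split=> [/ffunP G0 [|i [|j l]] //= [sl] /and3P[iq jq lq]|G0].
  have := G0 (Ordinal iq, Ordinal jq); rewrite !ffunE /= => /IHm; apply=> //.
apply/ffunP => -[i j]; rewrite !ffunE; apply/IHm => l sl lq /=.
by apply: G0; rewrite /= ?ltn_ord // sl.
Qed.

Lemma eq_nest m G H : (forall l, size l = (m.*2 + b)%N -> G l = H l) -> nest m G = nest m H.
Proof.
move=> GH; apply/eqP; rewrite -subr_eq0 -nestB; apply/eqP/nest_eq0 => l sl _.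
by rewrite GH ?subrr.
Qed.

Lemma nest0_zero m : nest m (fun=> 0) = 0.
Proof. by apply/nest_eq0. Qed.

Lemma nestD m G H : nest m (fun l => G l + H l) = nest m G + nest m H.
Proof.
have nestN : nest m (fun l => - H l) = - nest m H.
  rewrite -[RHS]sub0r -(nest0_zero m) -nestB; apply: eq_nest => l _.
  by rewrite sub0r.
by rewrite -[nest m H]opprK -nestN -nestB; apply: eq_nest => l _; rewrite opprK.
Qed.

Lemma nest_pairs_op m G : nest m (pairs_op op m G) = tower_op T q m (nest m G).
Proof.
elim: m G => [|m IHm] G /=; first exact: nest0_op.
apply/ffunP => -[[i iq] [j jq]].
have iq1 : (i.-1 < q)%N by lia.
have jq1 : (j.-1 < q)%N by lia.
rewrite (pairTE _ _ _ _ iq1 jq1) !ffunE /= nestD IHm; congr (_ + _).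
by case: ifP => // _; rewrite nest0_zero.
Qed.

Lemma nest_surj m v : exists G, nest m G = v.
Proof.
elim: m v => [|m IHm] v; first exact: nest0_surj.
have [H HP] := choice (fun p => IHm (v p)).
exists (fun l => if l is i :: j :: l' then
  oapp (fun i' => oapp (fun j' => H (i', j') l') 0 (insub j)) 0 (insub i) else 0).
by apply/ffunP => -[i j]; rewrite ffunE /= !valK /= -HP.
Qed.

End Nesting.

Section CoefficientLists.
Import mpoly.
Variables (n : nat) (F : fieldType).
Implicit Types f g : mfps n F.

Definition coef_list f (l : seq nat) : F :=
  mfps_coef f [multinom nth 0%N l i | i < n].

Lemma coef_list_varM f p i l (sn : (size p < n)%N) :
  coef_list (mfps_var F (Ordinal sn) * f) (p ++ i :: l) =
  if (0 < i)%N then coef_list f (p ++ i.-1 :: l) else 0.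
Proof.
rewrite /coef_list mfps_coef_varM mnmE nth_cat /= ltnn subnn /=; case: ifP => // i0.
congr (mfps_coef _ _); apply/mnmP => j; rewrite mnmBE !mnmE -val_eqE /= !nth_cat.
case: (ltngtP j (size p)) => [jp|pj|->]; rewrite ?subn0 //.
  by rewrite -(subnSK pj).
by rewrite subnn /= subn1.
Qed.

Lemma coef_list_eq0 q f : (forall l, size l = n -> all (fun i => i < q)%N l -> coef_list f l = 0) <->
  mfps_low q f = 0.
Proof.
split=> [f0|f0 l sl lq].
  apply: mfpsP => m /=; case: forallP => // mq.
  rewrite -[m](_ : [multinom nth 0%N (val m) i | i < n] = m); first apply: f0.
  - exact: size_tuple.
  - by apply/all_tnthP => i; exact: mq.
  by apply/mnmP => i; rewrite mnmE -mnm_nth.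
have /= := congr1 (fun h => mfps_coef h [multinom nth 0%N l i | i < n]) f0.
case: forallP => // -[] i; rewrite mnmE; apply: (allP lq); apply: mem_nth.
by rewrite sl.
Qed.

Lemma coef_list_surj (G : seq nat -> F) : exists f, forall l, size l = n -> coef_list f l = G l.
Proof.
exists (MFPS (fun m : 'X_{1..n} => G (val m))) => l sl; rewrite /coef_list.
set m := [multinom _ | _ < _]; suff <- : val m = l :> seq nat by [].
apply: (@eq_from_nth _ 0%N) => [|i]; first by rewrite sl size_tuple.
rewrite size_tuple => il; rewrite -[i]/(nat_of_ord (Ordinal il)).
by rewrite -mnm_nth mnmE.
Qed.

End CoefficientLists.
#[global] Arguments coef_list : simpl never.

Section Truncation.
Variable d : nat.
Local Notation S := (mfps d.+1 'F_2).
Local Notation Q := (A1_form d).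

(** Multiplication by the square of the last variable when d is even. *)
Definition last_op (G : seq nat -> 'F_2) (l : seq nat) : 'F_2 :=
  if odd d then 0 else
  if l is i :: l' then (if (1 < i)%N then G (i.-2 :: l') else 0) else 0.

Lemma coef_list_A1_varM (f : S) p i l k : size p = k -> (k <= d)%N ->
  coef_list (A1_var d k * f) (p ++ i :: l) =
  if (0 < i)%N then coef_list f (p ++ i.-1 :: l) else 0.
Proof.
move=> <- pd; have sn : (size p < d.+1)%N by [].
rewrite -(coef_list_varM f i l sn); congr (coef_list (mfps_var _ _ * _) _).
by apply: val_inj; rewrite /= inordK.
Qed.

Lemma coef_list_A1_form (f : S) l : size l = d.+1 ->
  coef_list (Q * f) l = pairs_op last_op (uphalf d) (coef_list f) l.
Proof.
(* s counts the pairs of variables already read, and p lists their exponents. *)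
suff H m s (p l' : seq nat) : size p = s.*2 -> (size p + size l' = d.+1)%N ->
    (s + m = uphalf d)%N ->
    coef_list ((\sum_(s <= i < s + m) A1_var d i.*2 * A1_var d i.*2.+1 +
               (if odd d then 0 else A1_var d d ^+ 2)) * f) (p ++ l') =
    pairs_op last_op m (fun l'' => coef_list f (p ++ l'')) l'.
  move=> sl; have := H (uphalf d) 0%N [::] l erefl sl erefl.
  by rewrite big_mkord.
elim: m s p l' => [|m IHm] s p l' ps pl sm.
  rewrite addn0 big_geq // add0r [RHS]/= /last_op; case: (boolP (odd d)) => d_odd.
    by rewrite mul0r /coef_list.
  have pd : size p = d by rewrite ps; lia.
  case: l' pl => [|i [|j l']] /=; rewrite pd; try lia; move=> _.
  rewrite expr2 -mulrA (coef_list_A1_varM _ _ _ pd) //.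
  by case: i => //= i; rewrite (coef_list_A1_varM _ _ _ pd).
case: l' pl => [|i [|j l']] pl; try by move: pl; rewrite /=; lia.
rewrite big_ltn; last by lia.
rewrite -addrA mulrDl addnS -addSn.
have -> (f1 f2 : S) l1 : coef_list (f1 + f2) l1 = coef_list f1 l1 + coef_list f2 l1 by [].
have := IHm s.+1 (p ++ [:: i; j]) l'; rewrite -!catA /= => ->.
- congr (_ + _); last by congr pairs_op; apply/funext => l''; rewrite -catA.
  have sd : (s.*2.+1 <= d)%N by move: pl; rewrite ps /=; lia.
  rewrite -mulrA (coef_list_A1_varM _ _ _ ps) ?(ltnW sd) //.
  case: i pl => //= i pl; have pi1 : size (p ++ [:: i]) = s.*2.+1 by rewrite size_cat addn1 ps.
  by have := coef_list_A1_varM f j l' pi1 sd; rewrite -!catA.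
- by rewrite size_cat ps doubleS /= addn2.
- by rewrite size_cat -pl /=; lia.
by lia.
Qed.

(** tr identifies the series modulo the q-th powers of the variables with V, and
    multiplication by the quadric with T. *)
Record truncation (q : nat) (V : vectType 'F_2) (T : 'End(V)) (tr : S -> V) : Prop := {
  truncB : forall f g, tr (f - g) = tr f - tr g;
  trunc_form : forall f, tr (Q * f) = T (tr f);
  trunc_eq0 : forall f, tr f = 0 <-> mfps_low q f = 0;
  trunc_surj : forall v, exists f, tr f = v }.

Lemma nest_truncation (q b : nat) (W : vectType 'F_2) (T : 'End(W))
    (nest0 : (seq nat -> 'F_2) -> W) :
  (forall G H, nest0 (fun l => G l - H l) = nest0 G - nest0 H) ->
  (forall G, nest0 (last_op G) = T (nest0 G)) ->
  (forall G, nest0 G = 0 <->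
    forall l, size l = b -> all (fun i => i < q)%N l -> G l = 0) ->
  (forall w, exists G, nest0 G = w) ->
  ((uphalf d).*2 + b = d.+1)%N ->
  truncation q (tower_op T q (uphalf d))
    (fun f => nest q nest0 (uphalf d) (coef_list f)).
Proof.
move=> nB nop n0 nsurj sb; split.
- by move=> f g; rewrite -(nestB q nB).
- move=> f; rewrite -(nest_pairs_op nB nop n0).
  by apply: (eq_nest nB n0) => l; rewrite sb => /coef_list_A1_form.
- by move=> f; rewrite (nest_eq0 n0) sb; exact: coef_list_eq0.
move=> v; have [G <-] := nest_surj nsurj v.
have [f fG] := coef_list_surj d.+1 G; exists f.
by apply: (eq_nest nB n0) => l; rewrite sb => /fG.
Qed.

(** Length of the power series ring modulo the quadric and the 2^e-th powers of the
    variables. *)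
Definition A1_length (e : nat) : int :=
  if odd d then (2 ^+ e * 2 ^+ e) ^+ (uphalf d).-1 * 2 ^+ e +
    \sum_(k < e) (2 ^+ e * 2 ^+ k) ^+ (uphalf d).-1 * 2 ^+ k
  else (2 ^+ e * 2 ^+ e) ^+ uphalf d + (2 ^+ e * 2 ^+ e.-1) ^+ uphalf d.

Lemma A1_truncation e : (0 < e)%N -> (0 < d)%N ->
  exists (V : vectType 'F_2) (T : 'End(V)) (tr : S -> V),
    truncation (2 ^ e) T tr /\ (\dim (lker T))%:Z = A1_length e.
Proof.
move=> e_gt0 d_gt0; have char2 := pchar_F2; rewrite /A1_length.
have [d_odd|d_even] := boolP (odd d).
  exists (tower_space ('F_2)^o (2 ^ e) (uphalf d)), (tower_op 0 (2 ^ e) (uphalf d)).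
  exists (fun f => nest (2 ^ e) (fun G => G [::] : ('F_2)^o) (uphalf d) (coef_list f)); split.
    apply: (@nest_truncation _ 0%N) => //.
    - by move=> G; rewrite zero_lfunE /last_op d_odd.
    - by move=> G; split=> [G0 [|//]|] //; apply.
    - by move=> w; exists (fun=> w).
    by rewrite addn0; lia.
  have m_gt0 : (0 < uphalf d)%N by rewrite uphalf_gt0.
  by rewrite -(prednK m_gt0) /= (dim_ker_tower_odd char2).
have eE : e.-1.+1 = e by rewrite prednK.
pose T : 'End({ffun 'I_(2 ^ e) -> ('F_2)^o}) := lpow (jt ('F_2)^o (2 ^ e)) 2.
exists (tower_space {ffun 'I_(2 ^ e) -> ('F_2)^o} (2 ^ e) (uphalf d)), (tower_op T (2 ^ e) (uphalf d)).
exists (fun f => nest (2 ^ e) (fun G => [ffun i : 'I_(2 ^ e) => G [:: i : nat] : ('F_2)^o])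
  (uphalf d) (coef_list f)); split.
  apply: (@nest_truncation _ 1%N).
  - by move=> G H; apply/ffunP => i; rewrite !ffunE.
  - move=> G; apply/ffunP => -[i iq]; have iq2 : (i - 2 < 2 ^ e)%N by lia.
    rewrite lpowE (iter_jtE _ _ iq2) !ffunE /last_op (negPf d_even) /=.
    by case: i iq iq2 => [|[|i]] //= _ _; rewrite !subSS subn0.
  - move=> G; split=> [/ffunP G0 [|i [|//]] //= _ /andP[iq _]|G0].
      by have := G0 (Ordinal iq); rewrite !ffunE.
    by apply/ffunP => i; rewrite !ffunE G0 //= ltn_ord.
  - move=> w; exists (fun l => if l is i :: _ then oapp w 0 (insub i) else 0).
    by apply/ffunP => i; rewrite ffunE valK.
  by lia.
by rewrite /T -eE (dim_ker_tower_even char2).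
Qed.

End Truncation.

(** * The Hilbert-Kunz function as the dimension of a kernel *)

From mathcomp Require Import classical_sets reals ereal.

(** A subspace contained in X of largest dimension is X. *)
Lemma vspace_of_pred (F : fieldType) (V : vectType F) (X : V -> Prop) :
  X 0 -> (forall a u v, X u -> X v -> X (a *: u + v)) ->
  exists U : {vspace V}, forall v, v \in U <-> X v.
Proof.
move=> X0 XD; suff H (U : {vspace V}) : (forall v, v \in U -> X v) ->
    exists U : {vspace V}, forall v, v \in U <-> X v.
  by apply: (H 0%VS) => v; rewrite memv0 => /eqP->.
have [k] := ubnP (\dim {:V} - \dim U); elim: k U => // k IHk U kU UX.
have [XU|/existsNP[v /not_implyP[Xv vU]]] := pselect (forall v, X v -> v \in U).
  by exists U => v; split; [apply: UX|apply: XU].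
apply: (IHk (U + <[v]>)%VS).
  have v0 : v != 0 by apply: contra_notN vU => /eqP->; apply: mem0v.
  have dU : (\dim (U + <[v]>) = \dim U + 1)%N.
    rewrite dimv_disjoint_sum ?dim_vline ?v0 //; apply/eqP; rewrite -subv0; apply/subvP => w.
    rewrite memv_cap memv0 => /andP[wU /vlineP[a wv]]; apply: contraT => w0.
    case: vU; have a0 : a != 0 by apply: contra w0; rewrite wv => /eqP->; rewrite scale0r.
    by rewrite -[v](scalerK a0) -wv memvZ.
  have : (\dim (U + <[v]>) <= \dim {:V})%N by apply/dimvS/subvf.
  by rewrite dU; lia.
move=> w /memv_addP[u uU [_ /vlineP[a ->] ->]]; rewrite addrC.
by apply: XD => //; apply: UX.
Qed.

Section QuotientLength.
Local Open Scope quotient_scope.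
Variables (d e : nat).
Local Notation S := (mfps d.+1 'F_2).
Local Notation R := (A1_ring d).
Local Notation Q := (A1_form d).
Local Notation q := (2 ^ e)%N.
Variables (V : vectType 'F_2) (T : 'End(V)) (tr : S -> V).
Hypothesis trP : truncation q T tr.

Let tr0 : tr 0 = 0.
Proof. by rewrite -(subrr 0) (truncB trP) subrr. Qed.

Let trN f : tr (- f) = - tr f.
Proof. by rewrite -sub0r (truncB trP) tr0 sub0r. Qed.

Let trD f g : tr (f + g) = tr f + tr g.
Proof. by rewrite -[g]opprK (truncB trP) !trN. Qed.

(** The elements of the ideal generated by the quadric and the q-th powers of the variables. *)
Definition quadric_ideal (f : S) : Prop := exists g, tr (f - g * Q) = 0.

Lemma quadric_idealE f : quadric_ideal f <-> tr f \in limg T.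
Proof.
split=> [[g /eqP]|/memv_imgP[v _ tfv]].
  rewrite (truncB trP) subr_eq0 mulrC (trunc_form trP) => /eqP->.
  exact/memv_img/memvf.
have [g gv] := trunc_surj trP v; exists g.
by rewrite (truncB trP) mulrC (trunc_form trP) gv -tfv subrr.
Qed.

Lemma low_eq0M (f g : S) : mfps_low q f = 0 -> mfps_low q (g * f) = 0.
Proof.
move=> f0; apply: mfpsP => m; rewrite mfps_lowE; case: forallP => // mq; rewrite mfps_coefM big1 // => k km.
have := congr1 (fun h => mfps_coef h (mpoly.mnm_sub m (mpoly.bmnm k))) f0; rewrite mfps_lowE.
case: forallP => [_ ->|[]]; first by rewrite mulr0.
by move=> i; rewrite mpoly.mnmBE; apply: leq_ltn_trans (mq i); apply: leq_subr.
Qed.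

Lemma trunc_eq0M f g : tr f = 0 -> tr (g * f) = 0.
Proof. by move=> /(trunc_eq0 trP) f0; apply/(trunc_eq0 trP)/low_eq0M. Qed.

Lemma trunc_varX i f : tr (mfps_var _ i ^+ q * f) = 0.
Proof.
apply/(trunc_eq0 trP)/mfpsP => m; rewrite mfps_lowE; case: forallP => // mq.
by rewrite mfps_coef_varXM leqNgt mq.
Qed.

Lemma quadric_ideal0 : quadric_ideal 0.
Proof. by exists 0; rewrite mul0r subr0 tr0. Qed.

Lemma quadric_idealD f g : quadric_ideal f -> quadric_ideal g -> quadric_ideal (f + g).
Proof. by move=> /quadric_idealE fT /quadric_idealE gT; apply/quadric_idealE; rewrite trD rpredD. Qed.

Lemma quadric_idealM f g : quadric_ideal f -> quadric_ideal (g * f).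
Proof. by case=> h fh; exists (g * h); rewrite -mulrA -mulrBr; apply: trunc_eq0M. Qed.

Lemma quadric_ideal_form g : quadric_ideal (g * Q).
Proof. by exists g; rewrite subrr tr0. Qed.

Lemma quadric_ideal_eq f g : A1_proj f = A1_proj g -> quadric_ideal f -> quadric_ideal g.
Proof.
move=> fg fJ; have [h hE] : exists h, g - f = h * Q.
  by apply/A1_proj_eq0; rewrite A1_projB fg subrr.
by rewrite -(subrK f g) hE; apply: quadric_idealD => //; apply: quadric_ideal_form.
Qed.

(** A series with a nonzero constant term is regular of order 0 in any variable. *)
Lemma A1_nonunit f : @nonunits R (A1_proj f) <-> mfps_coef f mpoly.mnm0 = 0.
Proof.
split=> [nu|f0 r].
  apply: contrapT => /eqP f0; have freg : regular_in ord_max 0 f.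
    by split=> // ; rewrite (_ : mpoly.mnm_muln _ 0 = mpoly.mnm0).
  have [u _ uf] := @regular_in_unit _ _ ord_max f (@in_vars_full _ _ f) freg.
  by apply: (nu (A1_proj u)); rewrite mulrC -A1_projM uf A1_proj1.
have [g <-] := A1_proj_surj r; rewrite -A1_projM -A1_proj1 => fg1.
have [h hE] : exists h, f * g - 1 = h * Q by apply/A1_proj_eq0; rewrite A1_projB fg1 subrr.
have Q0 : mfps_coef Q mpoly.mnm0 = 0.
  rewrite mfps_coefD mfps_coef_sum big1 => [|i _]; last by rewrite mfps_coef0M mfps_var_coef0 mul0r.
  by rewrite add0r; case: ifP => // _; rewrite expr2 mfps_coef0M mfps_var_coef0 mul0r.
have := congr1 (fun x => mfps_coef x mpoly.mnm0) hE.
rewrite mfps_coefB !mfps_coef0M f0 Q0 mul0r mulr0 mfps_coef1 eqxx sub0r => /eqP.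
by rewrite oppr_eq0 oner_eq0.
Qed.

Lemma exprD_F2 (x y : S) : (x + y) ^+ q = x ^+ q + y ^+ q.
Proof.
elim: e => [|k IHk]; first by rewrite !expr1.
by rewrite expnSr !exprM IHk sqrrD -mulr_natl mulr2n addff_F2 mul0r addr0.
Qed.

Lemma quadric_ideal_nonunitX f : mfps_coef f mpoly.mnm0 = 0 -> quadric_ideal (f ^+ q).
Proof.
move=> f0; exists 0; rewrite mul0r subr0.
have [g ->] := mfps_decomp 1 f; rewrite mfps_low1 f0 (_ : mfps_const _ 0 = 0) ?add0r; last first.
  by apply: mfpsP => m /=; case: eqP.
elim/big_ind: _ => [|x y x0 y0|i _]; first by rewrite expr0n gtn_eqF ?expn_gt0.
  by rewrite exprD_F2 trD x0 y0 addr0.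
by rewrite exprMn expr1 trunc_varX.
Qed.

Local Notation Frob := (@frobenius_power R q).

(** Frobenius is additive and the non-units are combinations of the variables, so the
    Frobenius power is generated by the q-th powers of the variables. *)
Lemma mem_frobenius_power f : (A1_proj f \in Frob) <-> quadric_ideal f.
Proof.
split=> [/asboolP fF|[g fg]].
  pose I : {pred R^o} := fun r => `[< exists2 f', A1_proj f' = r & quadric_ideal f' >].
  have /asboolP[f' f'f] : A1_proj f \in I; last exact: quadric_ideal_eq.
  apply: fF.
    split=> [|a x y /asboolP[fx <- xJ] /asboolP[fy <- yJ]]; apply/asboolP.
      by exists 0; [rewrite -(subrr 0) A1_projB subrr|exact: quadric_ideal0].
    have [fa <-] := A1_proj_surj a; exists (fa * fx + fy).
      by rewrite A1_projD A1_projM.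
    by apply: quadric_idealD => //; apply: quadric_idealM.
  move=> _ [a nua <-]; apply/asboolP; have [fa faE] := A1_proj_surj a.
  exists (fa ^+ q); first by rewrite -faE; elim: q => [|k IHk]; rewrite ?A1_proj1 // !exprS A1_projM IHk.
  by apply/quadric_ideal_nonunitX/A1_nonunit; rewrite faE.
have [F0 FM] := ideal_span_closed [set a ^+ q | a in @nonunits R]%classic.
have FD (x y : R) : x \in Frob -> y \in Frob -> x + y \in Frob.
  by move=> xF yF; rewrite -[x]mul1r; apply: FM.
have FMl (a x : R) : x \in Frob -> a * x \in Frob.
  by move=> xF; rewrite -[_ * _]addr0; apply: FM.
move: fg => /(trunc_eq0 trP); have [h] := mfps_decomp q (f - g * Q) => + f0.
rewrite f0 add0r => fE.
have -> : A1_proj f = A1_proj (\sum_i mfps_var _ i ^+ q * h i).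
  rewrite -fE A1_projB (_ : A1_proj (g * Q) = 0) ?subr0 //.
  by apply/A1_proj_eq0; exists g.
elim/big_ind: _ => [|x y xF yF|i _]; first by rewrite -(subrr 0) A1_projB subrr.
  by rewrite A1_projD FD.
rewrite mulrC A1_projM FMl //; apply/asboolP => I _; apply.
exists (A1_proj (mfps_var _ i)); first by apply/A1_nonunit/mfps_var_coef0.
by elim: q => [|k IHk]; rewrite ?A1_proj1 // !exprS A1_projM IHk.
Qed.

End QuotientLength.

(** * Lengths of modules presented by a vector space *)

Section LengthDimension.
Variables (R : pzRingType) (M : lmodType R) (V : vectType 'F_2) (p : V -> M).
Variable U0 : {vspace V}.
Hypothesis pD : forall u v, p (u + v) = p u + p v.
Hypothesis p_surj : forall x, exists v, p v = x.
Hypothesis p_eq0 : forall v, p v = 0 <-> v \in U0.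

Let p0 : p 0 = 0.
Proof. by apply/p_eq0/mem0v. Qed.

Let submodD (N : {pred M}) x y : submod_closed N -> x \in N -> y \in N -> x + y \in N.
Proof. by move=> [_ ND] xN yN; rewrite -[x]scale1r ND. Qed.

Let submodZ (N : {pred M}) a x : submod_closed N -> x \in N -> a *: x \in N.
Proof. by move=> [N0 ND] xN; rewrite -[_ *: _]addr0 ND. Qed.

Lemma F2_case (a : 'F_2) : a = 0 \/ a = 1.
Proof. by case: a => [[|[|n]] hn]; [left|right|]; try exact: val_inj. Qed.

Lemma preim_submodule (N : {pred M}) : submod_closed N ->
  exists U : {vspace V}, forall v, v \in U <-> p v \in N.
Proof.
move=> Ncl; apply: vspace_of_pred; first by rewrite p0; case: Ncl.
move=> a u v uN vN; rewrite pD; apply: submodD => //.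
by case: (F2_case a) => ->; rewrite ?scale1r // scale0r p0; case: Ncl.
Qed.

Lemma submodule_chain_le n : submodule_chain M n -> (n <= \dim {:V} - \dim U0)%N.
Proof.
move=> [N [Ncl Nlt]].
suff H i : (i <= n)%N -> exists2 U : {vspace V},
    (forall v, v \in U <-> p v \in N i) & (\dim U0 + i <= \dim U)%N.
  have [U _] := H n (leqnn n); have := dimvS (subvf U).
  by move=> + Un; have := Un; lia.
elim: i => [_|i IHi lin].
  have [U UE] := preim_submodule (Ncl 0%N isT); exists U => //.
  rewrite addn0; apply/dimvS/subvP => v /p_eq0 pv0; apply/UE; rewrite pv0.
  by case: (Ncl 0%N isT).
have [U UE dU] := IHi (ltnW lin).
have [U' UE'] := preim_submodule (Ncl _ lin); exists U' => //.
have [sN [x xN' xN]] := Nlt _ lin; have [v vx] := p_surj x.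
rewrite addnS; apply: leq_ltn_trans dU _; have sU : (U <= U')%VS.
  by apply/subvP => u /UE uN; apply/UE'/sN.
rewrite (ltn_leqif (dimv_leqif_sup sU)); apply/negP => /subvP /(_ v).
have -> : v \in U' by apply/UE'; rewrite vx.
by move=> /(_ isT)/UE; rewrite vx; apply/negP.
Qed.

Hypothesis socle : forall N : {pred M}, submod_closed N -> (exists x, x \notin N) ->
  exists2 x, x \notin N & forall r : R, (r *: x \in N) || (r *: x - x \in N).

(** The union of N and x + N is again a submodule when every scalar acts on x as 0 or 1
    modulo N, and its preimage is larger by at most one dimension. Hence a chain can be
    continued until the dimension of V is reached. *)
Lemma submodule_chain_dim : submodule_chain M (\dim {:V} - \dim U0).
Proof.
suff H k : (k <= \dim {:V} - \dim U0)%N -> exists N : nat -> {pred M},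
    [/\ forall i, (i <= k)%N -> submod_closed (N i),
        forall i, (i < k)%N -> {subset N i <= N i.+1} /\ exists2 x, x \in N i.+1 & x \notin N i
      & forall U : {vspace V}, (forall v, v \in U <-> p v \in N k) -> (\dim U <= \dim U0 + k)%N].
  by have [N [? ? _]] := H _ (leqnn _); exists N.
elim: k => [_|k IHk lek].
  exists (fun=> (fun x : M => x == 0) : {pred M}); split=> // [i _|U UE].
    by split=> [|a x y]; rewrite !unfold_in ?eqxx // => /eqP-> /eqP->; rewrite scaler0 addr0.
  rewrite addn0; apply/dimvS/subvP => v /UE; rewrite unfold_in => /eqP; exact/(p_eq0 v).1.
have [N [Ncl Nlt dN]] := IHk (ltnW lek).
have [U UE] := preim_submodule (Ncl k (leqnn k)).
have Nproper : exists x, x \notin N k.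
  apply: contrapT => /forallNP Nfull; suff : (\dim {:V} <= \dim U0 + k)%N by lia.
  apply: leq_trans (dN U UE); apply/dimvS/subvP => v _; apply/UE.
  by apply: contraT => /Nfull.
have [x xN xS] := socle (Ncl k (leqnn k)) Nproper.
pose N' : {pred M} := fun y => (y \in N k) || (y - x \in N k).
have N'E y : (y \in N') = (y \in N k) || (y - x \in N k) by [].
have ND y z := @submodD (N k) y z (Ncl k (leqnn k)).
have NZ a y := @submodZ (N k) a y (Ncl k (leqnn k)).
have NN y : y \in N k -> - y \in N k by move=> yN; rewrite -scaleN1r NZ.
have N0 : 0 \in N k by case: (Ncl k (leqnn k)).
have xx : x + x \in N k.
  have := xS (-1); rewrite scaleN1r => /orP[/NN|/NN]; last by rewrite opprD !opprK.
  by rewrite opprK (negPf xN).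
have N'cl : submod_closed N'.
  have N'D y z : y \in N' -> z \in N' -> y + z \in N'.
    rewrite !N'E.
    move=> /orP[hy|hy] /orP[hz|hz].
    - by rewrite (ND y z).
    - by rewrite -addrA (ND y (z - x)) ?orbT.
    - by rewrite [y + z - x]addrAC (ND (y - x) z) ?orbT.
    by rewrite -{1}(subrK x y) -{1}(subrK x z) addrACA (ND _ (x + x)) // (ND (y - x)).
  split=> [|a y z yN' zN']; first by rewrite N'E N0.
  apply: N'D zN'; move: yN'; rewrite !N'E => /orP[yN|yN].
    by rewrite NZ.
  have -> : a *: y = a *: (y - x) + a *: x by rewrite scalerBr subrK.
  have aN := NZ a _ yN; case/orP: (xS a) => axN; first by rewrite (ND (a *: (y - x)) (a *: x)).
  by rewrite -addrA (ND (a *: (y - x)) (a *: x - x)) ?orbT.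
exists (fun i => if (i <= k)%N then N i else N'); split=> [i lik|i lik|U' UE'].
- by case: ifP => // ik; apply: Ncl.
- rewrite ltnS in lik; rewrite lik; case: ifP => [ik|ik]; first exact: Nlt.
  have -> : i = k by lia.
  split=> [y yN|]; first by rewrite N'E yN.
  by exists x => //; rewrite N'E subrr N0 orbT.
rewrite ltnn in UE'; have [w wx] := p_surj x.
have sU : (U' <= U + <[w]>)%VS.
  apply/subvP => v /UE'; rewrite N'E => /orP[/UE vU|vN].
    by rewrite -[v]addr0 memv_add ?mem0v.
  rewrite -(subrK w v) memv_add ?memv_line //; apply/UE.
  suff -> : p (v - w) = p v - x by [].
  by apply: (addIr x); rewrite subrK -wx -pD subrK.
apply: leq_trans (dimvS sU) _; apply: leq_trans (dimv_add_leqif _ _) _.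
have := dN U UE; rewrite dim_vline; case: (w != 0); lia.
Qed.

Lemma module_length_dim (K : realType) :
  module_length K M = (\dim {:V} - \dim U0)%:R%:E.
Proof.
apply/eqP; rewrite eq_le; apply/andP; split.
  apply: ge_ereal_sup => _ [n /submodule_chain_le nD <-].
  by rewrite lee_fin ler_nat.
by apply: ereal_sup_ubound; exists (\dim {:V} - \dim U0)%N => //; apply: submodule_chain_dim.
Qed.

End LengthDimension.

(** * The Hilbert-Kunz function and the dimension of the quadric *)

Section HilbertKunzA1.
Local Open Scope quotient_scope.
Variables (K : realType) (d : nat).
Hypothesis d_gt1 : (1 < d)%N.
Local Notation S := (mfps d.+1 'F_2).
Local Notation R := (A1_ring d).

Section Frobenius.
Variable e : nat.
Local Notation q := (2 ^ e)%N.
Local Notation M := (quot_module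
  (ideal_span_closed _ : submod_closed (@frobenius_power R q))).
Variables (V : vectType 'F_2) (T : 'End(V)) (tr : S -> V).
Hypothesis trP : truncation q T tr.

Let pM (f : S) : M := \pi_M (A1_proj f : R^o).

Let pM_eq0 f : pM f = 0 <-> quadric_ideal tr f.
Proof.
rewrite -(mem_frobenius_power trP) -[0](raddf0 \pi_M).
have -> : (pM f = \pi_M 0) <-> (pM f == \pi_M 0) by split=> /eqP.
by rewrite /pM -Quotient.idealrBE subr0.
Qed.

Let pMD f g : pM (f + g) = pM f + pM g.
Proof. by rewrite /pM A1_projD raddfD. Qed.

Let pMZ g f : A1_proj g *: pM f = pM (g * f).
Proof. by rewrite /pM A1_projM; apply: pi_scale. Qed.

Let pM_surj x : exists f, pM f = x.
Proof. by have [f fx] := A1_proj_surj (repr x); exists f; rewrite /pM fx reprK. Qed.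

Let p (v : V) : M := pM (projT1 (cid (trunc_surj trP v))).

Let pE f : p (tr f) = pM f.
Proof.
rewrite /p; case: cid => g /= gf; apply/eqP; rewrite -subr_eq0; apply/eqP.
have -> : pM g - pM f = pM (g - f) by apply/eqP; rewrite subr_eq -pMD subrK.
by apply/pM_eq0; exists 0; rewrite mul0r subr0 (truncB trP) gf subrr.
Qed.

(** An element outside N is multiplied by each variable in turn as often as it stays outside N,
    which stops because the q-th powers act as 0. Then all the variables send
    it into N, and a scalar acts through its constant term in F_2. *)
Lemma frobenius_socle (N : {pred M}) : submod_closed N -> (exists x, x \notin N) ->
  exists2 x, x \notin N & forall r : R, (r *: x \in N) || (r *: x - x \in N).
Proof.
move=> [N0 ND] [x0 x0N].
have NZ a x : x \in N -> a *: x \in N by move=> xN; rewrite -[_ *: _]addr0 ND.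
have [f fN fV] : exists2 f, pM f \notin N & forall i : 'I_d.+1, pM (mfps_var _ i * f) \in N.
  suff H k : (k <= d.+1)%N -> exists2 f, pM f \notin N &
      forall i : 'I_d.+1, (i < k)%N -> pM (mfps_var _ i * f) \in N.
    by have [f fN fV] := H _ (leqnn _); exists f => // i; apply: fV.
  elim: k => [_|k IHk kd]; first by have [f fx] := pM_surj x0; exists f; rewrite ?fx.
  have [f fN fV] := IHk (ltnW kd); pose X : S := mfps_var _ (Ordinal kd).
  have exN : exists j, pM (X ^+ j * f) \in N.
    exists q; rewrite (_ : pM _ = 0) //; apply/pM_eq0; exists 0.
    by rewrite mul0r subr0 (trunc_varX trP).
  case: (ex_minnP exN) => [[|j] jN jmin]; first by rewrite expr0 mul1r (negPf fN) in jN.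
  exists (X ^+ j * f) => [|i]; first by apply/negP => /jmin; rewrite ltnn.
  rewrite ltnS leq_eqVlt => /orP[/eqP ik|ik]; last by rewrite mulrCA -pMZ NZ ?fV.
  by rewrite (_ : i = Ordinal kd) ?mulrA -?exprS //; apply: val_inj.
exists (pM f) => // r; have [g <-] := A1_proj_surj r; rewrite pMZ.
have [h ->] := mfps_decomp 1 g; rewrite mulrDl pMD.
have hN : pM ((\sum_i mfps_var 'F_2 i ^+ 1 * h i) * f) \in N.
  elim/big_ind: _ => [|x y xN yN|i _].
  - by rewrite mul0r -[0](mulr0 0) -pMZ (_ : pM 0 = 0) ?scaler0 //; apply/pM_eq0/(quadric_ideal0 trP).
  - by rewrite mulrDl pMD -[pM _]scale1r ND.
  by rewrite expr1 [_ * h i]mulrC -mulrA -pMZ NZ.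
rewrite mfps_low1; case: (F2_case (mfps_coef g mpoly.mnm0)) => ->.
  rewrite (_ : mfps_const _ 0 = 0) ?mul0r; last by apply: mfpsP => m /=; case: eqP.
  by rewrite (_ : pM 0 = 0) ?add0r ?hN //; apply/pM_eq0/(quadric_ideal0 trP).
rewrite (_ : mfps_const _ 1 = 1) ?mul1r; last by apply: mfpsP => m /=; case: eqP.
by rewrite addrAC subrr add0r hN orbT.
Qed.

Lemma hilbert_kunz_ker : hilbert_kunz K R 2 e = (\dim (lker T))%:R%:E.
Proof.
rewrite /hilbert_kunz.
rewrite (@module_length_dim R M V p (limg T)).
- congr (_%:R%:E); have := limg_ker_dim T fullv; rewrite capfv; lia.
- move=> u v; have [f <-] := trunc_surj trP u; have [g <-] := trunc_surj trP v.
  rewrite (_ : tr f + tr g = tr (f + g)) ?pE ?pMD //.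
  by rewrite -{2}[g]opprK (truncB trP) -[- g]sub0r (truncB trP) -(subrr 0) (truncB trP) !subrr sub0r opprK.
- by move=> x; have [f <-] := pM_surj x; exists (tr f); rewrite pE.
- move=> v; have [f <-] := trunc_surj trP v; rewrite pE -(quadric_idealE trP).
  exact: pM_eq0.
exact: frobenius_socle.
Qed.

End Frobenius.

Lemma hilbert_kunz_A1 e : (0 < e)%N ->
  hilbert_kunz K R 2 e = (A1_length d e)%:~R%:E.
Proof.
move=> e_gt0; have [V [T [tr [trP <-]]]] := A1_truncation e_gt0 (ltnW d_gt1).
by rewrite (hilbert_kunz_ker trP).
Qed.

Lemma krull_dim_A1 : krull_dim K R = d%:R%:E.
Proof.
apply/eqP; rewrite eq_le; apply/andP; split.
  apply: ge_ereal_sup => _ [n /(A1_prime_chain_le d_gt1) nd <-].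
  by rewrite lee_fin ler_nat.
by apply: ereal_sup_ubound; exists d => //; apply: A1_prime_chain.
Qed.

End HilbertKunzA1.

(** * Closed forms and the limit *)

From mathcomp Require Import topology normedtype sequences.
Import numFieldNormedType.Exports.

Section ClosedForms.
Variable K : realType.

(** Up to the factor 2^(n e), the sum is geometric of ratio 2^(n+1). *)
Lemma A1_length_odd n e :
  (A1_length n.*2.+1 e)%:~R = 2 ^+ n.+1 / (2 ^+ n.+1 - 1) * 2 ^+ (n.*2.+1 * e)
    - (2 ^+ n) ^+ e / (2 ^+ n.+1 - 1) :> K.
Proof.
have a1 : 1 <= 2 ^+ n :> K by rewrite exprn_ege1 // ler1n.
have a0 : 2 * 2 ^+ n - 1 != 0 :> K by apply: lt0r_neq0; lra.
rewrite /A1_length oddS odd_double (_ : (uphalf n.*2.+1).-1 = n) ?[~~ _]/=; last by rewrite /= doubleK.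
set a : K := 2 ^+ n in a1 a0 *.
have aE k : ((2 ^+ e * 2 ^+ k) ^+ n)%:~R = a ^+ e * a ^+ k :> K.
  by rewrite rmorphXn rmorphM !rmorphXn /= exprMn -!exprM ![(n * _)%N]mulnC.
rewrite intrD intrM aE rmorphXn rmorph_sum /=.
under eq_bigr => k _ do rewrite intrM aE rmorphXn /= -mulrA -exprMn.
rewrite -mulr_sumr [2 ^+ n.+1]exprS -/a exprM.
have -> : 2 ^+ n.*2.+1 = (a * 2) * a by rewrite exprS -addnn exprD -/a mulrCA mulrA.
rewrite !exprMn -[2%:~R]/(2 : K); apply: (mulfI a0).
set s := \sum_(i < e) _; set x := a ^+ e; set y := 2 ^+ e.
have sE : (2 * a - 1) * s + 1 = x * y by rewrite [2 * a]mulrC -subrX1 subrK exprMn.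
have -> : (2 * a - 1) * (2 * a / (2 * a - 1) * (x * y * x) - x / (2 * a - 1)) =
    2 * a * (x * y * x) - x by field.
apply/eqP; rewrite -subr_eq0; apply/eqP.
transitivity (x * ((2 * a - 1) * s + 1 - x * y)); first by ring.
by rewrite sE subrr mulr0.
Qed.

Lemma A1_length_even m e : (0 < e)%N ->
  (A1_length m.*2 e)%:~R = (2 ^+ m + 1) / 2 ^+ m * 2 ^+ (m.*2 * e) :> K.
Proof.
case: e => // e _; rewrite /A1_length odd_double uphalf_double /=.
have a0 : 2 ^+ m != 0 :> K by rewrite expf_neq0 // pnatr_eq0.
set a : K := 2 ^+ m in a0 *.
have aE i k : ((2 ^+ i * 2 ^+ k) ^+ m)%:~R = a ^+ i * a ^+ k :> K.
  by rewrite rmorphXn rmorphM !rmorphXn /= exprMn -!exprM ![(m * _)%N]mulnC.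
rewrite intrD !aE exprM -addnn exprD -/a exprMn.
by rewrite !exprS; field.
Qed.

Local Open Scope classical_set_scope.

Lemma cvg_sub_geometric (a c z : K) : `|z| < 1 -> (fun e => a - c * z ^+ e) @ \oo --> a.
Proof.
move=> z1; have cz : (fun e => c * z ^+ e) @ \oo --> c * 0.
  by apply: cvgM; [exact: cvg_cst|exact: cvg_expr].
by have := cvgB (@cvg_cst _ a _ \oo _) cz; rewrite mulr0 subr0; apply.
Qed.

Lemma is_hk_multiplicity_A1 d (u : nat -> K) (l : K) : (1 < d)%N ->
  (forall e, (0 < e)%N -> hilbert_kunz K (A1_ring d) 2 e = (u e)%:E) ->
  (fun e => u e / 2 ^+ (d * e)) @ \oo --> l ->
  is_hk_multiplicity (A1_ring d) 2 l.
Proof.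
move=> d1 hu ul; exists d; first exact: krull_dim_A1.
apply: (@cvg_trans _ ((fun e => (u e / 2 ^+ (d * e))%:E) @ \oo)); last by apply: cvg_EFin; [exact: nearW|exact: ul].
apply: near_eq_cvg; near=> e.
rewrite hu; last by near: e; exists 1%N.
by rewrite -EFinM natrX mulnC.
Unshelve. all: by end_near.
Qed.

End ClosedForms.

Theorem theorem3p6 (K : realType) (d m : nat) :
  (2 <= d)%N ->
  (d = (2 * m - 1)%N ->
    (forall e : nat, (1 <= e)%N ->
       hilbert_kunz K (A1_ring d) 2 e =
         ((2 ^+ m / (2 ^+ m - 1)) * 2 ^+ (d * e)
            - (2 ^+ (m - 1)) ^+ e / (2 ^+ m - 1))%:E) /\
    is_hk_multiplicity (A1_ring d) 2 (2 ^+ m / (2 ^+ m - 1) : K)) /\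
  (d = (2 * m)%N ->
    (forall e : nat, (1 <= e)%N ->
       hilbert_kunz K (A1_ring d) 2 e =
         ((2 ^+ m + 1) / 2 ^+ m * 2 ^+ (d * e))%:E) /\
    is_hk_multiplicity (A1_ring d) 2 ((2 ^+ m + 1) / 2 ^+ m : K)).
Proof.
move=> d_gt1; split=> dm.
  have [n mE] : exists n, m = n.+1 by case: (m) dm d_gt1 => [|n] *; [lia|exists n].
  have dE : d = n.*2.+1 by lia.
  have HK e : (1 <= e)%N -> hilbert_kunz K (A1_ring d) 2 e =
      ((2 ^+ m / (2 ^+ m - 1)) * 2 ^+ (d * e) - (2 ^+ (m - 1)) ^+ e / (2 ^+ m - 1))%:E.
    move=> e_gt0; rewrite (hilbert_kunz_A1 K d_gt1 e_gt0) mE dE subn1.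
    by rewrite (A1_length_odd K n e).
  split=> //; apply: (is_hk_multiplicity_A1 d_gt1 HK).
  have -> : (fun e => (2 ^+ m / (2 ^+ m - 1) * 2 ^+ (d * e)
      - (2 ^+ (m - 1)) ^+ e / (2 ^+ m - 1)) / 2 ^+ (d * e)) =
      (fun e => 2 ^+ m / (2 ^+ m - 1) - (2 ^+ m - 1)^-1 * (2 ^+ m)^-1 ^+ e) :> (nat -> K).
    apply/funext => e; have x0 k : 2 ^+ k != 0 :> K by rewrite expf_neq0 // pnatr_eq0.
    rewrite mulrBl mulfK //; congr (_ - _).
    rewrite mulrAC mulrC; congr (_ * _).
    have -> : d = (m + (m - 1))%N by lia.
    by rewrite exprM exprD exprMn invfM exprVn mulrCA divff ?mulr1 ?expf_neq0.
  apply: cvg_sub_geometric; rewrite ger0_norm ?invr_ge0 ?exprn_ge0 //.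
  by rewrite invf_lt1 ?exprn_gt0 // exprn_egt1 ?ltr1n // mE.
have HK e : (1 <= e)%N ->
    hilbert_kunz K (A1_ring d) 2 e = ((2 ^+ m + 1) / 2 ^+ m * 2 ^+ (d * e))%:E.
  move=> e_gt0; rewrite (hilbert_kunz_A1 K d_gt1 e_gt0).
  by rewrite (_ : d = m.*2) ?(A1_length_even K m e_gt0) //; lia.
split=> //; apply: (is_hk_multiplicity_A1 d_gt1 HK).
under eq_fun do rewrite mulfK ?expf_neq0 ?pnatr_eq0 //.
exact: cvg_cst.
Qed.
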